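(* Let $0<c\le\infty$ and let $f\in C((-c,c),\mathbb R)$ satisfy: ($f_1$) $f$ is odd, $f(0)=0$, and there exist $0<b<\beta<c$ such that $f(s)>0$ for $s>b$, $f(s)\le 0$ and $f(s)\not\equiv 0$ for $s\in[0,b]$, and $F(\beta)=0$, where $F(s):=\int_0^s f(t)\,dt$; ($f_2$) $f$ is continuously differentiable in $(0,c)$ and $f'\in L^1(0,1)$. Let $q$ satisfy: ($q_1$) $q\in C^1(\mathbb R^+;\mathbb R^+)$, $q\ge 0$, $q(0)=0$ and $q'>0$ on $(0,\infty)$; ($q_2$) $q'/q$ is strictly decreasing on $(0,\infty)$; ($q_3$) with $Q(r):=\int_0^r q(s)\,ds$, (i) the function $H(r):=\left(\frac{Q}{q}\right)'(r)$ is nonincreasing in $(0,\infty)$, with $H(0)<\frac12$ and $H_\infty:=\lim_{r\to\infty}H(r)>0$, and (ii) $q(r)(H(r)-H_\infty)$ is nondecreasing in $(0,\infty)$; ($q_4$) $\frac1q\in L^1(1,\infty)\setminus L^1(0,1)$ and the function $h(r):=q(r)\int_r^\infty\frac{ds}{q(s)}$ satisfies: $h'(r)$ is strictly positive and nonincreasing for all $r>0$, with $\ell_\infty:=\lim_{r\to\infty}h'(r)>0$; ($q_5$) $q'q$ is strictly increasing on $(0,\infty)$. Consider the problem $$(\ast)\qquad (q\,u')'+q(r)f(u)=0,\quad r>0,\qquad u'(0)=0,\qquad \lim_{r\to+\infty}u(r)=0.$$ (i) If $\left(\frac{F}{f}\right)'(s)\ge\frac12(1-2H_\infty)$ for all $s>\beta$,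 and $f(s)\ge f'(s)(s-b)$ for all $s\ge b$, then $(\ast)$ has at most one nonnegative solution satisfying $u(0)>0$, and at most one solution satisfying $u(0)>0$ which has exactly one sign change in $(0,\infty)$. (ii) If $\frac{sf'(s)}{f(s)}$ decreases for all $s>b$, and $\frac{\beta f'(\beta)}{f(\beta)}\le 1+2\ell_\infty$, then $(\ast)$ has at most one nonnegative solution satisfying $u(0)>0$, and at most one solution satisfying $u(0)>0$ which has exactly one sign change in $(0,\infty)$.
   Context: $'$ denotes $\frac{d}{dr}$ for functions of $r$ (and $\frac{d}{ds}$ for functions of $s$). $\mathbb R^+=[0,\infty)$. Conditions on $f$ for large $s$ (such as $s>b$ or $s>\beta$) are understood for $s<c$. $H(0)$ is the limit of $H(r)$ as $r\to0^+$. A solution $u=u(r)$, $r\ge0$, is a classical solution with values in $(-c,c)$. The condition $\frac1q\in L^1(1,\infty)\setminus L^1(0,1)$ means that $1/q$ is integrable on $(1,\infty)$ and not integrable on $(0,1)$. *)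

(* Defs.v *)
From Stdlib Require Export Reals.
From Coquelicot Require Export Coquelicot.
Open Scope R_scope.

(* Functions on R^+ = [0,oo) or on (-c,c) are represented by total functions
   R -> R; nothing is assumed about their values outside these sets. *)

(* g' is the derivative of g on [0,oo), one-sided at 0, and is continuous on
   [0,oo); thus g is in C^1([0,oo)).  At r > 0 this is the usual derivative. *)
Definition C1_Rplus (g g' : R -> R) : Prop :=
  (forall r, 0 <= r ->
     filterlim (fun x => (g x - g r) / (x - r))
       (within (fun x => 0 <= x) (locally' r)) (locally (g' r))) /\
  continuous_on (fun r => 0 <= r) g'.

(* g in L^1(a,b), for g continuous on the open interval (a,b): for such g,
   Lebesgue integrability is convergence of the improper integral of |g|.
   The filters are x -> a+ and x -> b-, or x -> +oo when b = +oo. *)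
Definition L1 (g : R -> R) (a : R) (b : Rbar) : Prop :=
  ex_RInt_gen (fun x => Rabs (g x))
    (at_right a) (within (fun x => Rbar_lt x b) (Rbar_locally b)).

Definition primitive (g : R -> R) (x : R) : R := RInt g 0 x.

Definition in_dom (c : Rbar) (s : R) : Prop := Rbar_lt (Rabs s) c.

Record cond_f1 (c : Rbar) (f : R -> R) (b beta : R) : Prop := {
  f1_odd : forall s, in_dom c s -> f (- s) = - f s;
  f1_zero : f 0 = 0;
  f1_b_pos : 0 < b;
  f1_b_lt_beta : b < beta;
  f1_beta_lt_c : Rbar_lt beta c;
  f1_pos : forall s, b < s -> Rbar_lt s c -> 0 < f s;
  f1_nonpos : forall s, 0 <= s <= b -> f s <= 0;
  f1_nontrivial : exists s, 0 <= s <= b /\ f s <> 0;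
  f1_F_beta : primitive f beta = 0
}.

(* If c < 1, then f' lives on (0,c) only and L^1(0,1) is read as L^1(0,c). *)
Record cond_f2 (c : Rbar) (f : R -> R) : Prop := {
  f2_derivable : forall s, 0 < s -> Rbar_lt s c -> ex_derive f s;
  f2_continuous : forall s, 0 < s -> Rbar_lt s c -> continuous (Derive f) s;
  f2_L1 : L1 (Derive f) 0 (Rbar_min 1 c)
}.

Record cond_q1 (q : R -> R) : Prop := {
  q1_C1 : exists q', C1_Rplus q q';
  q1_nonneg : forall r, 0 <= r -> 0 <= q r;
  q1_zero : q 0 = 0;
  q1_deriv_pos : forall r, 0 < r -> 0 < Derive q r
}.

Definition cond_q2 (q : R -> R) : Prop :=
  forall r1 r2, 0 < r1 -> r1 < r2 -> Derive q r2 / q r2 < Derive q r1 / q r1.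

Definition Hfun (q : R -> R) : R -> R :=
  Derive (fun r => primitive q r / q r).

Record cond_q3 (q : R -> R) (Hinf : R) : Prop := {
  q3_H_noninc : forall r1 r2, 0 < r1 -> r1 <= r2 -> Hfun q r2 <= Hfun q r1;
  q3_H0 : exists H0 : R,
    filterlim (Hfun q) (at_right 0) (locally H0) /\ H0 < 1 / 2;
  q3_Hinf_lim : is_lim (Hfun q) p_infty Hinf;
  q3_Hinf_pos : 0 < Hinf;
  q3_qH_nondec : forall r1 r2, 0 < r1 -> r1 <= r2 ->
    q r1 * (Hfun q r1 - Hinf) <= q r2 * (Hfun q r2 - Hinf)
}.

Definition hfun (q : R -> R) (r : R) : R :=
  q r * RInt_gen (fun s => 1 / q s) (at_point r) (Rbar_locally p_infty).

Record cond_q4 (q : R -> R) (linf : R) : Prop := {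
  q4_L1_infty : L1 (fun r => 1 / q r) 1 p_infty;
  q4_not_L1_0 : ~ L1 (fun r => 1 / q r) 0 1;
  q4_h'_pos : forall r, 0 < r -> 0 < Derive (hfun q) r;
  q4_h'_noninc : forall r1 r2, 0 < r1 -> r1 <= r2 ->
    Derive (hfun q) r2 <= Derive (hfun q) r1;
  q4_linf_lim : is_lim (Derive (hfun q)) p_infty linf;
  q4_linf_pos : 0 < linf
}.

Definition cond_q5 (q : R -> R) : Prop :=
  forall r1 r2, 0 < r1 -> r1 < r2 -> Derive q r1 * q r1 < Derive q r2 * q r2.

Definition is_solution (c : Rbar) (f q u : R -> R) : Prop :=
  (forall r, 0 <= r -> in_dom c (u r)) /\
  (exists u',
     C1_Rplus u u' /\ u' 0 = 0 /\
     forall r, 0 < r ->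
       ex_derive (fun x => q x * u' x) r /\
       Derive (fun x => q x * u' x) r + q r * f (u r) = 0) /\
  is_lim u p_infty 0.

Definition nonnegative (u : R -> R) : Prop := forall r, 0 <= r -> 0 <= u r.

(* The number of sign changes is the largest k for which the signs of u
   alternate strictly along some r_0 < ... < r_k in (0,oo); zeros, and
   intervals on which u vanishes, are ignored. *)
Definition one_sign_change (u : R -> R) : Prop :=
  (exists r0 r1, 0 < r0 /\ r0 < r1 /\ u r0 * u r1 < 0) /\
  ~ (exists r0 r1 r2, 0 < r0 /\ r0 < r1 /\ r1 < r2 /\
       u r0 * u r1 < 0 /\ u r1 * u r2 < 0).

Definition at_most_one_on_Rplus (P : (R -> R) -> Prop) : Prop :=
  forall u v, P u -> P v -> forall r, 0 <= r -> u r = v r.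

(* Main.v *)
Require Import Defs.
From Stdlib Require Import Lra Psatz Classical ClassicalEpsilon.

(** The solutions are compared level by level rather than radius by radius. Where u
    decreases, let r (s) be the radius at which u = s, rho (s) = |u'| there and
    E = rho^2 / 2 + F; such a piece is a [branch]. As f is odd, a piece on which u
    increases is a branch of - u. Suppose two solutions of the same kind have
    u1 (0) < u2 (0). Both start above beta, since otherwise E would be nonpositive from
    the start. Their branches are followed from the top to the level 0, where a
    contradiction appears.

    Solution 2 first leads: r1 < r2 and E1 < E2. While r1 <= r2 the gap
    q (r1) (E2 - E1) does not shrink, because q' / q decreases ([energy_gap_grows]). So a
    lead can only end in a crossing of the radii; and on a branch that decays to 0 it
    must end, because q (r2) E2 tends to 0. After a crossing solution 2 lags: it is
    earlier, r2 <= r1, but faster. Such an order lasts as well, in a form that depends on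
    the level: for q^2 E where |s| <= beta, as q q' increases and F <= 0; for the flux
    q rho where f <= 0; for Q E / (q rho) where f >= 0 and the Pohozaev function is
    nonnegative. It cannot last down to the level 0 of a decaying branch either
    ([lagging_impossible], by means of (Q / q) rho and (Q / q)^2 E). Hence two decaying
    branches cannot be in either order at the level beta ([two_tails_impossible]), and it
    remains to bring the order there.

    On the first descent there are two arguments, according to the assumptions on f. If
    f (s) / (s - b) does not increase, Sturm comparison of u1 - b and u2 - b excludes a
    crossing above b ([first_descent_sublinear]). If s f' / f decreases, a crossing may
    occur, but the order of the fluxes then holds down to beta
    ([first_descent_superlinear]): with h (r) = q (r) T (r), T (r) being the integral of
    1 / q over (r, oo), the slope y = h rho / s of u in logarithmic coordinates satisfies
    s y y' = - (y^2 - y + N) with N = h^2 f / s, and the two solutions are compared at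
    levels where their slopes agree ([no_flux_contact_while_later]).

    This settles nonnegative solutions. If the solutions change sign once, the order is
    carried from beta to - beta, and below - beta it makes the gap of the Pohozaev
    functions P = Q E - q rho F / f increase, by the lower bound on (F / f)'. So
    solution 2 turns back at a lower level, and P2 is still ahead when it has come back to
    the level at which solution 1 turned. On the way back this brings a lead or a lag to
    the level beta of the last branches ([sign_changing_pair_impossible]). The lower bound
    on (F / f)' is either assumed, or follows from the bound on s f' / f through the
    inequality (1 - 2 Hinf) linf <= Hinf ([limit_slopes], [growth_of_elasticity]).

    Finally, solutions with u1 (0) = u2 (0) coincide ([motions_agree]). As f need not be
    Lipschitz at 0, the passage through a zero of u uses the energy, and a solution that
    reaches 0 with zero speed stays there. *)

(** * Monotonicity, limits and inverses on the line *)

Lemma is_derive_value (g : R -> R) (x d d' : R) :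
  is_derive g x d -> d = d' -> is_derive g x d'.
Proof. now intros Hd <-. Qed.

Lemma nondecreasing_of_derive (g dg : R -> R) (x y : R) :
  x <= y ->
  (forall z, x <= z <= y -> is_derive g z (dg z)) ->
  (forall z, x < z < y -> 0 <= dg z) -> g x <= g y.
Proof.
  intros [Hxy | <-] Hd Hs; [| lra].
  destruct (MVT_cor2 g dg x y Hxy) as (z & Hz & Hz').
  - intros t Ht. now apply is_derive_Reals, Hd.
  - assert (0 <= dg z * (y - x)) by (apply Rmult_le_pos; [apply Hs|]; lra). lra.
Qed.

Lemma increasing_of_derive (g dg : R -> R) (x y : R) :
  x < y ->
  (forall z, x <= z <= y -> is_derive g z (dg z)) ->
  (forall z, x < z < y -> 0 < dg z) -> g x < g y.
Proof.
  intros Hxy Hd Hs.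
  destruct (MVT_cor2 g dg x y Hxy) as (z & Hz & Hz').
  - intros t Ht. now apply is_derive_Reals, Hd.
  - assert (0 < dg z * (y - x)) by (apply Rmult_lt_0_compat; [apply Hs|]; lra). lra.
Qed.

Lemma continuous_pos_near (g : R -> R) (x : R) :
  continuous g x -> 0 < g x ->
  exists d, 0 < d /\ forall t, Rabs (t - x) < d -> 0 < g t.
Proof.
  intros Hc Hx.
  destruct (Hc (fun y => 0 < y) (open_gt 0 (g x) Hx)) as [d Hd].
  exists d. split; [apply cond_pos|]. intros t Ht. apply Hd. exact Ht.
Qed.

Lemma highest_zero (g : R -> R) (x y : R) :
  x <= y -> (forall z, x <= z <= y -> continuous g z) ->
  0 < g y -> g x <= 0 ->
  exists z, x <= z < y /\ g z = 0 /\ forall t, z < t <= y -> 0 < g t.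
Proof.
  intros Hxy Hc Hy Hx.
  destruct (completeness (fun t => x <= t <= y /\ g t <= 0)) as (m & Hub & Hl).
  - exists y. intros t Ht. lra.
  - exists x. lra.
  - assert (Hm : x <= m <= y).
    { split; [apply Hub; lra | apply Hl; intros t Ht; lra]. }
    assert (Habove : forall t, m < t <= y -> 0 < g t).
    { intros t Ht. apply Rnot_le_lt. intros Hgt.
      assert (t <= m) by (apply Hub; lra). lra. }
    assert (Hle : g m <= 0).
    { apply Rnot_lt_le. intros Hpos.
      destruct (continuous_pos_near g m (Hc m Hm) Hpos) as (d & Hd & Hn).
      assert (m <= m - d); [| lra].
      apply Hl. intros t Ht. apply Rnot_lt_le. intros Hlt.
      assert (t <= m) by (apply Hub; exact Ht).
      assert (0 < g t) by (apply Hn, Rabs_lt_between; lra). lra. }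
    assert (m < y) by (destruct (proj2 Hm) as [|E]; [assumption | rewrite E in Hle; lra]).
    exists m. repeat split; try lra; try assumption.
    apply Rle_antisym; [assumption |]. apply Rnot_lt_le. intros Hneg.
    destruct (continuous_pos_near (fun t => - g t) m) as (d & Hd & Hn).
    { apply (continuous_opp g), Hc, Hm. }
    { lra. }
    assert (Hh : 0 < Rmin d (y - m)) by (apply Rmin_pos; lra).
    assert (Rmin d (y - m) <= d) by apply Rmin_l.
    assert (Rmin d (y - m) <= y - m) by apply Rmin_r.
    assert (0 < g (m + Rmin d (y - m) / 2)) by (apply Habove; lra).
    assert (0 < - g (m + Rmin d (y - m) / 2)) by (apply Hn, Rabs_lt_between; lra). lra.
Qed.

(** Continuous induction towards smaller arguments: only a first zero of g has to be
    excluded. *)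
Lemma propagate_down (g : R -> R) (x y : R) :
  (forall z, x <= z <= y -> continuous g z) -> 0 < g y ->
  (forall z, x <= z < y -> (forall t, z < t <= y -> 0 < g t) -> 0 < g z) ->
  forall z, x <= z <= y -> 0 < g z.
Proof.
  intros Hc Hy Hstep z Hz. apply Rnot_le_lt. intros Hle.
  destruct (highest_zero g z y) as (m & Hm & H0 & Habove); try lra; try assumption.
  - intros t Ht. apply Hc. lra.
  - assert (0 < g m) by (apply Hstep; [lra | assumption]). lra.
Qed.

Lemma lowest_zero (g : R -> R) (x y : R) :
  x <= y -> (forall z, x <= z <= y -> continuous g z) ->
  0 < g x -> g y <= 0 ->
  exists z, x < z <= y /\ g z = 0 /\ forall t, x <= t < z -> 0 < g t.
Proof.
  intros Hxy Hc Hx Hy.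
  destruct (highest_zero (fun t => g (- t)) (- y) (- x)) as (z & Hz & H0 & Habove).
  - lra.
  - intros z Hz. apply (continuous_comp Ropp g).
    + apply (continuous_opp (fun t : R => t)), continuous_id.
    + apply Hc. lra.
  - now rewrite Ropp_involutive.
  - now rewrite Ropp_involutive.
  - exists (- z). repeat split; try lra.
    intros t Ht. rewrite <- (Ropp_involutive t). apply Habove. lra.
Qed.

Lemma propagate_up (g : R -> R) (x y : R) :
  (forall z, x <= z <= y -> continuous g z) -> 0 < g x ->
  (forall z, x < z <= y -> (forall t, x <= t < z -> 0 < g t) -> 0 < g z) ->
  forall z, x <= z <= y -> 0 < g z.
Proof.
  intros Hc Hx Hstep z Hz. apply Rnot_le_lt. intros Hle.
  destruct (lowest_zero g x z) as (m & Hm & H0 & Hbelow); try lra; try assumption.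
  - intros t Ht. apply Hc. lra.
  - assert (0 < g m) by (apply Hstep; [lra | assumption]). lra.
Qed.

Lemma is_derive_continuous (g : R -> R) (x d : R) : is_derive g x d -> continuous g x.
Proof. intros Hd. apply (ex_derive_continuous g). now exists d. Qed.

Lemma derive_mult (g k : R -> R) (x dg dk : R) :
  is_derive g x dg -> is_derive k x dk ->
  is_derive (fun t => g t * k t) x (dg * k x + g x * dk).
Proof.
  intros Hg Hk. apply (is_derive_mult g k); [assumption | assumption |].
  intros; apply Rmult_comm.
Qed.

Lemma derive_plus (g k : R -> R) (x dg dk : R) :
  is_derive g x dg -> is_derive k x dk ->
  is_derive (fun t => g t + k t) x (dg + dk).
Proof. intros Hg Hk. now apply (is_derive_plus g k). Qed.

Lemma derive_minus (g k : R -> R) (x dg dk : R) :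
  is_derive g x dg -> is_derive k x dk ->
  is_derive (fun t => g t - k t) x (dg - dk).
Proof. intros Hg Hk. now apply (is_derive_minus g k). Qed.

Lemma derive_div_const (g : R -> R) (x dg a : R) :
  is_derive g x dg -> is_derive (fun t => g t / a) x (dg / a).
Proof. intros Hg. now apply (is_derive_scal_l g x dg (/ a)). Qed.

Lemma derive_comp (g k : R -> R) (x dg dk : R) :
  is_derive g (k x) dg -> is_derive k x dk ->
  is_derive (fun t => g (k t)) x (dg * dk).
Proof.
  intros Hg Hk. eapply is_derive_value.
  - apply (is_derive_comp g k); eassumption.
  - apply Rmult_comm.
Qed.

Lemma nonneg_at_left_end (g : R -> R) (x y : R) :
  x < y -> continuous g x -> (forall t, x < t <= y -> 0 < g t) -> 0 <= g x.
Proof.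
  intros Hxy Hc Hpos. apply Rnot_lt_le. intros Hneg.
  destruct (continuous_pos_near (fun t => - g t) x) as (d & Hd & Hn).
  - now apply (continuous_opp g).
  - lra.
  - assert (Hh : 0 < Rmin d (y - x)) by (apply Rmin_pos; lra).
    assert (Rmin d (y - x) <= d) by apply Rmin_l.
    assert (Rmin d (y - x) <= y - x) by apply Rmin_r.
    assert (0 < g (x + Rmin d (y - x) / 2)) by (apply Hpos; lra).
    assert (0 < - g (x + Rmin d (y - x) / 2)) by (apply Hn, Rabs_lt_between; lra). lra.
Qed.

Lemma nonincreasing_of_derive (g dg : R -> R) (x y : R) :
  x <= y ->
  (forall z, x <= z <= y -> is_derive g z (dg z)) ->
  (forall z, x < z < y -> dg z <= 0) -> g y <= g x.
Proof.
  intros Hxy Hd Hs. assert (- g x <= - g y); [| lra].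
  apply (nondecreasing_of_derive (fun t => - g t) (fun t => - dg t)); [assumption | |].
  - intros z Hz. now apply (is_derive_opp g), Hd.
  - intros z Hz. specialize (Hs z Hz). lra.
Qed.

Section Limits.
Context {Fl : (R -> Prop) -> Prop} {FF : ProperFilter Fl}.

Lemma lim_lt (g : R -> R) (l k : R) :
  filterlim g Fl (locally l) -> l < k -> Fl (fun x => g x < k).
Proof. intros Hg Hlk. apply (Hg (fun y => y < k)). exact (open_lt k l Hlk). Qed.

Lemma lim_gt (g : R -> R) (l k : R) :
  filterlim g Fl (locally l) -> k < l -> Fl (fun x => k < g x).
Proof. intros Hg Hlk. apply (Hg (fun y => k < y)). exact (open_gt k l Hlk). Qed.

Lemma lim_le (g k : R -> R) (l m : R) : filterlim g Fl (locally l) ->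
  filterlim k Fl (locally m) -> Fl (fun x => g x <= k x) -> l <= m.
Proof. intros Hg Hk Hle. apply (filterlim_le (F := Fl) g k l m Hle Hg Hk). Qed.

Lemma lim_mult (g k : R -> R) (l m : R) : filterlim g Fl (locally l) ->
  filterlim k Fl (locally m) -> filterlim (fun x => g x * k x) Fl (locally (l * m)).
Proof. intros Hg Hk. exact (filterlim_comp_2 g k Rmult Hg Hk (filterlim_mult l m)). Qed.

Lemma lim_plus (g k : R -> R) (l m : R) : filterlim g Fl (locally l) ->
  filterlim k Fl (locally m) -> filterlim (fun x => g x + k x) Fl (locally (l + m)).
Proof. intros Hg Hk. exact (filterlim_comp_2 g k Rplus Hg Hk (filterlim_plus l m)). Qed.

Lemma lim_opp (g : R -> R) (l : R) : filterlim g Fl (locally l) ->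
  filterlim (fun x => - g x) Fl (locally (- l)).
Proof. intros Hg. exact (filterlim_comp _ _ _ g Ropp _ _ _ Hg (filterlim_opp l)). Qed.

Lemma lim_minus (g k : R -> R) (l m : R) : filterlim g Fl (locally l) ->
  filterlim k Fl (locally m) -> filterlim (fun x => g x - k x) Fl (locally (l - m)).
Proof. intros Hg Hk. apply lim_plus; [assumption | now apply lim_opp]. Qed.

Lemma lim_continuous (g k : R -> R) (l : R) : continuous g l ->
  filterlim k Fl (locally l) -> filterlim (fun x => g (k x)) Fl (locally (g l)).
Proof. intros Hg Hk. exact (filterlim_comp _ _ _ k g _ _ _ Hk Hg). Qed.
End Limits.

Lemma at_right_interval (x y : R) : x < y -> at_right x (fun z => x < z < y).
Proof.
  intros Hxy. exists (mkposreal (y - x) ltac:(lra)). intros z Hz Hlt.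
  unfold ball in Hz; simpl in Hz. apply Rabs_lt_between in Hz.
  unfold minus, plus, opp in Hz; simpl in Hz. lra.
Qed.

Lemma at_left_interval (x y : R) : x < y -> at_left y (fun z => x < z < y).
Proof.
  intros Hxy. exists (mkposreal (y - x) ltac:(lra)). intros z Hz Hlt.
  unfold ball in Hz; simpl in Hz. apply Rabs_lt_between in Hz.
  unfold minus, plus, opp in Hz; simpl in Hz. lra.
Qed.

Lemma continuous_at_left (g : R -> R) (x : R) :
  continuous g x -> filterlim g (at_left x) (locally (g x)).
Proof.
  intros Hg P HP. apply (filter_imp (F := locally x) (fun y => P (g y))); [| exact (Hg P HP)].
  intros y Hy _. exact Hy.
Qed.

Lemma continuous_at_right (g : R -> R) (x : R) :
  continuous g x -> filterlim g (at_right x) (locally (g x)).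
Proof.
  intros Hg P HP. apply (filter_imp (F := locally x) (fun y => P (g y))); [| exact (Hg P HP)].
  intros y Hy _. exact Hy.
Qed.

Lemma level_at_right (x : R) : filterlim (fun s => s) (at_right x) (locally x).
Proof. apply (continuous_at_right (fun s => s)), continuous_id. Qed.
Lemma level_at_left (x : R) : filterlim (fun s => s) (at_left x) (locally x).
Proof. apply (continuous_at_left (fun s => s)), continuous_id. Qed.

Lemma strictly_decreasing_of_derive (g dg : R -> R) (t : R) (T : Rbar) :
  (forall x, t < x -> Rbar_lt x T -> is_derive g x (dg x) /\ dg x < 0) ->
  forall x y, t < x -> x < y -> Rbar_lt y T -> g y < g x.
Proof.
  intros Hg x y Hx Hxy Hy.
  assert (H : - g x < - g y); [| lra].
  apply (increasing_of_derive (fun z => - g z) (fun z => - dg z)); [assumption | |].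
  - intros z Hz. apply (is_derive_opp g), Hg; [lra |].
    apply Rbar_le_lt_trans with y; [apply Hz | assumption].
  - intros z Hz. destruct (Hg z); [lra | | lra].
    apply Rbar_le_lt_trans with y; [simpl; lra | assumption].
Qed.

(** The inverse comes from a choice of preimages; its derivative needs its continuity,
    which monotonicity of g provides. *)
Lemma inverse_of_decreasing (g dg : R -> R) (t : R) (T : Rbar) (lo hi : R) :
  (forall x, t < x -> Rbar_lt x T -> is_derive g x (dg x) /\ dg x < 0) ->
  (forall s, lo < s < hi -> exists x, t < x /\ Rbar_lt x T /\ g x = s) ->
  exists inv : R -> R, forall s, lo < s < hi ->
    t < inv s /\ Rbar_lt (inv s) T /\ g (inv s) = s /\
    is_derive inv s (/ dg (inv s)).
Proof.
  intros Hg Hsurj.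
  assert (Hdec := strictly_decreasing_of_derive g dg t T Hg).
  destruct (constructive_indefinite_description
    (fun inv : R -> R => forall s, lo < s < hi ->
       t < inv s /\ Rbar_lt (inv s) T /\ g (inv s) = s)) as [inv Hinv].
  { apply (choice (fun s x => lo < s < hi -> t < x /\ Rbar_lt x T /\ g x = s)).
    intros s. destruct (classic (lo < s < hi)) as [Hs | Hs].
    - destruct (Hsurj s Hs) as [x Hx]. now exists x.
    - exists 0. tauto. }
  exists inv. intros s Hs. destruct (Hinv s Hs) as (Ht & HT & Hgs).
  split; [assumption | split; [assumption | split; [assumption |]]].
  destruct (Hg _ Ht HT) as [Hd Hneg].
  set (x0 := inv s) in *.
  apply is_derive_Reals. apply (proj1 (is_derive_Reals g x0 _)) in Hd.
  intros eps Heps.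
  assert (Hinvc : continuous Rinv (dg x0)) by (apply continuous_Rinv; lra).
  destruct (Hinvc (fun y => Rabs (y - / dg x0) < eps)) as [eta Heta].
  { exists (mkposreal eps Heps). intros y Hy. exact Hy. }
  destruct (Hd eta (cond_pos eta)) as [d1 Hd1].
  (* xl and xh bracket the values of inv near s *)
  assert (Hlow : exists xl, t < xl /\ x0 - d1 < xl < x0).
  { exists (Rmax ((t + x0) / 2) (x0 - d1 / 2)).
    assert (H1 := Rmax_l ((t + x0) / 2) (x0 - d1 / 2)).
    assert (H2 := Rmax_r ((t + x0) / 2) (x0 - d1 / 2)).
    assert (Hd0 := cond_pos d1).
    repeat split; try lra. apply Rmax_lub_lt; lra. }
  assert (Hhigh : exists xh : R, Rbar_lt xh T /\ x0 < xh < x0 + d1).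
  { assert (Hd0 := cond_pos d1). destruct T as [T | | ]; simpl in *; try easy.
    - exists (Rmin ((T + x0) / 2) (x0 + d1 / 2)).
      assert (H1 := Rmin_l ((T + x0) / 2) (x0 + d1 / 2)).
      assert (H2 := Rmin_r ((T + x0) / 2) (x0 + d1 / 2)).
      repeat split; simpl; try lra; apply Rmin_glb_lt; lra.
    - exists (x0 + d1 / 2). repeat split; simpl; try lra; exact I. }
  destruct Hlow as (xl & Hxl & Hxl'). destruct Hhigh as (xh & Hxh & Hxh').
  assert (Hgl : s < g xl).
  { pattern s at 1; rewrite <- Hgs. apply (Hdec xl x0 Hxl (proj2 Hxl') HT). }
  assert (Hgh : g xh < s).
  { pattern s; rewrite <- Hgs. apply (Hdec x0 xh Ht (proj1 Hxh') Hxh). }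
  assert (Hdel : 0 < Rmin (Rmin (g xl - s) (s - g xh)) (Rmin (s - lo) (hi - s))).
  { repeat apply Rmin_pos; lra. }
  exists (mkposreal _ Hdel). intros h Hh0 Hh. simpl in Hh.
  assert (M1 := Rmin_l (Rmin (g xl - s) (s - g xh)) (Rmin (s - lo) (hi - s))).
  assert (M2 := Rmin_r (Rmin (g xl - s) (s - g xh)) (Rmin (s - lo) (hi - s))).
  assert (M3 := Rmin_l (g xl - s) (s - g xh)).
  assert (M4 := Rmin_r (g xl - s) (s - g xh)).
  assert (M5 := Rmin_l (s - lo) (hi - s)).
  assert (M6 := Rmin_r (s - lo) (hi - s)).
  apply Rabs_lt_between in Hh.
  destruct (Hinv (s + h)) as (Ht' & HT' & Hg'); [lra |].
  set (x1 := inv (s + h)) in *.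
  assert (B1 : xl < x1).
  { apply Rnot_le_lt. intros [Hc | Hc].
    - assert (g xl < g x1); [| lra]. apply Hdec; try assumption.
      apply Rbar_lt_trans with xh; [simpl; lra | assumption].
    - rewrite Hc in Hg'. lra. }
  assert (B2 : x1 < xh).
  { apply Rnot_le_lt. intros [Hc | Hc].
    - assert (g x1 < g xh); [| lra]. apply Hdec; try assumption. lra.
    - rewrite <- Hc in Hg'. lra. }
  assert (Hne : x1 - x0 <> 0).
  { intros Hc. replace x1 with x0 in Hg' by lra. lra. }
  specialize (Hd1 (x1 - x0) Hne). replace (x0 + (x1 - x0)) with x1 in Hd1 by ring.
  rewrite Hg', Hgs in Hd1.
  fold x0. replace ((x1 - x0) / h) with (/ ((s + h - s) / (x1 - x0))) by (field; lra).
  apply Heta. apply Hd1. apply Rabs_lt_between. lra.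
Qed.

(** * Weights, forces and branches *)

Lemma in_dom_opp {c : Rbar} (s : R) : in_dom c s -> in_dom c (- s).
Proof. unfold in_dom. now rewrite Rabs_Ropp. Qed.

Lemma in_dom_le {c : Rbar} (s t : R) : in_dom c s -> Rabs t <= Rabs s -> in_dom c t.
Proof. unfold in_dom. intros Hs Ht. apply Rbar_le_lt_trans with (Rabs s); assumption. Qed.

Lemma in_dom_pos {c : Rbar} (s : R) : 0 <= s -> (in_dom c s <-> Rbar_lt s c).
Proof. intros Hs. unfold in_dom. now rewrite Rabs_pos_eq. Qed.

Lemma in_dom_open {c : Rbar} (s : R) : in_dom c s -> exists m, Rabs s < m /\ in_dom c m.
Proof.
  unfold in_dom. assert (A := Rabs_pos s). destruct c as [c | |]; simpl; intros Hs.
  - exists ((Rabs s + c) / 2). split; [lra |]. rewrite Rabs_pos_eq; lra.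
  - exists (Rabs s + 1). split; [lra | exact I].
  - destruct Hs.
Qed.

(** H is (Q / q)', spelled out through q'. *)
Record weight (q dq Q H : R -> R) (Hinf : R) : Prop := {
  w_pos : forall r, 0 < r -> 0 < q r;
  w_der : forall r, 0 < r -> is_derive q r (dq r);
  w_dpos : forall r, 0 < r -> 0 < dq r;
  w_prim : forall r, 0 < r -> is_derive Q r (q r);
  w_primpos : forall r, 0 < r -> 0 < Q r;
  w_H : forall r, 0 < r -> H r = 1 - Q r * dq r / (q r * q r);
  w_Hmono : forall r1 r2, 0 < r1 -> r1 <= r2 -> H r2 <= H r1;
  w_Hpos : forall r, 0 < r -> 0 < H r;
  w_Hinf : forall r, 0 < r -> Hinf <= H r;
  w_Hhalf : forall r, 0 < r -> H r < 1 / 2;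
  w_qH : forall r1 r2, 0 < r1 -> r1 <= r2 ->
    q r1 * (H r1 - Hinf) <= q r2 * (H r2 - Hinf);
  w_logder : forall r1 r2, 0 < r1 -> r1 <= r2 -> dq r2 / q r2 <= dq r1 / q r1;
  w_qdq : forall r1 r2, 0 < r1 -> r1 <= r2 -> dq r1 * q r1 <= dq r2 * q r2
}.

Record force (c : Rbar) (f F : R -> R) (b beta : R) : Prop := {
  fo_prim : forall s, in_dom c s -> is_derive F s (f s);
  fo_odd : forall s, in_dom c s -> f (- s) = - f s;
  fo_even : forall s, in_dom c s -> F (- s) = F s;
  fo_b : 0 < b < beta;
  fo_at_b : f b = 0;
  fo_dom : in_dom c beta;
  fo_nonpos : forall s, 0 <= s <= b -> f s <= 0;
  fo_pos : forall s, b < s -> in_dom c s -> 0 < f s;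
  fo_Fnonpos : forall s, Rabs s <= beta -> F s <= 0;
  fo_Fbeta : F beta = 0;
  fo_Fpos : forall s, beta < Rabs s -> in_dom c s -> 0 < F s
}.

Definition energy (F rho : R -> R) (s : R) : R := rho s * rho s / 2 + F s.

(** A decreasing piece of a solution, followed by its level s: r (s) is the radius at
    which the level is reached and rho (s) the speed |u'| there. Since dr / ds = - 1 /
    rho, the equation (q u')' + q f (u) = 0 becomes a first-order system for (r, rho). *)
Record branch (c : Rbar) (q dq f F : R -> R) (lo hi : R) (r rho : R -> R) : Prop := {
  br_dom : forall s, lo < s < hi -> in_dom c s;
  br_r : forall s, lo < s < hi -> 0 < r s;
  br_rho : forall s, lo < s < hi -> 0 < rho s;
  br_dr : forall s, lo < s < hi -> is_derive r s (- / rho s);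
  br_drho : forall s, lo < s < hi ->
    is_derive rho s (dq (r s) / q (r s) - f s / rho s);
  br_energy : forall s, lo < s < hi -> 0 < energy F rho s
}.
Arguments w_pos {q dq Q H Hinf}.
Arguments w_der {q dq Q H Hinf}.
Arguments w_dpos {q dq Q H Hinf}.
Arguments w_prim {q dq Q H Hinf}.
Arguments w_primpos {q dq Q H Hinf}.
Arguments w_H {q dq Q H Hinf}.
Arguments w_Hmono {q dq Q H Hinf}.
Arguments w_Hpos {q dq Q H Hinf}.
Arguments w_Hinf {q dq Q H Hinf}.
Arguments w_Hhalf {q dq Q H Hinf}.
Arguments w_qH {q dq Q H Hinf}.
Arguments w_logder {q dq Q H Hinf}.
Arguments w_qdq {q dq Q H Hinf}.
Arguments fo_prim {c f F b beta}.
Arguments fo_odd {c f F b beta}.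
Arguments fo_even {c f F b beta}.
Arguments fo_b {c f F b beta}.
Arguments fo_at_b {c f F b beta}.
Arguments fo_dom {c f F b beta}.
Arguments fo_nonpos {c f F b beta}.
Arguments fo_pos {c f F b beta}.
Arguments fo_Fnonpos {c f F b beta}.
Arguments fo_Fbeta {c f F b beta}.
Arguments fo_Fpos {c f F b beta}.
Arguments br_dom {c q dq f F lo hi r rho}.
Arguments br_r {c q dq f F lo hi r rho}.
Arguments br_rho {c q dq f F lo hi r rho}.
Arguments br_dr {c q dq f F lo hi r rho}.
Arguments br_drho {c q dq f F lo hi r rho}.
Arguments br_energy {c q dq f F lo hi r rho}.

Lemma branch_sub {c : Rbar} {q dq f F : R -> R} {lo hi : R} {r rho : R -> R} (lo' hi' : R) :
  branch c q dq f F lo hi r rho -> lo <= lo' -> hi' <= hi ->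
  branch c q dq f F lo' hi' r rho.
Proof.
  intros B Hlo Hhi. constructor; intros s Hs; assert (Hs' : lo < s < hi) by lra.
  - apply (br_dom B s Hs').
  - apply (br_r B s Hs').
  - apply (br_rho B s Hs').
  - apply (br_dr B s Hs').
  - apply (br_drho B s Hs').
  - apply (br_energy B s Hs').
Qed.

Section Branch.
Context {c : Rbar} {q dq Q H f F : R -> R} {Hinf b beta lo hi : R}.
Context (Wt : weight q dq Q H Hinf) (Fo : force c f F b beta).
Context {r rho : R -> R} (Br : branch c q dq f F lo hi r rho).

Lemma weight_ratio_derive (x : R) : 0 < x -> is_derive (fun y => Q y / q y) x (H x).
Proof.
  intros Hx. assert (Hq := w_pos Wt x Hx).
  eapply is_derive_value.
  - apply is_derive_div; [now apply (w_prim Wt) | now apply (w_der Wt) | lra].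
  - rewrite (w_H Wt x Hx). field. lra.
Qed.

Lemma weight_logder_ratio (x : R) : 0 < x -> Q x * dq x = (1 - H x) * (q x * q x).
Proof.
  intros Hx. assert (Hq := w_pos Wt x Hx).
  rewrite (w_H Wt x Hx). field. lra.
Qed.

Lemma is_derive_on_branch (g : R -> R) (dg s : R) :
  lo < s < hi -> is_derive g (r s) dg ->
  is_derive (fun t => g (r t)) s (- dg / rho s).
Proof.
  intros Hs Hg. eapply is_derive_value.
  - apply derive_comp; [exact Hg | apply (br_dr Br _ Hs)].
  - assert (0 < rho s) by (apply (br_rho Br _ Hs)). field. lra.
Qed.

Lemma energy_derive (s : R) : lo < s < hi ->
  is_derive (energy F rho) s (dq (r s) / q (r s) * rho s).
Proof.
  intros Hs. assert (Hrho := br_rho Br _ Hs).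
  assert (Hd := br_drho Br _ Hs).
  assert (HF := fo_prim Fo s (br_dom Br _ Hs)).
  assert (Hq := w_pos Wt _ (br_r Br _ Hs)).
  unfold energy. eapply is_derive_value.
  - apply derive_plus; [| exact HF].
    apply derive_div_const, derive_mult; exact Hd.
  - field. lra.
Qed.

Lemma product_derive (g : R -> R) (dg : R) (k : R -> R) (dk s : R) :
  lo < s < hi -> is_derive g (r s) dg -> is_derive k s dk ->
  is_derive (fun t => g (r t) * k t) s (- dg / rho s * k s + g (r s) * dk).
Proof.
  intros Hs Hg Hk.
  now apply (derive_mult (fun t => g (r t)) k); [apply is_derive_on_branch |].
Qed.

Lemma flux_derive (s : R) : lo < s < hi ->
  is_derive (fun t => q (r t) * rho t) s (- (q (r s) * f s / rho s)).
Proof.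
  intros Hs. assert (Hrho := br_rho Br _ Hs).
  assert (Hr := br_r Br _ Hs).
  assert (Hq := w_pos Wt _ Hr).
  eapply is_derive_value.
  - apply product_derive; [assumption | now apply (w_der Wt) |
      now apply (br_drho Br)].
  - field. lra.
Qed.

Lemma ratio_speed_derive (s : R) : lo < s < hi ->
  is_derive (fun t => Q (r t) / q (r t) * rho t) s
    (1 - 2 * H (r s) - Q (r s) / q (r s) * f s / rho s).
Proof.
  intros Hs. assert (Hrho := br_rho Br _ Hs).
  assert (Hr := br_r Br _ Hs).
  assert (Hq := w_pos Wt _ Hr).
  eapply is_derive_value.
  - apply (product_derive (fun x => Q x / q x)); [assumption | now apply weight_ratio_derive |
      now apply (br_drho Br)].
  - assert (E := weight_logder_ratio _ Hr).
    replace (Q (r s) / q (r s) * (dq (r s) / q (r s) - f s / rho s)) with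
      ((Q (r s) * dq (r s)) / (q (r s) * q (r s)) - Q (r s) / q (r s) * f s / rho s)
      by (field; lra).
    rewrite E. field. lra.
Qed.

Lemma prim_energy_derive (s : R) : lo < s < hi ->
  is_derive (fun t => Q (r t) * energy F rho t) s
    (q (r s) * rho s * (1 / 2 - H (r s)) - q (r s) * F s / rho s).
Proof.
  intros Hs. assert (Hrho := br_rho Br _ Hs).
  assert (Hr := br_r Br _ Hs).
  assert (Hq := w_pos Wt _ Hr).
  eapply is_derive_value.
  - apply product_derive; [assumption | now apply (w_prim Wt) | now apply energy_derive].
  - assert (E := weight_logder_ratio _ Hr). unfold energy.
    replace (Q (r s) * (dq (r s) / q (r s) * rho s)) with
      ((Q (r s) * dq (r s)) / q (r s) * rho s) by (field; lra).
    rewrite E. field. lra.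
Qed.

Lemma ratio_sq_energy_derive (s : R) : lo < s < hi ->
  is_derive (fun t => Q (r t) / q (r t) * (Q (r t) / q (r t)) * energy F rho t) s
    (Q (r s) / q (r s) * ((1 - 2 * H (r s)) * rho s - 2 * H (r s) * F s / rho s)).
Proof.
  intros Hs. assert (Hrho := br_rho Br _ Hs).
  assert (Hr := br_r Br _ Hs).
  assert (Hq := w_pos Wt _ Hr).
  eapply is_derive_value.
  - apply (product_derive (fun x => Q x / q x * (Q x / q x))); [assumption | | now apply energy_derive].
    apply (derive_mult (fun x => Q x / q x) (fun x => Q x / q x)); now apply weight_ratio_derive.
  - assert (E := weight_logder_ratio _ Hr). unfold energy.
    replace (Q (r s) / q (r s) * (Q (r s) / q (r s)) * (dq (r s) / q (r s) * rho s)) with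
      ((Q (r s) * dq (r s)) * (Q (r s) / q (r s) / (q (r s) * q (r s))) * rho s) by (field; lra).
    rewrite E. field. lra.
Qed.

Lemma weight_sq_energy_derive (s : R) : lo < s < hi ->
  is_derive (fun t => q (r t) * q (r t) * energy F rho t) s
    (- (2 * (dq (r s) * q (r s)) * F s / rho s)).
Proof.
  intros Hs. assert (Hrho := br_rho Br _ Hs).
  assert (Hr := br_r Br _ Hs).
  assert (Hq := w_pos Wt _ Hr).
  eapply is_derive_value.
  - apply (product_derive (fun x => q x * q x)); [assumption | | now apply energy_derive].
    apply (derive_mult q q); now apply (w_der Wt).
  - unfold energy. field. lra.
Qed.

Lemma flux_pos (s : R) : lo < s < hi -> 0 < q (r s) * rho s.
Proof.
  intros Hs. apply Rmult_lt_0_compat; [apply (w_pos Wt), (br_r Br s Hs) | apply (br_rho Br s Hs)].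
Qed.

End Branch.

(** * Order of two branches *)

Definition leads (F r1 rho1 r2 rho2 : R -> R) (s : R) : Prop :=
  r1 s < r2 s /\ energy F rho1 s < energy F rho2 s.

(** The order in which a crossing of the radii leaves two solutions of which the
    second was leading. *)
Definition lags (q r1 rho1 r2 rho2 : R -> R) (s : R) : Prop :=
  r2 s <= r1 s /\ q (r1 s) * rho1 s < q (r2 s) * rho2 s.

(** By [lags_ratio] a weakening of [lags]; it survives where the flux order need not,
    and still excludes decay. *)
Definition lags_weakly (q Q r1 rho1 r2 rho2 : R -> R) (s : R) : Prop :=
  r2 s <= r1 s /\ Q (r1 s) / q (r1 s) * rho1 s < Q (r2 s) / q (r2 s) * rho2 s.

Definition mean (q Q F r rho : R -> R) (s : R) : R :=
  Q (r s) * energy F rho s / (q (r s) * rho s).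

Section Pair.
Context {c : Rbar} {q dq Q H f F : R -> R} {Hinf b beta lo hi : R}.
Context (Wt : weight q dq Q H Hinf) (Fo : force c f F b beta).
Context {r1 rho1 r2 rho2 : R -> R}.
Context (B1 : branch c q dq f F lo hi r1 rho1) (B2 : branch c q dq f F lo hi r2 rho2).

Lemma weight_monotone (x y : R) : 0 < x -> x <= y -> q x <= q y.
Proof.
  intros Hx Hxy. apply (nondecreasing_of_derive q dq); [assumption | |].
  - intros z Hz. apply (w_der Wt). lra.
  - intros z Hz. apply Rlt_le, (w_dpos Wt). lra.
Qed.

Lemma ratio_monotone (x y : R) : 0 < x -> x <= y -> Q x / q x <= Q y / q y.
Proof.
  intros Hx Hxy. apply (nondecreasing_of_derive (fun t => Q t / q t) H); [assumption | |].
  - intros z Hz. apply (weight_ratio_derive Wt). lra.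
  - intros z Hz. apply Rlt_le, (w_Hpos Wt). lra.
Qed.

Lemma ratio_pos (x : R) : 0 < x -> 0 < Q x / q x.
Proof. intros Hx. apply Rdiv_lt_0_compat; [now apply (w_primpos Wt) | now apply (w_pos Wt)]. Qed.

(** (Q / q^2)' = (2 H - 1) / q is negative because H < 1 / 2. *)
Lemma ratio_over_weight_antitone (x y : R) : 0 < x -> x <= y ->
  Q y / (q y * q y) <= Q x / (q x * q x).
Proof.
  intros Hx Hxy.
  apply (nonincreasing_of_derive (fun t => Q t / (q t * q t)) (fun t => (2 * H t - 1) / q t));
    [assumption | |].
  - intros z Hz. assert (Hz0 : 0 < z) by lra. assert (Hq := w_pos Wt z Hz0).
    eapply is_derive_value.
    + apply (is_derive_div Q (fun t => q t * q t)); [now apply (w_prim Wt) | |].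
      * apply derive_mult; now apply (w_der Wt).
      * apply Rgt_not_eq. now apply Rmult_lt_0_compat.
    + assert (E := weight_logder_ratio Wt z Hz0).
      replace ((q z * (q z * q z) - Q z * (dq z * q z + q z * dq z)) / (q z * q z) ^ 2)
        with ((q z * (q z * q z) - 2 * q z * (Q z * dq z)) / (q z * q z) ^ 2)
        by (field; lra).
      rewrite E. field. lra.
  - intros z Hz. assert (Hz0 : 0 < z) by lra. assert (Hq := w_pos Wt z Hz0).
    assert (Hh := w_Hhalf Wt z Hz0). apply Rlt_le.
    unfold Rdiv. rewrite <- (Ropp_involutive (2 * H z - 1)), Ropp_mult_distr_l_reverse.
    apply Ropp_lt_gt_0_contravar. apply Rmult_lt_0_compat; [lra | now apply Rinv_0_lt_compat].
Qed.

Lemma speed_of_energy (s : R) : lo < s < hi ->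
  energy F rho1 s < energy F rho2 s <-> rho1 s < rho2 s.
Proof.
  intros Hs. unfold energy.
  assert (P1 := br_rho B1 s Hs). assert (P2 := br_rho B2 s Hs).
  split; intros Hlt; nra.
Qed.

Lemma slower_if_smaller_flux (s : R) : lo < s < hi -> r2 s <= r1 s ->
  q (r1 s) * rho1 s < q (r2 s) * rho2 s -> rho1 s < rho2 s.
Proof.
  intros Hs Hr Hw.
  assert (P1 := br_rho B1 s Hs). assert (R2 := br_r B2 s Hs).
  assert (Hq := weight_monotone _ _ R2 Hr). assert (Hq2 := w_pos Wt _ R2).
  apply (Rmult_lt_reg_l (q (r2 s))); [assumption |].
  apply Rle_lt_trans with (q (r1 s) * rho1 s); [| assumption].
  apply Rmult_le_compat_r; lra.
Qed.

(** dr / ds = - 1 / rho, so a slower solution spends more radius on every level. *)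
Lemma delay_grows (x y : R) : lo < x -> x <= y -> y < hi ->
  (forall t, x < t < y -> rho1 t <= rho2 t) ->
  r1 y - r2 y <= r1 x - r2 x.
Proof.
  intros Hx Hxy Hy Hrho.
  apply (nonincreasing_of_derive (fun t => r1 t - r2 t) (fun t => - / rho1 t - - / rho2 t));
    [assumption | |].
  - intros z Hz. apply derive_minus; [apply (br_dr B1) | apply (br_dr B2)]; lra.
  - intros z Hz. assert (P1 := br_rho B1 z ltac:(lra)).
    assert (/ rho2 z <= / rho1 z) by (apply Rinv_le_contravar; [assumption | now apply Hrho]).
    lra.
Qed.

(** With p = q' / q the derivative is - q' (r1) (rho2 - rho1)^2 / (2 rho1) plus q (r1)
    rho2 (p (r2) - p (r1)), and p decreases. *)
Lemma energy_gap_grows (x y : R) : lo < x -> x <= y -> y < hi ->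
  (forall t, x <= t <= y -> r1 t <= r2 t) ->
  q (r1 y) * (energy F rho2 y - energy F rho1 y) <=
  q (r1 x) * (energy F rho2 x - energy F rho1 x).
Proof.
  intros Hx Hxy Hy Hr.
  apply (nonincreasing_of_derive
    (fun t => q (r1 t) * (energy F rho2 t - energy F rho1 t))
    (fun t => - dq (r1 t) / rho1 t * (energy F rho2 t - energy F rho1 t) +
      q (r1 t) * (dq (r2 t) / q (r2 t) * rho2 t - dq (r1 t) / q (r1 t) * rho1 t)));
    [assumption | |].
  - intros z Hz. assert (Hz' : lo < z < hi) by lra.
    apply (product_derive B1 q _ (fun t => energy F rho2 t - energy F rho1 t)); [assumption | |].
    + apply (w_der Wt), (br_r B1 z Hz').
    + apply derive_minus; [exact (energy_derive Wt Fo B2 z Hz') | exact (energy_derive Wt Fo B1 z Hz')].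
  - intros z Hz. assert (Hz' : lo < z < hi) by lra.
    assert (P1 := br_rho B1 z Hz'). assert (P2 := br_rho B2 z Hz').
    assert (R1 := br_r B1 z Hz'). assert (Hq := w_pos Wt _ R1). assert (Hd := w_dpos Wt _ R1).
    assert (Hp := w_logder Wt _ _ R1 (Hr z ltac:(lra))).
    unfold energy.
    assert (I1 : q (r1 z) * (dq (r2 z) / q (r2 z) * rho2 z) <= dq (r1 z) * rho2 z).
    { replace (dq (r1 z) * rho2 z) with (q (r1 z) * (dq (r1 z) / q (r1 z) * rho2 z))
        by (field; lra).
      apply Rmult_le_compat_l; [lra |]. apply Rmult_le_compat_r; lra. }
    assert (I2 : 0 <= dq (r1 z) * (rho2 z - rho1 z) ^ 2 / (2 * rho1 z)).
    { apply Rmult_le_pos; [| apply Rlt_le, Rinv_0_lt_compat; lra].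
      apply Rmult_le_pos; [lra | apply pow2_ge_0]. }
    replace (- dq (r1 z) / rho1 z *
      (rho2 z * rho2 z / 2 + F z - (rho1 z * rho1 z / 2 + F z)) +
      q (r1 z) * (dq (r2 z) / q (r2 z) * rho2 z - dq (r1 z) / q (r1 z) * rho1 z))
    with (q (r1 z) * (dq (r2 z) / q (r2 z) * rho2 z) - dq (r1 z) * rho2 z
       - dq (r1 z) * (rho2 z - rho1 z) ^ 2 / (2 * rho1 z)).
    + lra.
    + assert (q (r2 z) <> 0) by (apply Rgt_not_eq, (w_pos Wt), (br_r B2 z Hz')).
      field. lra.
Qed.

Lemma rho_gap_continuous (s : R) : lo < s < hi -> continuous (fun t => rho2 t - rho1 t) s.
Proof.
  intros Hs. eapply is_derive_continuous, derive_minus;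
    [apply (br_drho B2 s Hs) | apply (br_drho B1 s Hs)].
Qed.

Local Notation leads := (leads F r1 rho1 r2 rho2).

(** As long as r1 <= r2 the weighted energy gap of [energy_gap_grows] stays positive,
    so a lead can only end where the radii cross. *)
Lemma leads_until_crossing (x y : R) : lo < x -> x <= y -> y < hi -> leads y ->
  (forall t, x <= t <= y -> leads t) \/
  (exists z, x <= z < y /\ r1 z = r2 z /\ energy F rho1 z < energy F rho2 z /\
     forall t, z < t <= y -> leads t).
Proof.
  intros Hx Hxy Hy [Hry HEy].
  assert (HE : forall z, x <= z <= y -> (forall t, z <= t <= y -> r1 t <= r2 t) ->
    energy F rho1 z < energy F rho2 z).
  { intros z Hz Hord.
    assert (G := energy_gap_grows z y ltac:(lra) ltac:(lra) Hy Hord).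
    assert (Q1 := w_pos Wt _ (br_r B1 y ltac:(lra))).
    assert (Q2 := w_pos Wt _ (br_r B1 z ltac:(lra))).
    assert (0 < q (r1 y) * (energy F rho2 y - energy F rho1 y))
      by (apply Rmult_lt_0_compat; lra).
    assert (0 < energy F rho2 z - energy F rho1 z); [| lra].
    apply (Rmult_lt_reg_l (q (r1 z))); lra. }
  assert (Hc : forall z, x <= z <= y -> continuous (fun t => r2 t - r1 t) z).
  { intros z Hz. apply (continuous_minus r2 r1); eapply is_derive_continuous;
      [apply (br_dr B2) | apply (br_dr B1)]; lra. }
  destruct (classic (forall t, x <= t <= y -> r1 t < r2 t)) as [Hall | Hnot].
  - left. intros t Ht. split; [now apply Hall |].
    apply HE; [assumption |]. intros u Hu. apply Rlt_le, Hall. lra.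
  - right. apply not_all_ex_not in Hnot. destruct Hnot as [z0 Hz0].
    apply imply_to_and in Hz0. destruct Hz0 as [Hz0 Hn].
    destruct (highest_zero (fun t => r2 t - r1 t) z0 y) as (z & Hz & Hz1 & Habove).
    + lra.
    + intros t Ht. apply Hc. lra.
    + lra.
    + lra.
    + assert (Hab : forall t, z < t <= y -> r1 t < r2 t).
      { intros t Ht. specialize (Habove t Ht). lra. }
      exists z. repeat split; try lra.
      * apply HE; [lra |]. intros t [[Ht | <-] Ht']; [| lra].
        apply Rlt_le, Hab. lra.
      * apply Hab. assumption.
      * apply HE; [lra |]. intros u Hu. apply Rlt_le, Hab. lra.
Qed.

(** (q^2 E)' = - 2 q q' F / rho, and F <= 0 here. While solution 2 is earlier and
    faster the gap of q^2 E grows downwards, because q q' increases; conversely the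
    order of q^2 E makes solution 2 faster, and then it stays earlier. *)
Lemma weight_sq_energy_persists (x y : R) : lo < x -> x <= y -> y < hi ->
  - beta <= x -> y <= beta ->
  r2 y <= r1 y ->
  q (r1 y) * q (r1 y) * energy F rho1 y < q (r2 y) * q (r2 y) * energy F rho2 y ->
  r2 x <= r1 x /\
  q (r1 x) * q (r1 x) * energy F rho1 x < q (r2 x) * q (r2 x) * energy F rho2 x.
Proof.
  intros Hx Hxy Hy Hbx Hby Hry HWy.
  assert (Hsp : forall z, x <= z <= y -> r2 z <= r1 z ->
    q (r1 z) * q (r1 z) * energy F rho1 z < q (r2 z) * q (r2 z) * energy F rho2 z ->
    rho1 z < rho2 z).
  { intros z Hz Hr HW. apply speed_of_energy; [lra |].
    assert (R2 := br_r B2 z ltac:(lra)). assert (Q2 := w_pos Wt _ R2).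
    assert (Qm := weight_monotone _ _ R2 Hr). assert (E1 := br_energy B1 z ltac:(lra)).
    apply (Rmult_lt_reg_l (q (r2 z) * q (r2 z))); [nra |].
    apply Rle_lt_trans with (q (r1 z) * q (r1 z) * energy F rho1 z); [| assumption].
    apply Rmult_le_compat_r; nra. }
  assert (Hstep : forall z, x <= z <= y -> (forall t, z < t < y -> rho1 t < rho2 t) ->
    r2 z <= r1 z /\
    q (r1 z) * q (r1 z) * energy F rho1 z < q (r2 z) * q (r2 z) * energy F rho2 z).
  { intros z Hz Hab.
    assert (Hr : forall t, z <= t <= y -> r2 t <= r1 t).
    { intros t Ht. assert (D := delay_grows t y ltac:(lra) ltac:(lra) Hy).
      assert (r1 y - r2 y <= r1 t - r2 t); [| lra].
      apply D. intros u Hu. apply Rlt_le, Hab. lra. }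
    split; [apply Hr; lra |].
    assert (M : q (r1 z) * q (r1 z) * energy F rho1 z - q (r2 z) * q (r2 z) * energy F rho2 z <=
                q (r1 y) * q (r1 y) * energy F rho1 y - q (r2 y) * q (r2 y) * energy F rho2 y);
      [| lra].
    apply (nondecreasing_of_derive
      (fun t => q (r1 t) * q (r1 t) * energy F rho1 t - q (r2 t) * q (r2 t) * energy F rho2 t)
      (fun t => - (2 * (dq (r1 t) * q (r1 t)) * F t / rho1 t) -
                - (2 * (dq (r2 t) * q (r2 t)) * F t / rho2 t))); [lra | |].
    - intros t Ht. apply derive_minus;
        [apply (weight_sq_energy_derive Wt Fo B1) | apply (weight_sq_energy_derive Wt Fo B2)]; lra.
    - intros t Ht. assert (Ht' : lo < t < hi) by lra.
      assert (R2 := br_r B2 t Ht'). assert (P1 := br_rho B1 t Ht').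
      assert (HF := fo_Fnonpos Fo t ltac:(apply Rabs_le; lra)).
      assert (Hqq := w_qdq Wt _ _ R2 (Hr t ltac:(lra))).
      assert (0 < dq (r2 t) * q (r2 t))
        by (apply Rmult_lt_0_compat; [apply (w_dpos Wt) | apply (w_pos Wt)]; assumption).
      assert (Hi : / rho2 t <= / rho1 t)
        by (apply Rinv_le_contravar; [assumption | apply Rlt_le, Hab; lra]).
      assert (0 < / rho2 t) by (apply Rinv_0_lt_compat, (br_rho B2 t Ht')).
      assert (dq (r2 t) * q (r2 t) * / rho2 t <= dq (r1 t) * q (r1 t) * / rho1 t)
        by (apply Rmult_le_compat; lra).
      unfold Rdiv. nra. }
  apply Hstep; [lra |]. intros t Ht.
  assert (0 < rho2 t - rho1 t); [| lra].
  revert t Ht. cut (forall t, x <= t <= y -> 0 < rho2 t - rho1 t).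
  { intros G t Ht. apply G. lra. }
  apply (propagate_down (fun t => rho2 t - rho1 t)).
  - intros z Hz. apply rho_gap_continuous. lra.
  - assert (rho1 y < rho2 y); [| lra]. apply Hsp; [lra | assumption | assumption].
  - intros z Hz Hab. destruct (Hstep z) as [Hr HW]; [lra | |].
    + intros t Ht. specialize (Hab t). lra.
    + assert (rho1 z < rho2 z) by (apply Hsp; [lra | assumption | assumption]). lra.
Qed.

Lemma delay_grows_strictly (x y : R) : lo < x -> x < y -> y < hi ->
  (forall t, x < t < y -> rho1 t < rho2 t) ->
  r1 y - r2 y < r1 x - r2 x.
Proof.
  intros Hx Hxy Hy Hrho.
  assert (r2 x - r1 x < r2 y - r1 y); [| lra].
  apply (increasing_of_derive (fun t => r2 t - r1 t) (fun t => - / rho2 t - - / rho1 t));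
    [assumption | |].
  - intros z Hz. apply derive_minus; [apply (br_dr B2) | apply (br_dr B1)]; lra.
  - intros z Hz. assert (P1 := br_rho B1 z ltac:(lra)).
    assert (/ rho2 z < / rho1 z).
    { apply Rinv_lt_contravar; [| now apply Hrho].
      apply Rmult_lt_0_compat; [assumption | apply (br_rho B2); lra]. }
    lra.
Qed.

Lemma flux_gap_continuous (s : R) : lo < s < hi ->
  continuous (fun t => q (r2 t) * rho2 t - q (r1 t) * rho1 t) s.
Proof.
  intros Hs. eapply is_derive_continuous, derive_minus;
    [apply (flux_derive Wt B2 s Hs) | apply (flux_derive Wt B1 s Hs)].
Qed.

Lemma flux_ratio_derive (s : R) : lo < s < hi ->
  is_derive (fun t => q (r1 t) * rho1 t / (q (r2 t) * rho2 t)) s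
    (q (r1 s) * rho1 s / (q (r2 s) * rho2 s) *
       (f s * (/ (rho2 s * rho2 s) - / (rho1 s * rho1 s)))).
Proof.
  intros Hs. assert (W2 := flux_pos Wt B2 s Hs).
  assert (P1 := br_rho B1 s Hs). assert (P2 := br_rho B2 s Hs).
  assert (Q1 := w_pos Wt _ (br_r B1 s Hs)). assert (Q2 := w_pos Wt _ (br_r B2 s Hs)).
  eapply is_derive_value.
  - apply is_derive_div; [apply (flux_derive Wt B1 s Hs) | apply (flux_derive Wt B2 s Hs) | lra].
  - cbv beta. field. lra.
Qed.

Lemma inv_sq_gap (s : R) : lo < s < hi -> rho1 s < rho2 s ->
  / (rho2 s * rho2 s) - / (rho1 s * rho1 s) < 0.
Proof.
  intros Hs Hlt. assert (P1 := br_rho B1 s Hs). assert (P2 := br_rho B2 s Hs).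
  assert (/ (rho2 s * rho2 s) < / (rho1 s * rho1 s)); [| lra].
  apply Rinv_lt_contravar; [| nra]. repeat apply Rmult_lt_0_compat; assumption.
Qed.

(** Smaller flux at a larger radius means smaller speed, and the slower solution falls
    further behind. *)
Lemma later_and_slower (x y : R) : lo < x -> x <= y -> y < hi -> r2 y <= r1 y ->
  (forall t, x <= t <= y -> q (r1 t) * rho1 t < q (r2 t) * rho2 t) ->
  forall t, x <= t <= y -> r2 t <= r1 t /\ rho1 t < rho2 t.
Proof.
  intros Hx Hxy Hy Hr Hw.
  assert (Hord : forall z, x <= z <= y -> (forall t, z < t < y -> rho1 t < rho2 t) ->
    r2 z <= r1 z /\ rho1 z < rho2 z).
  { intros z Hz Hab.
    assert (D : r1 y - r2 y <= r1 z - r2 z).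
    { apply delay_grows; try lra. intros t Ht. apply Rlt_le, Hab, Ht. }
    split; [lra |]. apply slower_if_smaller_flux; [lra | lra | apply Hw, Hz]. }
  assert (Hall : forall t, x <= t <= y -> 0 < rho2 t - rho1 t).
  { apply (propagate_down (fun t => rho2 t - rho1 t)).
    - intros z Hz. apply rho_gap_continuous. lra.
    - destruct (Hord y); [lra | intros; lra | lra].
    - intros z Hz Hab. destruct (Hord z); [lra | | lra].
      intros t Ht. specialize (Hab t). lra. }
  intros t Ht. apply Hord; [assumption |]. intros u Hu. specialize (Hall u). lra.
Qed.

(** The logarithmic derivative of w1 / w2, where w = q rho, is f (1 / rho2^2 - 1 /
    rho1^2); it is nonnegative when f <= 0 and solution 2 is faster. *)
Lemma flux_order_persists (x y : R) : lo < x -> x <= y -> y < hi ->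
  (forall t, x <= t <= y -> f t <= 0) ->
  r2 y <= r1 y -> q (r1 y) * rho1 y < q (r2 y) * rho2 y ->
  forall t, x <= t <= y -> q (r1 t) * rho1 t < q (r2 t) * rho2 t.
Proof.
  intros Hx Hxy Hy Hf Hr Hw.
  cut (forall t, x <= t <= y -> 0 < q (r2 t) * rho2 t - q (r1 t) * rho1 t).
  { intros G t Ht. specialize (G t Ht). lra. }
  apply (propagate_down (fun t => q (r2 t) * rho2 t - q (r1 t) * rho1 t)).
  - intros z Hz. apply flux_gap_continuous. lra.
  - lra.
  - intros z Hz Hab.
    assert (Hsl : forall t, z < t <= y -> rho1 t < rho2 t).
    { intros t Ht. apply (later_and_slower t y); try lra.
      intros u Hu. specialize (Hab u). lra. }
    assert (M : q (r1 z) * rho1 z / (q (r2 z) * rho2 z) <= q (r1 y) * rho1 y / (q (r2 y) * rho2 y)).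
    { apply (nondecreasing_of_derive (fun t => q (r1 t) * rho1 t / (q (r2 t) * rho2 t))
        (fun t => q (r1 t) * rho1 t / (q (r2 t) * rho2 t) *
           (f t * (/ (rho2 t * rho2 t) - / (rho1 t * rho1 t))))); [lra | |].
      - intros t Ht. apply flux_ratio_derive. lra.
      - intros t Ht. assert (Ht' : lo < t < hi) by lra.
        assert (I := inv_sq_gap t Ht' ltac:(apply Hsl; lra)).
        assert (Ff := Hf t ltac:(lra)).
        apply Rmult_le_pos; [| nra].
        apply Rlt_le, Rdiv_lt_0_compat; [apply (flux_pos Wt B1) | apply (flux_pos Wt B2)]; assumption. }
    assert (W2 := flux_pos Wt B2 y ltac:(lra)). assert (W2z := flux_pos Wt B2 z ltac:(lra)).
    assert (L : q (r1 y) * rho1 y / (q (r2 y) * rho2 y) < 1).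
    { apply Rmult_lt_reg_r with (q (r2 y) * rho2 y); [assumption |].
      replace (q (r1 y) * rho1 y / (q (r2 y) * rho2 y) * (q (r2 y) * rho2 y))
        with (q (r1 y) * rho1 y) by (field; split; intro; nra). lra. }
    assert (L' : q (r1 z) * rho1 z / (q (r2 z) * rho2 z) < 1) by lra.
    apply (Rmult_lt_compat_r (q (r2 z) * rho2 z)) in L'; [| assumption].
    replace (q (r1 z) * rho1 z / (q (r2 z) * rho2 z) * (q (r2 z) * rho2 z))
        with (q (r1 z) * rho1 z) in L' by (field; split; intro; nra). lra.
Qed.

Local Notation mean := (mean q Q F).

(** With S = w1 / w2, w = q rho, the function Q E1 - S Q E2 is nondecreasing in s: one
    part of its derivative is w1 (H (r2) - H (r1)), the other has the sign of f Q E2 -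
    w2 F. Its sign is the order of the means. *)
Lemma mean_order_persists (x y : R) : lo < x -> x <= y -> y < hi ->
  (forall t, x <= t <= y -> 0 <= f t /\
     0 <= f t * (Q (r2 t) * energy F rho2 t) - q (r2 t) * rho2 t * F t) ->
  r2 y <= r1 y -> rho1 y < rho2 y -> mean r1 rho1 y < mean r2 rho2 y ->
  forall t, x <= t <= y ->
    r2 t <= r1 t /\ rho1 t < rho2 t /\ mean r1 rho1 t < mean r2 rho2 t.
Proof.
  intros Hx Hxy Hy Hf Hr Hrho Hm.
  set (M := fun t => Q (r1 t) * energy F rho1 t -
    q (r1 t) * rho1 t / (q (r2 t) * rho2 t) * (Q (r2 t) * energy F rho2 t)).
  assert (HM : forall t, lo < t < hi -> (M t < 0 <-> mean r1 rho1 t < mean r2 rho2 t)).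
  { intros t Ht. assert (W1 := flux_pos Wt B1 t Ht). assert (W2 := flux_pos Wt B2 t Ht).
    replace (M t) with (q (r1 t) * rho1 t * (mean r1 rho1 t - mean r2 rho2 t)).
    - split; intros; nra.
    - assert (P1 := br_rho B1 t Ht). assert (P2 := br_rho B2 t Ht).
      assert (Q1 := w_pos Wt _ (br_r B1 t Ht)). assert (Q2 := w_pos Wt _ (br_r B2 t Ht)).
      unfold M, mean. field. lra. }
  assert (Hord : forall z, x <= z <= y -> (forall t, z < t < y -> rho1 t < rho2 t) ->
    r2 z <= r1 z /\ mean r1 rho1 z < mean r2 rho2 z).
  { intros z Hz Hab.
    assert (Hrt : forall t, z <= t <= y -> r2 t <= r1 t).
    { intros t Ht. assert (r1 y - r2 y <= r1 t - r2 t); [| lra].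
      apply delay_grows; try lra. intros u Hu. apply Rlt_le, Hab. lra. }
    split; [apply Hrt; lra |].
    apply HM; [lra |]. apply Rle_lt_trans with (M y); [| apply HM; [lra | assumption]].
    apply (nondecreasing_of_derive M (fun t =>
      q (r1 t) * rho1 t * (H (r2 t) - H (r1 t)) +
      - (/ (rho2 t * rho2 t) - / (rho1 t * rho1 t)) * (q (r1 t) * rho1 t / (q (r2 t) * rho2 t)) *
      (f t * (Q (r2 t) * energy F rho2 t) - q (r2 t) * rho2 t * F t))); [lra | |].
    - intros t Ht. assert (Ht' : lo < t < hi) by lra.
      assert (P1 := br_rho B1 t Ht'). assert (P2 := br_rho B2 t Ht').
      assert (Q1 := w_pos Wt _ (br_r B1 t Ht')). assert (Q2 := w_pos Wt _ (br_r B2 t Ht')).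
      unfold M. eapply is_derive_value.
      + apply derive_minus; [apply (prim_energy_derive Wt Fo B1 t Ht') |].
        apply derive_mult; [apply flux_ratio_derive; assumption |
          apply (prim_energy_derive Wt Fo B2 t Ht')].
      + cbv beta. field. lra.
    - intros t Ht. assert (Ht' : lo < t < hi) by lra.
      destruct (Hf t) as [F1 F2]; [lra |].
      assert (I := inv_sq_gap t Ht' ltac:(apply Hab; lra)).
      assert (W1 := flux_pos Wt B1 t Ht'). assert (W2 := flux_pos Wt B2 t Ht').
      assert (HH := w_Hmono Wt _ _ (br_r B2 t Ht') (Hrt t ltac:(lra))).
      apply Rplus_le_le_0_compat; [apply Rmult_le_pos; lra |].
      apply Rmult_le_pos; [| assumption].
      apply Rmult_le_pos; [lra |]. apply Rlt_le, Rdiv_lt_0_compat; assumption. }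
  assert (Hall : forall t, x <= t <= y -> 0 < rho2 t - rho1 t).
  { apply (propagate_down (fun t => rho2 t - rho1 t)).
    - intros z Hz. apply rho_gap_continuous. lra.
    - lra.
    - intros z Hz Hab.
      destruct (Hord z) as [Hrz Hmz]; [lra | intros t Ht; specialize (Hab t); lra |].
      destruct (nonneg_at_left_end (fun t => rho2 t - rho1 t) z y) as [Hlt | Heq];
        [lra | apply rho_gap_continuous; lra | assumption | assumption |].
      (* equal speeds would order the means the other way, as Q / q increases *)
      exfalso. assert (Hz' : lo < z < hi) by lra.
      assert (Er : rho1 z = rho2 z) by lra.
      assert (P2 := br_rho B2 z Hz'). assert (R2 := br_r B2 z Hz').
      assert (Q1 := w_pos Wt _ (br_r B1 z Hz')). assert (Q2 := w_pos Wt _ R2).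
      assert (Hra := ratio_monotone _ _ R2 Hrz).
      assert (E2 := br_energy B2 z Hz').
      unfold mean, energy in Hmz. unfold energy in E2. rewrite Er in Hmz.
      replace (Q (r1 z) * (rho2 z * rho2 z / 2 + F z) / (q (r1 z) * rho2 z)) with
        (Q (r1 z) / q (r1 z) * ((rho2 z * rho2 z / 2 + F z) / rho2 z)) in Hmz by (field; lra).
      replace (Q (r2 z) * (rho2 z * rho2 z / 2 + F z) / (q (r2 z) * rho2 z)) with
        (Q (r2 z) / q (r2 z) * ((rho2 z * rho2 z / 2 + F z) / rho2 z)) in Hmz by (field; lra).
      assert (0 < (rho2 z * rho2 z / 2 + F z) / rho2 z) by (apply Rdiv_lt_0_compat; assumption).
      nra. }
  intros t Ht. destruct (Hord t) as [G1 G2]; [assumption | |].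
  - intros u Hu. specialize (Hall u). lra.
  - specialize (Hall t Ht). repeat split; lra.
Qed.
(** Q / q = (Q / q^2) q, and Q / q^2 does not increase. *)
Lemma lags_ratio (s : R) : lo < s < hi -> lags q r1 rho1 r2 rho2 s ->
  Q (r1 s) / q (r1 s) * rho1 s < Q (r2 s) / q (r2 s) * rho2 s.
Proof.
  intros Hs [Hr Hw].
  assert (R1 := br_r B1 _ Hs). assert (R2 := br_r B2 _ Hs).
  assert (A := ratio_over_weight_antitone _ _ R2 Hr).
  assert (Q1 := w_pos Wt _ R1). assert (Q2 := w_pos Wt _ R2).
  assert (W1 := flux_pos Wt B1 _ Hs).
  assert (C2 : 0 < Q (r2 s) / (q (r2 s) * q (r2 s))).
  { apply Rdiv_lt_0_compat; [now apply (w_primpos Wt) | now apply Rmult_lt_0_compat]. }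
  replace (Q (r1 s) / q (r1 s) * rho1 s) with
    (Q (r1 s) / (q (r1 s) * q (r1 s)) * (q (r1 s) * rho1 s)) by (field; lra).
  replace (Q (r2 s) / q (r2 s) * rho2 s) with
    (Q (r2 s) / (q (r2 s) * q (r2 s)) * (q (r2 s) * rho2 s)) by (field; lra).
  apply Rle_lt_trans with (Q (r2 s) / (q (r2 s) * q (r2 s)) * (q (r1 s) * rho1 s)).
  - apply Rmult_le_compat_r; lra.
  - apply Rmult_lt_compat_l; assumption.
Qed.
End Pair.

(** * The Pohozaev function *)

(** The derivative appears as a witness, so that the condition includes
    differentiability of F / f. *)
Definition growth (c : Rbar) (f F : R -> R) (beta kmin : R) : Prop :=
  forall s, beta <= Rabs s -> in_dom c s ->
    exists k, is_derive (fun t => F t / f t) s k /\ kmin <= k.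

(** The factor F / f of the flux is the one for which the term q F / rho of (Q E)'
    cancels; only a multiple of the flux remains in [pohozaev_derive]. *)
Definition pohozaev (q Q f F r rho : R -> R) (s : R) : R :=
  Q (r s) * energy F rho s - q (r s) * rho s * (F s / f s).

Section Pohozaev.
Context {c : Rbar} {q dq Q H f F : R -> R} {Hinf b beta lo hi : R}.
Context (Wt : weight q dq Q H Hinf) (Fo : force c f F b beta).
Context (Gr : growth c f F beta (1 / 2 - Hinf)).

Lemma force_nonzero (s : R) : beta <= Rabs s -> in_dom c s -> f s <> 0.
Proof.
  intros Hs Hd. assert (Hb := fo_b Fo).
  destruct (Rle_or_lt 0 s) as [Hp | Hn].
  - rewrite Rabs_pos_eq in Hs by assumption.
    apply Rgt_not_eq, (fo_pos Fo); [lra | assumption].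
  - rewrite Rabs_left in Hs by assumption.
    assert (Hd' : in_dom c (- s)) by (unfold in_dom; now rewrite Rabs_Ropp).
    assert (P := fo_pos Fo (- s) ltac:(lra) Hd').
    rewrite (fo_odd Fo s Hd) in P. lra.
Qed.

Lemma pohozaev_derive {r rho : R -> R} (Br : branch c q dq f F lo hi r rho) (s k : R) :
  lo < s < hi -> beta <= Rabs s -> is_derive (fun t => F t / f t) s k ->
  is_derive (pohozaev q Q f F r rho) s (- (q (r s) * rho s * (k - (1 / 2 - H (r s))))).
Proof.
  intros Hs Hb Hk. assert (Hn := force_nonzero s Hb (br_dom Br s Hs)).
  assert (P := br_rho Br s Hs).
  eapply is_derive_value.
  - apply derive_minus; [apply (prim_energy_derive Wt Fo Br s Hs) |].
    apply (derive_mult (fun t => q (r t) * rho t)); [apply (flux_derive Wt Br s Hs) | exact Hk].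
  - cbv beta. field. lra.
Qed.

Lemma growth_derive (s : R) : beta <= Rabs s -> in_dom c s ->
  is_derive (fun t => F t / f t) s (Derive (fun t => F t / f t) s) /\
  1 / 2 - Hinf <= Derive (fun t => F t / f t) s.
Proof.
  intros Hs Hd. destruct (Gr s Hs Hd) as (k & Hk & Hk').
  assert (E : Derive (fun t => F t / f t) s = k) by now apply is_derive_unique.
  rewrite E. now split.
Qed.

Lemma pohozaev_increases {r rho : R -> R} (Br : branch c q dq f F lo hi r rho) (x y : R) :
  lo < x -> x <= y -> y < hi -> (forall t, x <= t <= y -> beta <= Rabs t) ->
  pohozaev q Q f F r rho y <= pohozaev q Q f F r rho x.
Proof.
  intros Hx Hxy Hy Hb.
  apply (nonincreasing_of_derive _ (fun t =>
    - (q (r t) * rho t * (Derive (fun u => F u / f u) t - (1 / 2 - H (r t))))));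
    [assumption | |].
  - intros z Hz. assert (Hz' : lo < z < hi) by lra.
    apply (pohozaev_derive Br); [assumption | now apply Hb |].
    apply growth_derive; [now apply Hb | apply (br_dom Br z Hz')].
  - intros z Hz. assert (Hz' : lo < z < hi) by lra.
    destruct (growth_derive z) as [_ G]; [apply Hb; lra | apply (br_dom Br z Hz') |].
    assert (R := br_r Br z Hz').
    assert (HH := w_Hinf Wt _ R).
    assert (0 < q (r z) * rho z)
      by (apply Rmult_lt_0_compat; [apply (w_pos Wt), R | apply (br_rho Br z Hz')]).
    nra.
Qed.

Context {r1 rho1 r2 rho2 : R -> R}.
Context (B1 : branch c q dq f F lo hi r1 rho1) (B2 : branch c q dq f F lo hi r2 rho2).

(** With k = (F / f)' and w = q rho, minus the derivative of the gap is (k - (1 / 2 -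
    Hinf)) (w2 - w1) + (w2 (H (r2) - Hinf) - w1 (H (r1) - Hinf)). *)
Lemma pohozaev_gap_grows (x y : R) :
  lo < x -> x <= y -> y < hi -> (forall t, x <= t <= y -> beta <= Rabs t) ->
  (forall t, x < t < y -> q (r1 t) * rho1 t <= q (r2 t) * rho2 t) ->
  (forall t, x < t < y -> q (r1 t) * rho1 t * (H (r1 t) - Hinf) <=
                          q (r2 t) * rho2 t * (H (r2 t) - Hinf)) ->
  pohozaev q Q f F r2 rho2 y - pohozaev q Q f F r1 rho1 y <=
  pohozaev q Q f F r2 rho2 x - pohozaev q Q f F r1 rho1 x.
Proof.
  intros Hx Hxy Hy Hb Hw HH.
  set (k := Derive (fun u => F u / f u)).
  apply (nonincreasing_of_derive
    (fun t => pohozaev q Q f F r2 rho2 t - pohozaev q Q f F r1 rho1 t) (fun t =>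
    - (q (r2 t) * rho2 t * (k t - (1 / 2 - H (r2 t)))) -
    - (q (r1 t) * rho1 t * (k t - (1 / 2 - H (r1 t)))))); [assumption | |].
  - intros z Hz. assert (Hz' : lo < z < hi) by lra.
    destruct (growth_derive z) as [G _]; [apply Hb; lra | apply (br_dom B1 z Hz') |].
    apply derive_minus; [apply (pohozaev_derive B2) | apply (pohozaev_derive B1)];
      try assumption; apply Hb; lra.
  - intros z Hz. assert (Hz' : lo < z < hi) by lra.
    destruct (growth_derive z) as [_ G]; [apply Hb; lra | apply (br_dom B1 z Hz') |].
    fold (k z) in G. specialize (Hw z Hz). specialize (HH z Hz).
    assert (0 <= (k z - (1 / 2 - Hinf)) * (q (r2 z) * rho2 z - q (r1 z) * rho1 z))
      by (apply Rmult_le_pos; lra).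
    lra.
Qed.

(** A lead orders radii and speeds, hence the fluxes; for the products with H - Hinf
    it is the monotonicity of q (H - Hinf) that counts. *)
Lemma pohozaev_gap_grows_leading (x y : R) :
  lo < x -> x <= y -> y < hi -> (forall t, x <= t <= y -> beta <= Rabs t) ->
  (forall t, x < t < y -> leads F r1 rho1 r2 rho2 t) ->
  pohozaev q Q f F r2 rho2 y - pohozaev q Q f F r1 rho1 y <=
  pohozaev q Q f F r2 rho2 x - pohozaev q Q f F r1 rho1 x.
Proof.
  intros Hx Hxy Hy Hb Hl.
  assert (Hq : forall t, x < t < y -> 0 <= q (r1 t) <= q (r2 t) /\ 0 <= rho1 t <= rho2 t).
  { intros t Ht. assert (Ht' : lo < t < hi) by lra. destruct (Hl t Ht) as [Hr HE].
    apply (speed_of_energy B1 B2 t Ht') in HE.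
    assert (R1 := br_r B1 t Ht').
    assert (q (r1 t) <= q (r2 t)) by (apply (weight_monotone Wt); lra).
    assert (0 < q (r1 t)) by now apply (w_pos Wt).
    assert (P1 := br_rho B1 t Ht'). lra. }
  apply pohozaev_gap_grows; try assumption.
  - intros t Ht. destruct (Hq t Ht). apply Rmult_le_compat; lra.
  - intros t Ht. destruct (Hq t Ht). destruct (Hl t Ht) as [Hr _].
    assert (R1 := br_r B1 t ltac:(lra)).
    assert (A := w_qH Wt _ _ R1 (Rlt_le _ _ Hr)).
    assert (0 <= q (r1 t) * (H (r1 t) - Hinf)).
    { apply Rmult_le_pos; [lra |]. assert (C := w_Hinf Wt _ R1). lra. }
    replace (q (r1 t) * rho1 t * (H (r1 t) - Hinf)) with
      (q (r1 t) * (H (r1 t) - Hinf) * rho1 t) by ring.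
    replace (q (r2 t) * rho2 t * (H (r2 t) - Hinf)) with
      (q (r2 t) * (H (r2 t) - Hinf) * rho2 t) by ring.
    apply Rmult_le_compat; lra.
Qed.

(** Here solution 2 is at the smaller radius, where H is larger. *)
Lemma pohozaev_gap_grows_lagging (x y : R) :
  lo < x -> x <= y -> y < hi -> (forall t, x <= t <= y -> beta <= Rabs t) ->
  (forall t, x < t < y -> r2 t <= r1 t /\ q (r1 t) * rho1 t < q (r2 t) * rho2 t) ->
  pohozaev q Q f F r2 rho2 y - pohozaev q Q f F r1 rho1 y <=
  pohozaev q Q f F r2 rho2 x - pohozaev q Q f F r1 rho1 x.
Proof.
  intros Hx Hxy Hy Hb Hl.
  apply pohozaev_gap_grows; try assumption.
  - intros t Ht. destruct (Hl t Ht). lra.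
  - intros t Ht. assert (Ht' : lo < t < hi) by lra. destruct (Hl t Ht) as [Hr Hw].
    assert (W1 := flux_pos Wt B1 t Ht').
    assert (HH := w_Hmono Wt _ _ (br_r B2 t Ht') Hr).
    assert (C := w_Hinf Wt _ (br_r B1 t Ht')).
    apply Rmult_le_compat; lra.
Qed.

(** Either the flux order survives, or the fluxes meet at some level. There the order
    of the Pohozaev functions is the order of the means Q E / (q rho), which persists
    from then on, since P2 >= 0 is the sign that [mean_order_persists] asks for. At
    beta, where F = 0, the mean is (Q / q) rho / 2. *)
Lemma lagging_reaches_beta (y : R) : lo < beta -> beta <= y -> y < hi ->
  r2 y <= r1 y -> q (r1 y) * rho1 y < q (r2 y) * rho2 y ->
  pohozaev q Q f F r1 rho1 y < pohozaev q Q f F r2 rho2 y ->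
  0 <= pohozaev q Q f F r2 rho2 y ->
  lags_weakly q Q r1 rho1 r2 rho2 beta.
Proof.
  intros Hlo Hby Hy Hr Hw HP HP2.
  assert (Hb0 := fo_b Fo).
  assert (Habs : forall t, beta <= t -> beta <= Rabs t).
  { intros t Ht. rewrite Rabs_pos_eq; lra. }
  assert (Hbeta : lo < beta < hi) by lra.
  assert (R1 := br_r B1 beta Hbeta). assert (R2 := br_r B2 beta Hbeta).
  assert (Q1 := w_pos Wt _ R1). assert (Q2 := w_pos Wt _ R2).
  destruct (classic (forall t, beta <= t <= y -> q (r1 t) * rho1 t < q (r2 t) * rho2 t))
    as [Hall | Hnot].
  - destruct (later_and_slower Wt B1 B2 beta y Hlo Hby Hy Hr Hall beta) as [Hrb _]; [lra |].
    split; [assumption |].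
    apply (lags_ratio Wt B1 B2 beta Hbeta). split; [assumption | apply Hall; lra].
  - apply not_all_ex_not in Hnot. destruct Hnot as [z0 Hz0].
    apply imply_to_and in Hz0. destruct Hz0 as [Hz0 Hn].
    destruct (highest_zero (fun t => q (r2 t) * rho2 t - q (r1 t) * rho1 t) z0 y)
      as (z & Hz & Hz1 & Habove).
    + lra.
    + intros t Ht. apply (flux_gap_continuous Wt B1 B2). lra.
    + lra.
    + lra.
    + assert (Hz' : lo < z < hi) by lra.
      assert (Hlag : forall t, z < t <= y -> r2 t <= r1 t /\ rho1 t < rho2 t).
      { intros t Ht. apply (later_and_slower Wt B1 B2 t y); try lra.
        intros u Hu. specialize (Habove u). lra. }
      assert (Hrz : r2 z < r1 z).
      { assert (r1 y - r2 y < r1 z - r2 z); [| lra].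
        apply (delay_grows_strictly B1 B2); try lra. intros t Ht. apply Hlag. lra. }
      assert (Rz1 := br_r B1 z Hz'). assert (Rz2 := br_r B2 z Hz').
      assert (Qz1 := w_pos Wt _ Rz1). assert (Qz2 := w_pos Wt _ Rz2).
      assert (Pz1 := br_rho B1 z Hz'). assert (Pz2 := br_rho B2 z Hz').
      assert (Hqz : q (r2 z) < q (r1 z)).
      { apply (increasing_of_derive q dq); [assumption | |].
        - intros t Ht. apply (w_der Wt). lra.
        - intros t Ht. apply (w_dpos Wt). lra. }
      assert (Hrhoz : rho1 z < rho2 z) by nra.
      assert (HPz : pohozaev q Q f F r1 rho1 z < pohozaev q Q f F r2 rho2 z).
      { assert (G := pohozaev_gap_grows_lagging z y ltac:(lra) ltac:(lra) Hy).
        assert (pohozaev q Q f F r2 rho2 y - pohozaev q Q f F r1 rho1 y <=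
          pohozaev q Q f F r2 rho2 z - pohozaev q Q f F r1 rho1 z); [| lra].
        apply G.
        - intros t Ht. apply Habs. lra.
        - intros t Ht. split; [apply Hlag; lra |]. specialize (Habove t). lra. }
      assert (Hmz : mean q Q F r1 rho1 z < mean q Q F r2 rho2 z).
      { unfold pohozaev in HPz. unfold mean.
        assert (Ew : q (r1 z) * rho1 z = q (r2 z) * rho2 z) by lra.
        rewrite Ew in HPz |- *. apply Rmult_lt_compat_r; [| lra].
        apply Rinv_0_lt_compat. now apply Rmult_lt_0_compat. }
      destruct (mean_order_persists Wt Fo B1 B2 beta z) with (t := beta) as (G1 & G2 & G3);
        try lra.
      { intros t Ht. assert (Ht' : lo < t < hi) by lra.
        assert (Pf := fo_pos Fo t ltac:(lra) (br_dom B1 t Ht')).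
        split; [lra |].
        assert (HPt : 0 <= pohozaev q Q f F r2 rho2 t).
        { apply Rle_trans with (pohozaev q Q f F r2 rho2 y); [assumption |].
          apply (pohozaev_increases B2); try lra. intros u Hu. apply Habs. lra. }
        unfold pohozaev in HPt.
        replace (f t * (Q (r2 t) * energy F rho2 t) - q (r2 t) * rho2 t * F t) with
          (f t * (Q (r2 t) * energy F rho2 t - q (r2 t) * rho2 t * (F t / f t))) by (field; lra).
        apply Rmult_le_pos; lra. }
      split; [assumption |].
      unfold mean, energy in G3. rewrite (fo_Fbeta Fo) in G3.
      assert (Pb1 := br_rho B1 beta Hbeta). assert (Pb2 := br_rho B2 beta Hbeta).
      replace (Q (r1 beta) * (rho1 beta * rho1 beta / 2 + 0) / (q (r1 beta) * rho1 beta)) with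
        (Q (r1 beta) / q (r1 beta) * rho1 beta / 2) in G3 by (field; lra).
      replace (Q (r2 beta) * (rho2 beta * rho2 beta / 2 + 0) / (q (r2 beta) * rho2 beta)) with
        (Q (r2 beta) / q (r2 beta) * rho2 beta / 2) in G3 by (field; lra).
      lra.
Qed.
End Pohozaev.

(** * Decaying branches *)

(** The three quantities are those whose order is followed down to the level 0. *)
Definition decays (q Q F r rho : R -> R) : Prop :=
  forall eps, 0 < eps -> exists d, 0 < d /\ forall s, 0 < s < d ->
    q (r s) * energy F rho s < eps /\
    Q (r s) / q (r s) * rho s < eps /\
    Q (r s) / q (r s) * (Q (r s) / q (r s)) * energy F rho s < eps.

Section Tail.
Context {c : Rbar} {q dq Q H f F : R -> R} {Hinf b beta hi : R}.
Context (Wt : weight q dq Q H Hinf) (Fo : force c f F b beta).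
Context {r1 rho1 r2 rho2 : R -> R}.
Context (B1 : branch c q dq f F 0 hi r1 rho1) (B2 : branch c q dq f F 0 hi r2 rho2).
Context (D2 : decays q Q F r2 rho2).

Lemma level_below (x d : R) : 0 < x -> 0 < d -> exists s, 0 < s < d /\ s <= x.
Proof.
  intros Hx Hd. exists (Rmin x (d / 2)).
  assert (Rmin x (d / 2) <= x) by apply Rmin_l.
  assert (Rmin x (d / 2) <= d / 2) by apply Rmin_r.
  assert (0 < Rmin x (d / 2)) by (apply Rmin_pos; lra). lra.
Qed.

(** The gap q (r1) (E2 - E1) would stay above a positive constant, yet it is at most q
    (r2) E2, which tends to 0. *)
Lemma no_perpetual_lead (y : R) : 0 < y < hi ->
  (forall t, 0 < t <= y -> r1 t <= r2 t) -> ~ energy F rho1 y < energy F rho2 y.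
Proof.
  intros Hy Hr HE.
  set (g := q (r1 y) * (energy F rho2 y - energy F rho1 y)).
  assert (Hg : 0 < g).
  { apply Rmult_lt_0_compat; [apply (w_pos Wt), (br_r B1 y Hy) | lra]. }
  destruct (D2 g Hg) as (d & Hd & Hsmall).
  destruct (level_below y d) as (s & Hs & Hsy); [lra | assumption |].
  destruct (Hsmall s Hs) as [A _].
  assert (G := energy_gap_grows Wt Fo B1 B2 s y ltac:(lra) Hsy ltac:(lra)).
  assert (Hs' : 0 < s < hi) by lra.
  assert (I : g <= q (r1 s) * (energy F rho2 s - energy F rho1 s)).
  { apply G. intros t Ht. apply Hr. lra. }
  assert (R1 := br_r B1 s Hs'). assert (Qp := w_pos Wt _ R1).
  assert (E1 := br_energy B1 s Hs'). assert (E2 := br_energy B2 s Hs').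
  assert (Qm := weight_monotone Wt _ _ R1 (Hr s ltac:(lra))).
  assert (q (r1 s) * (energy F rho2 s - energy F rho1 s) <= q (r2 s) * energy F rho2 s).
  { apply Rle_trans with (q (r1 s) * energy F rho2 s).
    - apply Rmult_le_compat_l; lra.
    - apply Rmult_le_compat_r; lra. }
  lra.
Qed.

Lemma slower_if_smaller_ratio (s : R) : 0 < s < hi -> r2 s <= r1 s ->
  Q (r1 s) / q (r1 s) * rho1 s < Q (r2 s) / q (r2 s) * rho2 s -> rho1 s < rho2 s.
Proof.
  intros Hs Hr Hz. assert (R2 := br_r B2 s Hs).
  assert (A := ratio_monotone Wt _ _ R2 Hr). assert (A2 := ratio_pos Wt _ R2).
  assert (P1 := br_rho B1 s Hs).
  apply (Rmult_lt_reg_l (Q (r2 s) / q (r2 s))); [assumption |].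
  apply Rle_lt_trans with (Q (r1 s) / q (r1 s) * rho1 s); [| assumption].
  apply Rmult_le_compat_r; lra.
Qed.

(** ((Q / q) rho)' = 1 - 2 H - (Q / q) f / rho with f <= 0: while solution 2 is
    earlier and faster, the gap of (Q / q) rho grows downwards, and this gap in turn
    keeps solution 2 faster. So (Q / q) rho2 cannot tend to 0. *)
Lemma ratio_speed_order_impossible_below_b (y : R) : 0 < y < hi -> y <= b ->
  r2 y <= r1 y ->
  ~ Q (r1 y) / q (r1 y) * rho1 y < Q (r2 y) / q (r2 y) * rho2 y.
Proof.
  intros Hy Hyb Hry HZ.
  set (Z := fun (r rho : R -> R) t => Q (r t) / q (r t) * rho t).
  assert (Hord : forall z, 0 < z <= y -> (forall t, z < t < y -> rho1 t < rho2 t) ->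
    r2 z <= r1 z /\ Z r2 rho2 y - Z r1 rho1 y <= Z r2 rho2 z - Z r1 rho1 z).
  { intros z Hz Hab.
    assert (Hrt : forall t, z <= t <= y -> r2 t <= r1 t).
    { intros t Ht. assert (r1 y - r2 y <= r1 t - r2 t); [| lra].
      apply (delay_grows B1 B2); try lra. intros u Hu. apply Rlt_le, Hab. lra. }
    split; [apply Hrt; lra |].
    apply (nonincreasing_of_derive (fun t => Z r2 rho2 t - Z r1 rho1 t) (fun t =>
      (1 - 2 * H (r2 t) - Q (r2 t) / q (r2 t) * f t / rho2 t) -
      (1 - 2 * H (r1 t) - Q (r1 t) / q (r1 t) * f t / rho1 t))); [lra | |].
    - intros t Ht. apply derive_minus;
        [apply (ratio_speed_derive Wt B2) | apply (ratio_speed_derive Wt B1)]; lra.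
    - intros t Ht. assert (Ht' : 0 < t < hi) by lra.
      assert (R2 := br_r B2 t Ht'). assert (P1 := br_rho B1 t Ht').
      assert (HH := w_Hmono Wt _ _ R2 (Hrt t ltac:(lra))).
      assert (A := ratio_monotone Wt _ _ R2 (Hrt t ltac:(lra))).
      assert (A2 := ratio_pos Wt _ R2).
      assert (Ff := fo_nonpos Fo t ltac:(lra)).
      assert (Hi : / rho2 t <= / rho1 t)
        by (apply Rinv_le_contravar; [assumption | apply Rlt_le, Hab; lra]).
      assert (0 < / rho2 t) by (apply Rinv_0_lt_compat, (br_rho B2 t Ht')).
      assert (Q (r2 t) / q (r2 t) * / rho2 t <= Q (r1 t) / q (r1 t) * / rho1 t)
        by (apply Rmult_le_compat; lra).
      unfold Rdiv at 2 4.
      replace (Q (r2 t) / q (r2 t) * f t * / rho2 t) with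
        (Q (r2 t) / q (r2 t) * / rho2 t * f t) by ring.
      replace (Q (r1 t) / q (r1 t) * f t * / rho1 t) with
        (Q (r1 t) / q (r1 t) * / rho1 t * f t) by ring.
      nra. }
  assert (HZ' : 0 < Z r2 rho2 y - Z r1 rho1 y) by (unfold Z; lra).
  destruct (D2 _ HZ') as (d & Hd & Hsmall).
  destruct (level_below y d) as (s & Hs & Hsy); [lra | assumption |].
  destruct (Hsmall s Hs) as (_ & A & _).
  assert (Hall : forall t, s <= t <= y -> 0 < rho2 t - rho1 t).
  { apply (propagate_down (fun t => rho2 t - rho1 t)).
    - intros z Hz. apply (rho_gap_continuous B1 B2). lra.
    - assert (rho1 y < rho2 y) by now apply slower_if_smaller_ratio. lra.
    - intros z Hz Hab. destruct (Hord z) as [G1 G2]; [lra | |].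
      + intros t Ht. specialize (Hab t). lra.
      + assert (rho1 z < rho2 z); [| lra].
        apply slower_if_smaller_ratio; [lra | assumption |]. unfold Z in *. lra. }
  destruct (Hord s) as [_ G]; [lra | intros t Ht; specialize (Hall t); lra |].
  assert (0 < Z r1 rho1 s).
  { apply Rmult_lt_0_compat; [apply (ratio_pos Wt), (br_r B1 s); lra | apply (br_rho B1 s); lra]. }
  unfold Z in *. lra.
Qed.

(** The same scheme for (Q / q)^2 E, whose derivative contains (1 - 2 H) (Q / q) rho:
    the assumed order of (Q / q) rho gives this term the sign that makes the gap grow
    downwards. *)
Lemma ratio_sq_energy_order_impossible (y : R) : 0 < y < hi -> y <= beta ->
  r2 y <= r1 y ->
  (forall t, 0 < t <= y -> r2 t <= r1 t ->
    Q (r2 t) / q (r2 t) * rho2 t <= Q (r1 t) / q (r1 t) * rho1 t) ->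
  ~ Q (r1 y) / q (r1 y) * (Q (r1 y) / q (r1 y)) * energy F rho1 y <
    Q (r2 y) / q (r2 y) * (Q (r2 y) / q (r2 y)) * energy F rho2 y.
Proof.
  intros Hy Hyb Hry HZ HV.
  set (V := fun (r rho : R -> R) t => Q (r t) / q (r t) * (Q (r t) / q (r t)) * energy F rho t).
  assert (Hsp : forall z, 0 < z < hi -> r2 z <= r1 z -> V r1 rho1 z < V r2 rho2 z ->
    rho1 z < rho2 z).
  { intros z Hz Hr HVz. apply (speed_of_energy B1 B2 z Hz).
    assert (R2 := br_r B2 z Hz).
    assert (A := ratio_monotone Wt _ _ R2 Hr). assert (A2 := ratio_pos Wt _ R2).
    assert (E1 := br_energy B1 z Hz).
    set (a1 := Q (r1 z) / q (r1 z)) in *. set (a2 := Q (r2 z) / q (r2 z)) in *.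
    apply (Rmult_lt_reg_l (a2 * a2)); [nra |].
    apply Rle_lt_trans with (V r1 rho1 z); [| assumption].
    unfold V. fold a1. apply Rmult_le_compat_r; nra. }
  assert (Hord : forall z, 0 < z <= y -> (forall t, z < t < y -> rho1 t < rho2 t) ->
    r2 z <= r1 z /\ V r2 rho2 y - V r1 rho1 y <= V r2 rho2 z - V r1 rho1 z).
  { intros z Hz Hab.
    assert (Hrt : forall t, z <= t <= y -> r2 t <= r1 t).
    { intros t Ht. assert (r1 y - r2 y <= r1 t - r2 t); [| lra].
      apply (delay_grows B1 B2); try lra. intros u Hu. apply Rlt_le, Hab. lra. }
    split; [apply Hrt; lra |].
    apply (nonincreasing_of_derive (fun t => V r2 rho2 t - V r1 rho1 t) (fun t =>
      Q (r2 t) / q (r2 t) * ((1 - 2 * H (r2 t)) * rho2 t - 2 * H (r2 t) * F t / rho2 t) -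
      Q (r1 t) / q (r1 t) * ((1 - 2 * H (r1 t)) * rho1 t - 2 * H (r1 t) * F t / rho1 t)));
      [lra | |].
    - intros t Ht. apply derive_minus;
        [apply (ratio_sq_energy_derive Wt Fo B2) | apply (ratio_sq_energy_derive Wt Fo B1)]; lra.
    - intros t Ht. assert (Ht' : 0 < t < hi) by lra.
      assert (R2 := br_r B2 t Ht'). assert (R1 := br_r B1 t Ht').
      assert (P1 := br_rho B1 t Ht'). assert (P2 := br_rho B2 t Ht').
      assert (HH := w_Hmono Wt _ _ R2 (Hrt t ltac:(lra))).
      assert (Hh := w_Hhalf Wt _ R2). assert (Hp := w_Hpos Wt _ R2).
      assert (A := ratio_monotone Wt _ _ R2 (Hrt t ltac:(lra))).
      assert (A2 := ratio_pos Wt _ R2).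
      assert (HF := fo_Fnonpos Fo t ltac:(apply Rabs_le; lra)).
      assert (Hzt := HZ t ltac:(lra) (Hrt t ltac:(lra))).
      assert (Hrho : rho1 t < rho2 t) by (apply Hab; lra).
      assert (Hi : / rho2 t <= / rho1 t) by (apply Rinv_le_contravar; lra).
      assert (Hi2 : 0 < / rho2 t) by now apply Rinv_0_lt_compat.
      assert (E1 := br_energy B1 t Ht'). unfold energy in E1.
      set (a1 := Q (r1 t) / q (r1 t)) in *. set (a2 := Q (r2 t) / q (r2 t)) in *.
      set (h1 := H (r1 t)) in *. set (h2 := H (r2 t)) in *.
      set (i1 := / rho1 t) in *. set (i2 := / rho2 t) in *.
      assert (I1 : i1 * rho1 t = 1) by (unfold i1; field; lra).
      unfold Rdiv. fold i1 i2.
      (* h1 may be replaced by the larger h2, since E1 > 0 gives rho1^2 > - F *)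
      assert (S1 : a1 * ((1 - 2 * h2) * rho1 t - 2 * h2 * F t * i1) <=
                   a1 * ((1 - 2 * h1) * rho1 t - 2 * h1 * F t * i1)).
      { apply Rmult_le_compat_l; [lra |].
        assert (0 <= (h2 - h1) * (rho1 t + F t * i1)); [| lra].
        apply Rmult_le_pos; [lra |].
        replace (rho1 t + F t * i1) with ((rho1 t * rho1 t + F t) * i1)
          by (replace (rho1 t) with (rho1 t * (i1 * rho1 t)) at 3 by (rewrite I1; ring); ring).
        apply Rmult_le_pos; [nra | lra]. }
      assert (S2 : a2 * i2 <= a1 * i1) by (apply Rmult_le_compat; lra).
      assert (S3 : 0 <= (1 - 2 * h2) * (a1 * rho1 t - a2 * rho2 t))
        by (apply Rmult_le_pos; lra).
      assert (S4 : 0 <= 2 * h2 * - F t * (a1 * i1 - a2 * i2))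
        by (repeat apply Rmult_le_pos; lra).
      lra. }
  assert (HV' : 0 < V r2 rho2 y - V r1 rho1 y) by (unfold V; lra).
  destruct (D2 _ HV') as (d & Hd & Hsmall).
  destruct (level_below y d) as (s & Hs & Hsy); [lra | assumption |].
  destruct (Hsmall s Hs) as (_ & _ & A).
  assert (Hall : forall t, s <= t <= y -> 0 < rho2 t - rho1 t).
  { apply (propagate_down (fun t => rho2 t - rho1 t)).
    - intros z Hz. apply (rho_gap_continuous B1 B2). lra.
    - assert (rho1 y < rho2 y); [| lra]. apply Hsp; [lra | assumption | unfold V; lra].
    - intros z Hz Hab. destruct (Hord z) as [G1 G2]; [lra | |].
      + intros t Ht. specialize (Hab t). lra.
      + assert (rho1 z < rho2 z); [| lra]. apply Hsp; [lra | assumption | lra]. }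
  destruct (Hord s) as [_ G]; [lra | intros t Ht; specialize (Hall t); lra |].
  assert (Hs' : 0 < s < hi) by lra.
  assert (0 < V r1 rho1 s).
  { assert (A1 := ratio_pos Wt _ (br_r B1 s Hs')).
    apply Rmult_lt_0_compat; [now apply Rmult_lt_0_compat | apply (br_energy B1 s Hs')]. }
  unfold V in *. lra.
Qed.

(** Above b the order of the means Q E / (q rho) persists. If (Q / q) rho is still
    ordered at b, [ratio_speed_order_impossible_below_b] applies there. Otherwise its
    values meet above b; at the lowest meeting level the order of the means is that of
    (Q / q)^2 E, and [ratio_sq_energy_order_impossible] applies. *)
Lemma lagging_impossible (y : R) : 0 < y < hi -> y <= beta -> beta < hi ->
  r2 y <= r1 y ->
  ~ Q (r1 y) / q (r1 y) * rho1 y < Q (r2 y) / q (r2 y) * rho2 y.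
Proof.
  intros Hy Hyb Hbh Hry HZ. assert (Hb0 := fo_b Fo).
  destruct (Rle_or_lt y b) as [Hle | Hgt].
  { exact (ratio_speed_order_impossible_below_b y Hy Hle Hry HZ). }
  assert (Hrho : rho1 y < rho2 y) by now apply slower_if_smaller_ratio.
  assert (Hmean : forall (r rho : R -> R) t, 0 < q (r t) -> 0 < rho t ->
    mean q Q F r rho t =
    Q (r t) / q (r t) * rho t / 2 + Q (r t) / q (r t) * (F t / rho t)).
  { intros r rho t Hq Hr. unfold mean, energy. field. lra. }
  assert (Hq : forall t, 0 < t < hi -> 0 < q (r1 t) /\ 0 < q (r2 t)).
  { intros t Ht. split; apply (w_pos Wt); [apply (br_r B1 t Ht) | apply (br_r B2 t Ht)]. }
  assert (Hmy : mean q Q F r1 rho1 y <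
                mean q Q F r2 rho2 y).
  { assert (P1 := br_rho B1 y Hy). assert (P2 := br_rho B2 y Hy).
    destruct (Hq y Hy). rewrite !Hmean by assumption.
    assert (R2 := br_r B2 y Hy).
    assert (A := ratio_monotone Wt _ _ R2 Hry). assert (A2 := ratio_pos Wt _ R2).
    assert (HF := fo_Fnonpos Fo y ltac:(apply Rabs_le; lra)).
    assert (Hi : / rho2 y <= / rho1 y) by (apply Rinv_le_contravar; lra).
    assert (Hi2 : 0 < / rho2 y) by now apply Rinv_0_lt_compat.
    assert (Q (r2 y) / q (r2 y) * / rho2 y <= Q (r1 y) / q (r1 y) * / rho1 y)
      by (apply Rmult_le_compat; lra).
    replace (Q (r1 y) / q (r1 y) * (F y / rho1 y)) with
      (Q (r1 y) / q (r1 y) * / rho1 y * F y) by (field; lra).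
    replace (Q (r2 y) / q (r2 y) * (F y / rho2 y)) with
      (Q (r2 y) / q (r2 y) * / rho2 y * F y) by (field; lra).
    nra. }
  assert (Hp := mean_order_persists Wt Fo B1 B2 b y ltac:(lra) ltac:(lra) ltac:(lra)).
  assert (Hper : forall t, b <= t <= y -> r2 t <= r1 t /\ rho1 t < rho2 t /\
    mean q Q F r1 rho1 t < mean q Q F r2 rho2 t).
  { apply Hp; try assumption. intros t Ht. assert (Ht' : 0 < t < hi) by lra.
    assert (Ff : 0 <= f t).
    { destruct Ht as [[Hbt | <-] _].
      - apply Rlt_le, (fo_pos Fo); [assumption | apply (br_dom B1 t Ht')].
      - rewrite (fo_at_b Fo). lra. }
    split; [assumption |].
    assert (HF := fo_Fnonpos Fo t ltac:(apply Rabs_le; lra)).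
    assert (W2 := flux_pos Wt B2 t Ht').
    assert (0 <= f t * (Q (r2 t) * energy F rho2 t)).
    { apply Rmult_le_pos; [assumption |]. apply Rmult_le_pos; apply Rlt_le;
        [apply (w_primpos Wt), (br_r B2 t Ht') | apply (br_energy B2 t Ht')]. }
    nra. }
  destruct (Rlt_or_le (Q (r1 b) / q (r1 b) * rho1 b) (Q (r2 b) / q (r2 b) * rho2 b))
    as [Hlt | Hge].
  { destruct (Hper b) as [Hrb _]; [lra |].
    apply (ratio_speed_order_impossible_below_b b); try assumption; lra. }
  set (g := fun t => Q (r1 t) / q (r1 t) * rho1 t - Q (r2 t) / q (r2 t) * rho2 t).
  assert (Hgc : forall z, b <= z <= y -> continuous g z).
  { intros z Hz. eapply is_derive_continuous, derive_minus;
      [apply (ratio_speed_derive Wt B1) | apply (ratio_speed_derive Wt B2)]; lra. }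
  assert (Hs2 : exists z, b <= z <= y /\ g z = 0 /\ forall t, b <= t <= z -> 0 <= g t).
  { destruct Hge as [Hgt' | Heq].
    - destruct (lowest_zero g b y) as (z & Hz & H0 & Hbelow);
        [lra | assumption | unfold g; lra | unfold g; lra |].
      exists z. split; [lra | split; [assumption |]].
      intros t [Ht [Ht' | ->]]; [| lra]. apply Rlt_le, Hbelow. lra.
    - exists b. split; [lra | split; [unfold g; lra |]].
      intros t Ht. replace t with b by lra. unfold g. lra. }
  destruct Hs2 as (z & Hz & H0 & Hbelow).
  destruct (Hper z) as (Hrz & Hrhoz & Hmz); [lra |].
  assert (Hz' : 0 < z < hi) by lra.
  apply (ratio_sq_energy_order_impossible z Hz'); [lra | assumption | |].
  - intros t Ht Hrt. destruct (Rle_or_lt b t) as [Hbt | Hbt].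
    + assert (G := Hbelow t ltac:(lra)). unfold g in G. lra.
    + apply Rnot_lt_le. apply ratio_speed_order_impossible_below_b; lra.
  - assert (P1 := br_rho B1 z Hz'). assert (P2 := br_rho B2 z Hz'). destruct (Hq z Hz') as [Q1 Q2].
    assert (A1 := ratio_pos Wt _ (br_r B1 z Hz')).
    unfold mean in Hmz. unfold g in H0.
    replace (Q (r1 z) / q (r1 z) * (Q (r1 z) / q (r1 z)) * energy F rho1 z) with
      (Q (r1 z) / q (r1 z) * rho1 z * (Q (r1 z) * energy F rho1 z / (q (r1 z) * rho1 z)))
      by (field; lra).
    replace (Q (r2 z) / q (r2 z) * (Q (r2 z) / q (r2 z)) * energy F rho2 z) with
      (Q (r1 z) / q (r1 z) * rho1 z * (Q (r2 z) * energy F rho2 z / (q (r2 z) * rho2 z))).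
    + apply Rmult_lt_compat_l; [| assumption]. apply Rmult_lt_0_compat; lra.
    + replace (Q (r1 z) / q (r1 z) * rho1 z) with (Q (r2 z) / q (r2 z) * rho2 z) by lra.
      field. lra.
Qed.
End Tail.

(** * From the level beta to - beta *)

Section Passages.
Context {c : Rbar} {q dq Q H f F : R -> R} {Hinf b beta lo hi : R}.
Context (Wt : weight q dq Q H Hinf) (Fo : force c f F b beta).
Context {r1 rho1 r2 rho2 : R -> R}.
Context (B1 : branch c q dq f F lo hi r1 rho1) (B2 : branch c q dq f F lo hi r2 rho2).

Local Notation leads := (leads F r1 rho1 r2 rho2).

Local Notation lags := (lags q r1 rho1 r2 rho2).

Lemma leads_or_lags_slower (s : R) : lo < s < hi -> leads s \/ lags s -> rho1 s < rho2 s.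
Proof.
  intros Hs [[_ HE] | [Hr Hw]].
  - now apply (speed_of_energy B1 B2 s Hs).
  - now apply (slower_if_smaller_flux Wt B1 B2 s Hs).
Qed.

Lemma crossing_lags (s : R) : lo < s < hi -> r1 s = r2 s ->
  energy F rho1 s < energy F rho2 s -> lags s.
Proof.
  intros Hs Hr HE. apply (speed_of_energy B1 B2 s Hs) in HE.
  split; [lra |]. rewrite Hr. apply Rmult_lt_compat_l; [| assumption].
  apply (w_pos Wt), (br_r B2 s Hs).
Qed.

Lemma weight_sq_energy_at_beta (r rho : R -> R) (s : R) : F s = 0 ->
  q (r s) * q (r s) * energy F rho s = (q (r s) * rho s) * (q (r s) * rho s) / 2.
Proof. intros HF. unfold energy. rewrite HF. field. Qed.

(** At both ends of [- beta, beta] F vanishes, so that q^2 E is there half the square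
    of the flux; in between [weight_sq_energy_persists] takes over after a crossing. *)
Lemma cross_middle : lo < - beta -> beta < hi -> leads beta \/ lags beta ->
  leads (- beta) \/ lags (- beta).
Proof.
  intros Hlo Hhi Hst. assert (Hb := fo_b Fo).
  assert (HF : F (- beta) = 0) by (rewrite (fo_even Fo); [apply (fo_Fbeta Fo) | apply (fo_dom Fo)]).
  assert (Hend : forall z, - beta <= z <= beta -> r2 z <= r1 z ->
    q (r1 z) * q (r1 z) * energy F rho1 z < q (r2 z) * q (r2 z) * energy F rho2 z ->
    lags (- beta)).
  { intros z Hz Hr HW.
    destruct (weight_sq_energy_persists Wt Fo B1 B2 (- beta) z) as [G1 G2]; try lra.
    split; [assumption |]. rewrite !weight_sq_energy_at_beta in G2 by assumption.
    assert (W1 := flux_pos Wt B1 (- beta) ltac:(lra)).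
    assert (W2 := flux_pos Wt B2 (- beta) ltac:(lra)). nra. }
  destruct Hst as [Hl | [Hr Hw]].
  - destruct (leads_until_crossing Wt Fo B1 B2 (- beta) beta) as [Hall | (z & Hz & Hr & HE & _)];
      try lra; try assumption.
    + left. apply Hall. lra.
    + right. apply (Hend z); [lra | lra |]. rewrite Hr.
      apply Rmult_lt_compat_l; [| assumption].
      assert (0 < q (r2 z)) by (apply (w_pos Wt), (br_r B2 z); lra). nra.
  - right. apply (Hend beta); [lra | assumption |].
    rewrite !weight_sq_energy_at_beta by apply (fo_Fbeta Fo).
    assert (W1 := flux_pos Wt B1 beta ltac:(lra)). nra.
Qed.

Context (Gr : growth c f F beta (1 / 2 - Hinf)).

Lemma force_nonpos_below (s : R) : lo < s < hi -> s <= - beta -> f s <= 0.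
Proof.
  intros Hs Hb. assert (Hb0 := fo_b Fo).
  assert (Hd := br_dom B1 s Hs).
  assert (Hd' : in_dom c (- s)) by (unfold in_dom; now rewrite Rabs_Ropp).
  assert (P := fo_pos Fo (- s) ltac:(lra) Hd').
  rewrite (fo_odd Fo s Hd) in P. lra.
Qed.

(** Below - beta a crossing turns a lead into a lag, which lasts since f <= 0; under
    either order the gap of the Pohozaev functions grows downwards. *)
Lemma descend_below_minus_beta (x : R) : lo < x -> x <= - beta -> - beta < hi ->
  leads (- beta) \/ lags (- beta) ->
  (leads x \/ lags x) /\
  pohozaev q Q f F r2 rho2 (- beta) - pohozaev q Q f F r1 rho1 (- beta) <=
  pohozaev q Q f F r2 rho2 x - pohozaev q Q f F r1 rho1 x.
Proof.
  intros Hx Hxb Hhi Hst. assert (Hb := fo_b Fo).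
  assert (Habs : forall t, t <= - beta -> beta <= Rabs t).
  { intros t Ht. rewrite Rabs_left; lra. }
  assert (Hlag : forall z, x <= z <= - beta -> lags z ->
    (leads x \/ lags x) /\
    pohozaev q Q f F r2 rho2 z - pohozaev q Q f F r1 rho1 z <=
    pohozaev q Q f F r2 rho2 x - pohozaev q Q f F r1 rho1 x).
  { intros z Hz [Hr Hw].
    assert (Hfl := flux_order_persists Wt B1 B2 x z Hx ltac:(lra) ltac:(lra)).
    assert (Hfl' : forall t, x <= t <= z -> q (r1 t) * rho1 t < q (r2 t) * rho2 t).
    { apply Hfl; try assumption. intros t Ht. apply force_nonpos_below; lra. }
    assert (Hls := later_and_slower Wt B1 B2 x z Hx ltac:(lra) ltac:(lra) Hr Hfl').
    split.
    - right. split; [apply Hls; lra | apply Hfl'; lra].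
    - apply (pohozaev_gap_grows_lagging Wt Fo Gr B1 B2); try lra.
      + intros t Ht. apply Habs. lra.
      + intros t Ht. split; [apply Hls; lra | apply Hfl'; lra]. }
  destruct Hst as [Hl | Hl].
  - destruct (leads_until_crossing Wt Fo B1 B2 x (- beta)) as [Hall | (z & Hz & Hr & HE & Hab)];
      try lra; try assumption.
    + split; [left; apply Hall; lra |].
      apply (pohozaev_gap_grows_leading Wt Fo Gr B1 B2); try lra.
      * intros t Ht. apply Habs. lra.
      * intros t Ht. apply Hall. lra.
    + destruct (Hlag z) as [G1 G2]; [lra | apply crossing_lags; [lra | assumption | assumption] |].
      split; [assumption |].
      apply Rle_trans with (pohozaev q Q f F r2 rho2 z - pohozaev q Q f F r1 rho1 z);
        [| assumption].
      apply (pohozaev_gap_grows_leading Wt Fo Gr B1 B2); try lra.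
      * intros t Ht. apply Habs. lra.
      * intros t Ht. apply Hab. lra.
  - apply Hlag; [lra | assumption].
Qed.

(** F (- beta) = 0 leaves Q rho^2 / 2 = (Q / q^2) (q rho)^2 / 2. *)
Lemma pohozaev_lt_at_minus_beta : lo < - beta < hi -> leads (- beta) \/ lags (- beta) ->
  pohozaev q Q f F r1 rho1 (- beta) < pohozaev q Q f F r2 rho2 (- beta).
Proof.
  intros Hs Hst. assert (Hb := fo_b Fo).
  assert (HF : F (- beta) = 0) by (rewrite (fo_even Fo); [apply (fo_Fbeta Fo) | apply (fo_dom Fo)]).
  unfold pohozaev. rewrite HF. unfold Rdiv at 1 2. rewrite Rmult_0_l, !Rmult_0_r, !Rminus_0_r.
  assert (R1 := br_r B1 _ Hs). assert (R2 := br_r B2 _ Hs).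
  assert (E1 := br_energy B1 _ Hs).
  destruct Hst as [[Hr HE] | [Hr Hw]].
  - assert (Q (r1 (- beta)) <= Q (r2 (- beta))).
    { apply (nondecreasing_of_derive Q q); [lra | |]; intros z Hz;
        [apply (w_prim Wt) | apply Rlt_le, (w_pos Wt)]; lra. }
    assert (P1 := w_primpos Wt _ R1). nra.
  - assert (A := ratio_over_weight_antitone Wt _ _ R2 Hr).
    assert (Q1 := w_pos Wt _ R1). assert (Q2 := w_pos Wt _ R2).
    assert (W1 := flux_pos Wt B1 _ Hs).
    assert (C2 : 0 < Q (r2 (- beta)) / (q (r2 (- beta)) * q (r2 (- beta)))).
    { apply Rdiv_lt_0_compat; [now apply (w_primpos Wt) | now apply Rmult_lt_0_compat]. }
    unfold energy. rewrite HF.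
    replace (Q (r1 (- beta)) * (rho1 (- beta) * rho1 (- beta) / 2 + 0)) with
      (Q (r1 (- beta)) / (q (r1 (- beta)) * q (r1 (- beta))) *
       ((q (r1 (- beta)) * rho1 (- beta)) * (q (r1 (- beta)) * rho1 (- beta)) / 2))
      by (field; lra).
    replace (Q (r2 (- beta)) * (rho2 (- beta) * rho2 (- beta) / 2 + 0)) with
      (Q (r2 (- beta)) / (q (r2 (- beta)) * q (r2 (- beta))) *
       ((q (r2 (- beta)) * rho2 (- beta)) * (q (r2 (- beta)) * rho2 (- beta)) / 2))
      by (field; lra).
    set (w1 := q (r1 (- beta)) * rho1 (- beta)) in *.
    set (w2 := q (r2 (- beta)) * rho2 (- beta)) in *.
    apply Rle_lt_trans with (Q (r2 (- beta)) / (q (r2 (- beta)) * q (r2 (- beta))) * (w1 * w1 / 2)).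
    + apply Rmult_le_compat_r; [nra | assumption].
    + apply Rmult_lt_compat_l; [assumption | nra].
Qed.

Local Notation lags_weakly := (lags_weakly q Q r1 rho1 r2 rho2).

(** A lead keeps the order of the Pohozaev functions up to a crossing, where it is
    handed over to [lagging_reaches_beta]. *)
Lemma ascent_reaches_beta (y : R) : lo < beta -> beta <= y -> y < hi ->
  leads y \/ lags y ->
  pohozaev q Q f F r1 rho1 y < pohozaev q Q f F r2 rho2 y ->
  0 <= pohozaev q Q f F r2 rho2 y ->
  leads beta \/ lags_weakly beta.
Proof.
  intros Hlo Hby Hy Hst HP HP2. assert (Hb := fo_b Fo).
  assert (Habs : forall t, beta <= t -> beta <= Rabs t).
  { intros t Ht. rewrite Rabs_pos_eq; lra. }
  destruct Hst as [Hl | [Hr Hw]].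
  - destruct (leads_until_crossing Wt Fo B1 B2 beta y) as [Hall | (z & Hz & Hr & HE & Hab)];
      try lra; try assumption.
    + left. apply Hall. lra.
    + right. assert (Hz' : lo < z < hi) by lra.
      destruct (crossing_lags z Hz' Hr HE) as [Hrz Hwz].
      apply (lagging_reaches_beta Wt Fo Gr B1 B2 z); try lra; try assumption.
      * assert (G := pohozaev_gap_grows_leading Wt Fo Gr B1 B2 z y).
        assert (pohozaev q Q f F r2 rho2 y - pohozaev q Q f F r1 rho1 y <=
                pohozaev q Q f F r2 rho2 z - pohozaev q Q f F r1 rho1 z); [| lra].
        apply G; try lra.
        -- intros t Ht. apply Habs. lra.
        -- intros t Ht. apply Hab. lra.
      * apply Rle_trans with (pohozaev q Q f F r2 rho2 y); [assumption |].
        apply (pohozaev_increases Wt Fo Gr B2); try lra. intros t Ht. apply Habs. lra.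
  - right. apply (lagging_reaches_beta Wt Fo Gr B1 B2 y); assumption.
Qed.
End Passages.

(** A perpetual lead is excluded by [no_perpetual_lead]; a crossing would produce a
    lag, excluded by [lagging_impossible]. *)
Lemma two_tails_impossible {c : Rbar} {q dq Q H f F : R -> R} {Hinf b beta hi : R}
  (Wt : weight q dq Q H Hinf) (Fo : force c f F b beta) {r1 rho1 r2 rho2 : R -> R}
  (B1 : branch c q dq f F 0 hi r1 rho1) (B2 : branch c q dq f F 0 hi r2 rho2)
  (D2 : decays q Q F r2 rho2) :
  beta < hi ->
  ~ (leads F r1 rho1 r2 rho2 beta \/ lags_weakly q Q r1 rho1 r2 rho2 beta).
Proof.
  intros Hhi Hst. assert (Hb := fo_b Fo).
  destruct Hst as [Hl | [Hr HZ]].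
  - destruct (classic (forall t, 0 < t <= beta -> leads F r1 rho1 r2 rho2 t)) as [Hall | Hnot].
    + apply (no_perpetual_lead Wt Fo B1 B2 D2 beta); [lra | | apply Hl].
      intros t Ht. apply Rlt_le, Hall, Ht.
    + apply not_all_ex_not in Hnot. destruct Hnot as [x Hx].
      apply imply_to_and in Hx. destruct Hx as [Hx Hn].
      destruct (leads_until_crossing Wt Fo B1 B2 x beta) as [Hall | (z & Hz & Hrz & HE & _)];
        try lra; try assumption.
      * apply Hn, Hall. lra.
      * assert (Hz' : 0 < z < hi) by lra.
        assert (HL := crossing_lags Wt B1 B2 z Hz' Hrz HE).
        apply (lagging_impossible Wt Fo B1 B2 D2 z Hz'); try lra.
        exact (lags_ratio Wt B1 B2 z Hz' HL).
  - apply (lagging_impossible Wt Fo B1 B2 D2 beta); try lra; assumption.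
Qed.

(** * Through the turning point and back *)

(** The end of a branch at an extremum of the solution; Fl approaches the extremal
    level from inside the branch. *)
Definition rests (Fl : (R -> Prop) -> Prop) (r rho : R -> R) (t : R) : Prop :=
  filterlim r Fl (locally t) /\ filterlim rho Fl (locally 0).

Section RestLimits.
Context {c : Rbar} {q dq Q H f F : R -> R} {Hinf b beta : R}.
Context (Wt : weight q dq Q H Hinf) (Fo : force c f F b beta)
        (Gr : growth c f F beta (1 / 2 - Hinf)).
Context {Fl : (R -> Prop) -> Prop} {FF : ProperFilter Fl} {r rho : R -> R} {t s0 : R}.
Context (Hs0 : filterlim (fun s => s) Fl (locally s0)) (Hdom : in_dom c s0).
Context (Hrest : rests Fl r rho t).

Lemma energy_at_rest : filterlim (energy F rho) Fl (locally (F s0)).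
Proof.
  destruct Hrest as [_ Hrho].
  replace (F s0) with (0 * (0 * / 2) + F s0) by ring.
  apply (filterlim_ext (fun s => rho s * (rho s * / 2) + F s)).
  { intros s. unfold energy. field. }
  apply lim_plus.
  - apply lim_mult; [assumption |]. apply lim_mult; [assumption | apply filterlim_const].
  - apply (lim_continuous F (fun s => s)); [| assumption].
    eapply is_derive_continuous, (fo_prim Fo s0 Hdom).
Qed.

Context (Ht : 0 < t).

Lemma weight_at_rest : filterlim (fun s => q (r s)) Fl (locally (q t)).
Proof.
  apply lim_continuous; [| apply Hrest]. eapply is_derive_continuous, (w_der Wt t Ht).
Qed.

Lemma flux_at_rest : filterlim (fun s => q (r s) * rho s) Fl (locally 0).
Proof.
  replace 0 with (q t * 0) by ring. apply lim_mult; [apply weight_at_rest | apply Hrest].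
Qed.

Lemma pohozaev_at_rest : beta <= Rabs s0 ->
  filterlim (pohozaev q Q f F r rho) Fl (locally (Q t * F s0)).
Proof.
  intros Hb. replace (Q t * F s0) with (Q t * F s0 - 0 * (F s0 / f s0)) by ring.
  apply lim_minus.
  - apply lim_mult; [| apply energy_at_rest].
    apply lim_continuous; [| apply Hrest]. eapply is_derive_continuous, (w_prim Wt t Ht).
  - apply lim_mult; [apply flux_at_rest |].
    apply (lim_continuous (fun s => F s / f s) (fun s => s)); [| assumption].
    destruct (Gr s0 Hb Hdom) as (k & Hk & _). eapply is_derive_continuous, Hk.
Qed.
End RestLimits.

Section SignChange.
Context {c : Rbar} {q dq Q H f F : R -> R} {Hinf b beta : R}.
Context (Wt : weight q dq Q H Hinf) (Fo : force c f F b beta)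
        (Gr : growth c f F beta (1 / 2 - Hinf)).
Context {alpha1 alpha2 mu1 mu2 t1 t2 : R} {r1 rho1 r2 rho2 : R -> R}.
Context (B1 : branch c q dq f F (- mu1) alpha1 r1 rho1)
        (B2 : branch c q dq f F (- mu2) alpha2 r2 rho2).
Context (Hm1 : beta < mu1) (Hm2 : beta < mu2) (Ha1 : beta < alpha1) (Ha2 : beta < alpha2).
Context (Hd1 : in_dom c mu1) (Hd2 : in_dom c mu2) (Ht1 : 0 < t1) (Ht2 : 0 < t2).
Context (L1 : rests (at_right (- mu1)) r1 rho1 t1) (L2 : rests (at_right (- mu2)) r2 rho2 t2).
Context (Hst : leads F r1 rho1 r2 rho2 beta \/ lags q r1 rho1 r2 rho2 beta).

Local Notation P1 := (pohozaev q Q f F r1 rho1).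
Local Notation P2 := (pohozaev q Q f F r2 rho2).

Lemma order_below : exists g, 0 < g /\ forall x, - mu1 < x -> - mu2 < x -> x <= - beta ->
  (leads F r1 rho1 r2 rho2 x \/ lags q r1 rho1 r2 rho2 x) /\ rho1 x < rho2 x /\
  g <= P2 x - P1 x.
Proof.
  assert (Hb := fo_b Fo).
  set (hi := Rmin alpha1 alpha2).
  assert (Hh1 : hi <= alpha1) by apply Rmin_l. assert (Hh2 : hi <= alpha2) by apply Rmin_r.
  assert (Hhi : beta < hi) by now apply Rmin_glb_lt.
  set (lo := Rmax (- mu1) (- mu2)).
  assert (Hl1 : - mu1 <= lo) by apply Rmax_l. assert (Hl2 : - mu2 <= lo) by apply Rmax_r.
  assert (Hlo : lo < - beta) by (apply Rmax_lub_lt; lra).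
  assert (C1 := branch_sub lo hi B1 Hl1 Hh1). assert (C2 := branch_sub lo hi B2 Hl2 Hh2).
  assert (Hmid := cross_middle Wt Fo C1 C2 Hlo Hhi Hst).
  exists (P2 (- beta) - P1 (- beta)). split.
  - assert (G := pohozaev_lt_at_minus_beta (lo := lo) (hi := hi) (f := f) Wt Fo C1 C2
      ltac:(lra) Hmid). lra.
  - intros x Hx1 Hx2 Hxb. assert (Hx : lo < x) by (now apply Rmax_lub_lt).
    destruct (descend_below_minus_beta Wt Fo C1 C2 Gr x Hx Hxb ltac:(lra) Hmid) as [G1 G2].
    split; [assumption | split; [| assumption]].
    apply (leads_or_lags_slower Wt C1 C2); [lra | assumption].
Qed.

(** If solution 1 went deeper, rho2 would vanish at a level where rho1 > 0, against
    rho1 < rho2. If the depths agreed, the Pohozaev gap would give t1 < t2, hence a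
    lead near the bottom, where by [energy_gap_grows] the energy gap could not tend to
    0. *)
Lemma depth_increases : mu1 < mu2.
Proof.
  assert (Hb := fo_b Fo). destruct order_below as (g & Hg & Hord).
  apply Rnot_le_lt. intros [Hlt | Heq].
  - assert (Hin : - mu1 < - mu2 < alpha1) by lra.
    assert (P := br_rho B1 _ Hin).
    assert (Hc1 : filterlim rho1 (at_right (- mu2)) (locally (rho1 (- mu2)))).
    { apply continuous_at_right. eapply is_derive_continuous, (br_drho B1 _ Hin). }
    assert (rho1 (- mu2) <= 0); [| lra].
    apply (lim_le (Fl := at_right (- mu2)) rho1 rho2); [assumption | apply L2 |].
    apply (filter_imp (fun s => - mu2 < s < - beta)); [| apply at_right_interval; lra].
    intros s Hs. apply Rlt_le, Hord; lra.
  - subst mu2. set (Fl := at_right (- mu1)).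
    assert (Hdo : in_dom c (- mu1)) by now apply in_dom_opp.
    assert (Habs : Rabs (- mu1) = mu1) by (rewrite Rabs_Ropp, Rabs_pos_eq; lra).
    assert (HF : 0 < F (- mu1)) by (apply (fo_Fpos Fo); [lra | assumption]).
    assert (Hint : Fl (fun s => - mu1 < s < - beta)) by (apply at_right_interval; lra).
    assert (HPlim : g <= Q t2 * F (- mu1) - Q t1 * F (- mu1)).
    { apply (lim_le (Fl := Fl) (fun _ => g) (fun s => P2 s - P1 s)).
      - apply filterlim_const.
      - apply lim_minus; apply (pohozaev_at_rest Wt Fo Gr);
          try assumption; try apply level_at_right; lra.
      - apply (filter_imp (fun s => - mu1 < s < - beta)); [| assumption].
        intros s Hs. apply Hord; lra. }
    assert (Hq12 : Q t1 < Q t2) by nra.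
    assert (Ht12 : t1 < t2).
    { apply Rnot_le_lt. intros Hle. assert (Q t2 <= Q t1); [| lra].
      apply (nondecreasing_of_derive Q q); [assumption | |]; intros z Hz;
        [apply (w_prim Wt) | apply Rlt_le, (w_pos Wt)]; lra. }
    assert (Hlead : Fl (fun s => - mu1 < s < - beta /\ r1 s < r2 s)).
    { apply filter_and; [assumption |].
      assert (A := lim_lt (Fl := Fl) r1 t1 ((t1 + t2) / 2) (proj1 L1) ltac:(lra)).
      assert (C := lim_gt (Fl := Fl) r2 t2 ((t1 + t2) / 2) (proj1 L2) ltac:(lra)).
      generalize (filter_and _ _ A C). apply filter_imp. intros s [X Y]. lra. }
    destruct Hlead as [d Hd].
    assert (Hdp := cond_pos d).
    assert (Hnear : forall s, - mu1 < s < - mu1 + d -> - mu1 < s < - beta /\ r1 s < r2 s).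
    { intros s Hs. apply Hd; [| lra]. unfold ball; simpl. apply Rabs_lt_between.
      unfold minus, plus, opp; simpl. lra. }
    set (x0 := - mu1 + d / 2).
    destruct (Hnear x0) as [Hx0 Hrx0]; [unfold x0; lra |].
    destruct (Hord x0) as (_ & Hrho0 & _); [lra | lra | lra |].
    assert (Hin1 : - mu1 < x0 < alpha1) by lra. assert (Hin2 : - mu1 < x0 < alpha2) by lra.
    set (hi := Rmin alpha1 alpha2).
    assert (Hh1 : hi <= alpha1) by apply Rmin_l. assert (Hh2 : hi <= alpha2) by apply Rmin_r.
    assert (Hhi : beta < hi) by now apply Rmin_glb_lt.
    assert (C1 := branch_sub (- mu1) hi B1 ltac:(lra) Hh1).
    assert (C2 := branch_sub (- mu1) hi B2 ltac:(lra) Hh2).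
    assert (HE0 := proj2 (speed_of_energy C1 C2 x0 ltac:(lra)) Hrho0).
    set (e := q (r1 x0) * (energy F rho2 x0 - energy F rho1 x0)).
    assert (He : 0 < e).
    { apply Rmult_lt_0_compat; [apply (w_pos Wt), (br_r B1 x0 Hin1) | lra]. }
    assert (e <= q t1 * (F (- mu1) - F (- mu1))); [| lra].
    apply (lim_le (Fl := Fl) (fun _ => e) (fun s => q (r1 s) * (energy F rho2 s - energy F rho1 s))).
    + apply filterlim_const.
    + apply lim_mult; [apply (weight_at_rest Wt (Fl := Fl) (rho := rho1)); assumption |].
      apply lim_minus; eapply (energy_at_rest Fo); try eassumption; apply level_at_right.
    + apply (filter_imp (fun s => - mu1 < s < x0)); [| apply at_right_interval; lra].
      intros s Hs. apply (energy_gap_grows Wt Fo C1 C2); try lra.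
      intros u Hu. apply Rlt_le, Hnear. unfold x0 in *. lra.
Qed.

Context {s1 sig1 s2 sig2 : R -> R}.
Context (A1 : branch c q dq f F 0 mu1 s1 sig1) (A2 : branch c q dq f F 0 mu2 s2 sig2).
Context (M1 : rests (at_left mu1) s1 sig1 t1) (M2 : rests (at_left mu2) s2 sig2 t2).

(** Beyond the depth mu1 the Pohozaev function of solution 2 increases along the
    solution, before the turning point at mu2, where it equals Q (t2) F (mu2), and
    after it; so it stays ahead of the value that solution 1 has at its own turning
    point. *)
Lemma pohozaev_gap_after_turning : Q t1 * F mu1 < pohozaev q Q f F s2 sig2 mu1.
Proof.
  assert (Hb := fo_b Fo). assert (Hmu := depth_increases).
  destruct order_below as (g & Hg & Hord).
  assert (HF1 : F (- mu1) = F mu1) by now apply (fo_even Fo).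
  assert (HF2 : F (- mu2) = F mu2) by now apply (fo_even Fo).
  assert (Habs1 : Rabs (- mu1) = mu1) by (rewrite Rabs_Ropp, Rabs_pos_eq; lra).
  assert (Habs2 : Rabs (- mu2) = mu2) by (rewrite Rabs_Ropp, Rabs_pos_eq; lra).
  assert (Habs3 : Rabs mu2 = mu2) by (rewrite Rabs_pos_eq; lra).
  assert (Hin2 : - mu2 < - mu1 < alpha2) by lra.
  assert (Hin2' : 0 < mu1 < mu2) by lra.
  assert (I1 : Q t1 * F (- mu1) + g <= P2 (- mu1)).
  { apply (lim_le (Fl := at_right (- mu1)) (fun s => P1 s + g) P2).
    - apply lim_plus; [| apply filterlim_const].
      apply (pohozaev_at_rest Wt Fo Gr); try assumption;
        [apply level_at_right | now apply in_dom_opp | lra].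
    - apply continuous_at_right.
      destruct (Gr (- mu1)) as (k & Hk & _); [lra | now apply in_dom_opp |].
      eapply is_derive_continuous, (pohozaev_derive Wt Fo B2 _ k); [assumption | lra | assumption].
    - apply (filter_imp (fun s => - mu1 < s < - beta)); [| apply at_right_interval; lra].
      intros s Hs. assert (G := proj2 (proj2 (Hord s ltac:(lra) ltac:(lra) ltac:(lra)))). lra. }
  (* I2 and I3: solution 2 beyond the depth mu1, before and after its turning point *)
  assert (I2 : P2 (- mu1) <= Q t2 * F (- mu2)).
  { apply (lim_le (Fl := at_right (- mu2)) (fun _ => P2 (- mu1)) P2).
    - apply filterlim_const.
    - apply (pohozaev_at_rest Wt Fo Gr); try assumption;
        [apply level_at_right | now apply in_dom_opp | lra].
    - apply (filter_imp (fun s => - mu2 < s < - mu1)); [| apply at_right_interval; lra].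
      intros s Hs. apply (pohozaev_increases Wt Fo Gr B2); try lra.
      intros u Hu. rewrite Rabs_left; lra. }
  assert (I3 : Q t2 * F mu2 <= pohozaev q Q f F s2 sig2 mu1).
  { apply (lim_le (Fl := at_left mu2) (pohozaev q Q f F s2 sig2)
      (fun _ => pohozaev q Q f F s2 sig2 mu1)).
    - apply (pohozaev_at_rest Wt Fo Gr); try assumption; [apply level_at_left | lra].
    - apply filterlim_const.
    - apply (filter_imp (fun s => mu1 < s < mu2)); [| apply at_left_interval; lra].
      intros s Hs. apply (pohozaev_increases Wt Fo Gr A2); try lra.
      intros u Hu. rewrite Rabs_pos_eq; lra. }
  rewrite HF1 in I1. rewrite HF2 in I2. lra.
Qed.

(** At the level mu1 of the way back solution 1 rests while solution 2 moves: just
    below it energies, fluxes and Pohozaev functions are all ordered, and whichever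
    way the radii are ordered, the order reaches beta. *)
Lemma sign_changing_pair_impossible : ~ decays q Q F s2 sig2.
Proof.
  intros D2. assert (Hb := fo_b Fo). assert (Hmu := depth_increases).
  assert (HP := pohozaev_gap_after_turning).
  assert (Hin : 0 < mu1 < mu2) by lra.
  assert (C2 := branch_sub 0 mu1 A2 ltac:(lra) ltac:(lra)).
  set (Fl := at_left mu1).
  assert (Habs : Rabs mu1 = mu1) by (apply Rabs_pos_eq; lra).
  set (PP1 := pohozaev q Q f F s1 sig1) in *. set (PP2 := pohozaev q Q f F s2 sig2) in *.
  assert (HFmu : 0 < F mu1) by (apply (fo_Fpos Fo); [lra | assumption]).
  assert (LP1 : filterlim PP1 Fl (locally (Q t1 * F mu1))).
  { apply (pohozaev_at_rest Wt Fo Gr); try assumption; [apply level_at_left | lra]. }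
  assert (LP2 : filterlim PP2 Fl (locally (PP2 mu1))).
  { apply continuous_at_left. destruct (Gr mu1) as (k & Hk & _); [lra | assumption |].
    eapply is_derive_continuous, (pohozaev_derive Wt Fo A2 _ k); [assumption | lra | assumption]. }
  assert (LE1 : filterlim (energy F sig1) Fl (locally (F mu1))).
  { eapply (energy_at_rest Fo); try eassumption. apply level_at_left. }
  assert (LE2 : filterlim (energy F sig2) Fl (locally (energy F sig2 mu1))).
  { apply continuous_at_left. eapply is_derive_continuous, (energy_derive Wt Fo A2 _ Hin). }
  assert (LW1 : filterlim (fun s => q (s1 s) * sig1 s) Fl (locally 0)).
  { eapply (flux_at_rest Wt); eassumption. }
  assert (LW2 : filterlim (fun s => q (s2 s) * sig2 s) Fl (locally (q (s2 mu1) * sig2 mu1))).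
  { apply (continuous_at_left (fun s => q (s2 s) * sig2 s)).
    eapply is_derive_continuous, (flux_derive Wt A2 _ Hin). }
  assert (Hs := br_rho A2 _ Hin).
  assert (HE : F mu1 < energy F sig2 mu1) by (unfold energy; nra).
  assert (HW := flux_pos Wt A2 _ Hin).
  assert (HQ : 0 < Q t1 * F mu1) by (apply Rmult_lt_0_compat; [now apply (w_primpos Wt) | assumption]).
  assert (Ex : exists y, beta < y < mu1 /\ PP1 y < PP2 y /\ 0 < PP2 y /\
    energy F sig1 y < energy F sig2 y /\ q (s1 y) * sig1 y < q (s2 y) * sig2 y).
  { apply (filter_ex (F := Fl)).
    set (kp := (Q t1 * F mu1 + PP2 mu1) / 2). set (ke := (F mu1 + energy F sig2 mu1) / 2).
    set (kw := q (s2 mu1) * sig2 mu1 / 2).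
    assert (X1 := lim_lt _ _ kp LP1 ltac:(unfold kp; lra)).
    assert (X2 := lim_gt _ _ kp LP2 ltac:(unfold kp; lra)).
    assert (X3 := lim_lt _ _ ke LE1 ltac:(unfold ke; lra)).
    assert (X4 := lim_gt _ _ ke LE2 ltac:(unfold ke; lra)).
    assert (X5 := lim_lt _ _ kw LW1 ltac:(unfold kw; lra)).
    assert (X6 := lim_gt _ _ kw LW2 ltac:(unfold kw; lra)).
    assert (X7 : Fl (fun s => beta < s < mu1)) by (apply at_left_interval; lra).
    generalize (filter_and _ _ X1 (filter_and _ _ X2 (filter_and _ _ X3
      (filter_and _ _ X4 (filter_and _ _ X5 (filter_and _ _ X6 X7)))))).
    apply filter_imp. intros s Hall. assert (0 < kp) by (unfold kp; lra). lra. }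
  destruct Ex as (y & Hy & HPy & HPy2 & HEy & HWy).
  assert (Hst' : leads F s1 sig1 s2 sig2 y \/ lags q s1 sig1 s2 sig2 y).
  { destruct (Rlt_or_le (s1 y) (s2 y)); [left | right]; split; assumption. }
  assert (Hend := ascent_reaches_beta Wt Fo A1 C2 Gr y ltac:(lra) ltac:(lra) ltac:(lra)
    Hst' HPy (Rlt_le _ _ HPy2)).
  exact (two_tails_impossible Wt Fo A1 C2 D2 Hm1 Hend).
Qed.
End SignChange.

(** * The slope in logarithmic coordinates *)

(** T (r) is the integral of 1 / q over (r, oo), h = q T, and q' T - 1 = h'. *)
Record tail_weight (q dq T : R -> R) (l : R) : Prop := {
  tw_l : 0 < l;
  tw_pos : forall r, 0 < r -> 0 < T r;
  tw_der : forall r, 0 < r -> is_derive T r (- / q r);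
  tw_low : forall r, 0 < r -> l <= dq r * T r - 1;
  tw_mono : forall x y, 0 < x -> x <= y -> dq y * T y - 1 <= dq x * T x - 1;
  tw_zero : filterlim (fun r => q r * T r) (at_right 0) (locally 0)
}.
Arguments tw_l {q dq T l}.
Arguments tw_pos {q dq T l}.
Arguments tw_der {q dq T l}.
Arguments tw_low {q dq T l}.
Arguments tw_mono {q dq T l}.
Arguments tw_zero {q dq T l}.

Record elastic (c : Rbar) (f df : R -> R) (beta l : R) : Prop := {
  el_der : forall s, beta <= s -> in_dom c s -> is_derive f s (df s);
  el_mono : forall s t, beta <= s -> s <= t -> in_dom c t -> t * df t / f t <= s * df s / f s;
  el_bound : forall s, beta <= s -> in_dom c s -> s * df s / f s <= 1 + 2 * l
}.
Arguments el_der {c f df beta l}.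
Arguments el_mono {c f df beta l}.
Arguments el_bound {c f df beta l}.

Section Slope.
Context {c : Rbar} {q dq Q H f F : R -> R} {Hinf b beta : R}.
Context (Wt : weight q dq Q H Hinf) (Fo : force c f F b beta).
Context {T df : R -> R} {l : R} (Tw : tail_weight q dq T l) (El : elastic c f df beta l).

Definition h_slope (x : R) : R := dq x * T x - 1.

(** d (ln u) / d (ln T), which is h rho / s with h = q T: the slope of the solution in
    doubly logarithmic coordinates. It decreases in s ([slope_decreasing]), so two
    solutions can be compared at equal slopes. *)
Definition slope (r rho : R -> R) (s : R) : R := q (r s) * T (r s) * rho s / s.

(** The only quantity besides the slope that enters the equation for the slope. *)
Definition load (r : R -> R) (s : R) : R := (q (r s) * T (r s)) * (q (r s) * T (r s)) * (f s / s).

(** - s y y' for the slope y, see [slope_derive]. *)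
Definition steepening (r rho : R -> R) (s : R) : R :=
  slope r rho s * slope r rho s - slope r rho s + load r s.

(** - s y N' / N for the slope y and the load N, see [load_derive]. *)
Definition excess (r rho : R -> R) (s : R) : R :=
  2 * h_slope (r s) - (s * df s / f s - 1) * slope r rho s.

Lemma h_derive (x : R) : 0 < x -> is_derive (fun y => q y * T y) x (h_slope x).
Proof.
  intros Hx. assert (Hq := w_pos Wt x Hx). eapply is_derive_value.
  - apply derive_mult; [now apply (w_der Wt) | now apply (tw_der Tw)].
  - unfold h_slope. field. lra.
Qed.

Lemma h_pos (x : R) : 0 < x -> 0 < q x * T x.
Proof. intros Hx. apply Rmult_lt_0_compat; [now apply (w_pos Wt) | now apply (tw_pos Tw)]. Qed.

Section OneBranch.
Context {lo alpha : R} {r rho : R -> R} (B : branch c q dq f F lo alpha r rho).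
Context (Hlo : lo < beta) (Hal : beta < alpha) (Hda : in_dom c alpha).
Context (Hrest : rests (at_left alpha) r rho 0).

Local Notation y := (slope r rho).
Local Notation N := (load r).
Local Notation Y := (steepening r rho).

Lemma slope_pos (s : R) : beta <= s < alpha -> 0 < y s.
Proof.
  intros Hs. assert (Hb := fo_b Fo). assert (Hs' : lo < s < alpha) by lra.
  unfold slope. apply Rdiv_lt_0_compat; [| lra].
  apply Rmult_lt_0_compat; [apply h_pos, (br_r B s Hs') | apply (br_rho B s Hs')].
Qed.

Lemma force_pos_above (s : R) : beta <= s < alpha -> 0 < f s.
Proof.
  intros Hs. assert (Hb := fo_b Fo). apply (fo_pos Fo); [lra | apply (br_dom B); lra].
Qed.

Lemma load_pos (s : R) : beta <= s < alpha -> 0 < N s.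
Proof.
  intros Hs. assert (Hb := fo_b Fo). assert (Hs' : lo < s < alpha) by lra.
  assert (Hh := h_pos _ (br_r B s Hs')).
  unfold load. apply Rmult_lt_0_compat; [now apply Rmult_lt_0_compat |].
  apply Rdiv_lt_0_compat; [now apply force_pos_above | lra].
Qed.

Lemma slope_derive (s : R) : beta <= s < alpha ->
  is_derive (slope r rho) s (- (Y s / (s * y s))).
Proof.
  intros Hs. assert (Hb := fo_b Fo). assert (Hs' : lo < s < alpha) by lra.
  assert (Hr := br_r B s Hs'). assert (Hrho := br_rho B s Hs').
  assert (Hq := w_pos Wt _ Hr). assert (HT := tw_pos Tw _ Hr).
  unfold slope at 1. eapply is_derive_value.
  - apply (is_derive_div (fun t => q (r t) * T (r t) * rho t) (fun t => t)); [| apply is_derive_id | lra].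
    apply (product_derive B (fun x => q x * T x)); [assumption | now apply h_derive |
      apply (br_drho B s Hs')].
  - unfold one; simpl. unfold steepening, slope, load, h_slope. field. lra.
Qed.

Lemma load_derive (s : R) : beta <= s < alpha ->
  is_derive (load r) s (- (N s / (s * y s) * excess r rho s)).
Proof.
  intros Hs. assert (Hb := fo_b Fo). assert (Hs' : lo < s < alpha) by lra.
  assert (Hr := br_r B s Hs'). assert (Hrho := br_rho B s Hs').
  assert (Hq := w_pos Wt _ Hr). assert (HT := tw_pos Tw _ Hr).
  assert (Hf := force_pos_above s Hs).
  unfold load at 1. eapply is_derive_value.
  - eapply (product_derive B (fun x => (q x * T x) * (q x * T x)) _ (fun t => f t / t));
      [assumption | |].
    + apply (derive_mult (fun x => q x * T x) (fun x => q x * T x)); now apply h_derive.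
    + apply (is_derive_div f (fun t => t)); [| apply is_derive_id | lra].
      apply (el_der El); [lra | apply (br_dom B s Hs')].
  - unfold one; simpl. unfold excess, slope, load, h_slope. field. lra.
Qed.

Lemma h_vanishes : filterlim (fun s => q (r s) * T (r s)) (at_left alpha) (locally 0).
Proof.
  apply (filterlim_comp _ _ _ r (fun x => q x * T x) (at_left alpha) (at_right 0) _);
    [| apply (tw_zero Tw)].
  intros P [d Hd].
  assert (A : at_left alpha (fun s => beta < s < alpha)) by now apply at_left_interval.
  assert (C : at_left alpha (fun s => ball 0 d (r s)))
    by exact (proj1 Hrest (ball 0 d) (locally_ball 0 d)).
  change (at_left alpha (fun s => P (r s))).
  generalize (filter_and _ _ A C). apply filter_imp. intros s [X Z].
  apply Hd; [exact Z |]. apply (br_r B). lra.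
Qed.

Lemma slope_vanishes : filterlim (slope r rho) (at_left alpha) (locally 0).
Proof.
  assert (Hb := fo_b Fo).
  replace 0 with (0 * (0 * / alpha)) by ring.
  apply (filterlim_ext (fun s => q (r s) * T (r s) * (rho s * / s))).
  { intros s. unfold slope, Rdiv. ring. }
  apply lim_mult.
  - exact h_vanishes.
  - apply lim_mult; [apply Hrest |].
    apply (lim_continuous Rinv (fun s => s)); [apply continuous_Rinv; lra | apply level_at_left].
Qed.

Lemma load_vanishes : filterlim (load r) (at_left alpha) (locally 0).
Proof.
  assert (Hb := fo_b Fo).
  assert (Hh := h_vanishes).
  replace 0 with (0 * 0 * (f alpha * / alpha)) by ring.
  apply lim_mult; [now apply lim_mult |]. apply lim_mult.
  - apply (lim_continuous f (fun s => s)); [| apply level_at_left].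
    eapply is_derive_continuous, (el_der El); [lra | assumption].
  - apply (lim_continuous Rinv (fun s => s)); [apply continuous_Rinv; lra | apply level_at_left].
Qed.

(** h' >= l, while the elasticity of f / s is at most 2 l. *)
Lemma excess_pos (s : R) : beta <= s < alpha -> y s < 1 -> 0 < excess r rho s.
Proof.
  intros Hs Hy. assert (Hy0 := slope_pos s Hs). assert (Hl := tw_l Tw).
  assert (Hs' : lo < s < alpha) by lra.
  assert (G := el_bound El s ltac:(lra) (br_dom B s Hs')).
  assert (L := tw_low Tw _ (br_r B s Hs')). unfold excess, h_slope.
  set (g := s * df s / f s - 1) in *. assert (Hg : g <= 2 * l) by (unfold g; lra).
  assert (g * y s < 2 * l); [| lra].
  destruct (Rle_or_lt g 0); nra.
Qed.

Lemma steep_stays_steep (s s' : R) : beta <= s -> s <= s' -> s' < alpha -> 1 < y s' -> 1 < y s.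
Proof.
  intros Hs Hss Hs' Hy. assert (Hb := fo_b Fo).
  cut (forall z, s <= z <= s' -> 0 < y z - 1).
  { intros G. specialize (G s). lra. }
  apply (propagate_down (fun z => y z - 1)).
  - intros z Hz. eapply is_derive_continuous, derive_minus;
      [apply slope_derive; lra | apply (is_derive_const (V := R_NormedModule) 1)].
  - lra.
  - intros z Hz Hab. assert (y s' <= y z); [| lra].
    apply (nonincreasing_of_derive (slope r rho) (fun t => - (Y t / (t * y t)))); [lra | |].
    + intros t Ht. apply slope_derive. lra.
    + intros t Ht. assert (Hy1 := Hab t ltac:(lra)). assert (HN := load_pos t ltac:(lra)).
      assert (0 < Y t) by (unfold steepening; nra).
      assert (0 < Y t / (t * y t)); [| lra].
      apply Rdiv_lt_0_compat; [assumption | apply Rmult_lt_0_compat; lra].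
Qed.

(** Where the slope exceeds 1 this is clear. Elsewhere Y s^2 / T does not increase in
    s, and it is bounded below by a quantity that vanishes at the top. *)
Lemma steepening_pos (s0 : R) : beta <= s0 < alpha -> 0 < Y s0.
Proof.
  intros Hs0. assert (Hb := fo_b Fo).
  destruct (Rlt_or_le 1 (y s0)) as [Hgt | Hle].
  { assert (HN := load_pos s0 Hs0). unfold steepening. nra. }
  assert (Hy1 : forall s, s0 <= s < alpha -> y s <= 1).
  { intros s Hs. apply Rnot_lt_le. intros Hc.
    assert (1 < y s0) by (apply (steep_stays_steep s0 s); lra). lra. }
  set (G := fun s => Y s * (s * s) * / T (r s)).
  set (dG := fun s => - (N s * excess r rho s * s / (y s * T (r s)))).
  assert (HTp : forall s, s0 <= s < alpha -> 0 < T (r s)).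
  { intros s Hs. apply (tw_pos Tw), (br_r B). lra. }
  assert (HdG : forall s, s0 <= s < alpha -> is_derive G s (dG s)).
  { intros s Hs. assert (Hs' : lo < s < alpha) by lra.
    assert (Hr := br_r B s Hs'). assert (Hrho := br_rho B s Hs').
    assert (Hq := w_pos Wt _ Hr). assert (HT := HTp s Hs). assert (Hy0 := slope_pos s ltac:(lra)).
    unfold G. eapply is_derive_value.
    - apply (derive_mult (fun s => Y s * (s * s)) (fun s => / T (r s))).
      + apply (derive_mult (steepening r rho) (fun s => s * s)).
        * unfold steepening. apply derive_plus; [apply derive_minus |].
          -- apply derive_mult; apply slope_derive; lra.
          -- apply slope_derive; lra.
          -- apply load_derive; lra.
        * apply derive_mult; apply is_derive_id.
      + apply (is_derive_inv (fun s => T (r s))); [| lra].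
        apply (is_derive_on_branch B T); [assumption | now apply (tw_der Tw)].
    - unfold one; simpl. unfold dG.
      assert (E : q (r s) * T (r s) * rho s = s * y s) by (unfold slope; field; lra).
      assert (E2 : / (q (r s) * rho s) = T (r s) / (s * y s)).
      { rewrite <- E. field. lra. }
      replace (- - / q (r s) / rho s) with (/ (q (r s) * rho s)) by (field; lra).
      rewrite E2. generalize (excess r rho s). intros ex.
      change (y s * y s - y s + N s) with (Y s).
      unfold steepening. field. lra. }
  assert (Hex : forall s, s0 <= s < alpha -> 0 <= excess r rho s).
  { intros s Hs. destruct (Hy1 s Hs) as [Hlt | Heq]; [apply Rlt_le, excess_pos; [lra | assumption] |].
    unfold excess, h_slope. rewrite Heq.
    assert (G1 := el_bound El s ltac:(lra) (br_dom B s ltac:(lra))).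
    assert (L := tw_low Tw _ (br_r B s ltac:(lra))). lra. }
  assert (HdGs : forall s, s0 <= s < alpha -> dG s <= 0).
  { intros s Hs. unfold dG. assert (HN := load_pos s ltac:(lra)).
    assert (Hy0 := slope_pos s ltac:(lra)). assert (HT := HTp s Hs).
    assert (0 <= N s * excess r rho s * s / (y s * T (r s))); [| lra].
    apply Rmult_le_pos; [| apply Rlt_le, Rinv_0_lt_compat, Rmult_lt_0_compat; assumption].
    apply Rmult_le_pos; [| lra]. apply Rmult_le_pos; [lra | now apply Hex]. }
  assert (HGmono : forall s t, s0 <= s -> s <= t -> t < alpha -> G t <= G s).
  { intros s t Hs Hst Ht. apply (nonincreasing_of_derive G dG); [assumption | |].
    - intros z Hz. apply HdG. lra.
    - intros z Hz. apply HdGs. lra. }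
  assert (HTmono : forall s, s0 <= s < alpha -> T (r s0) <= T (r s)).
  { intros s Hs. apply (nondecreasing_of_derive (fun t => T (r t)) (fun t => - - / q (r t) / rho t));
      [lra | |].
    - intros z Hz. assert (Hz' : lo < z < alpha) by lra.
      apply (is_derive_on_branch B T); [assumption | apply (tw_der Tw), (br_r B z Hz')].
    - intros z Hz. assert (Hz' : lo < z < alpha) by lra.
      rewrite Ropp_involutive. apply Rmult_le_pos; apply Rlt_le, Rinv_0_lt_compat;
        [apply (w_pos Wt), (br_r B z Hz') | apply (br_rho B z Hz')]. }
  assert (HG0 : forall s, s0 <= s < alpha -> 0 <= G s).
  { intros s Hs. set (K := alpha * alpha / T (r s0)).
    assert (HT0 := HTp s0 ltac:(lra)).
    apply (lim_le (Fl := at_left alpha) (fun t => - (y t * K)) (fun _ => G s)).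
    - replace 0 with (- (0 * K)) by ring. apply lim_opp, lim_mult;
        [apply slope_vanishes | apply filterlim_const].
    - apply filterlim_const.
    - apply (filter_imp (fun t => s < t < alpha)); [| apply at_left_interval; lra].
      intros t Ht. apply Rle_trans with (G t); [| apply HGmono; lra].
      assert (HT := HTmono t ltac:(lra)). assert (HTt := HTp t ltac:(lra)).
      assert (Hy0 := slope_pos t ltac:(lra)). assert (HN := load_pos t ltac:(lra)).
      assert (I : t * t * / T (r t) <= K).
      { unfold K, Rdiv. apply Rmult_le_compat; [nra | apply Rlt_le, Rinv_0_lt_compat; lra | nra |].
        apply Rinv_le_contravar; assumption. }
      assert (0 <= t * t * / T (r t)).
      { apply Rmult_le_pos; [nra | apply Rlt_le, Rinv_0_lt_compat; lra]. }
      assert (HY : - y t <= Y t) by (unfold steepening; nra).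
      unfold G. rewrite Rmult_assoc. nra. }
  (* strict decrease near the top, where the slope is below 1 *)
  assert (Hnear : at_left alpha (fun s => s0 < s < alpha /\ y s < 1)).
  { apply filter_and; [apply at_left_interval; lra |].
    apply (lim_lt (Fl := at_left alpha) _ 0); [apply slope_vanishes | lra]. }
  destruct Hnear as [d Hd]. assert (Hdp := cond_pos d).
  set (e := Rmin d (alpha - s0)). assert (He : 0 < e) by (apply Rmin_pos; lra).
  assert (He1 : e <= d) by apply Rmin_l. assert (He2 : e <= alpha - s0) by apply Rmin_r.
  assert (Hlt1 : forall s, alpha - e < s < alpha -> y s < 1).
  { intros s Hs. apply Hd; [| lra]. unfold ball; simpl. apply Rabs_lt_between.
    unfold minus, plus, opp; simpl. lra. }
  assert (HGlt : G (alpha - e / 4) < G (alpha - e / 2)).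
  { assert (- G (alpha - e / 2) < - G (alpha - e / 4)); [| lra].
    apply (increasing_of_derive (fun s => - G s) (fun s => - dG s)); [lra | |].
    - intros z Hz. apply (is_derive_opp G), HdG. lra.
    - intros z Hz. unfold dG. rewrite Ropp_involutive.
      assert (HN := load_pos z ltac:(lra)). assert (Hy0 := slope_pos z ltac:(lra)).
      assert (HT := HTp z ltac:(lra)).
      assert (Hx := excess_pos z ltac:(lra) (Hlt1 z ltac:(lra))).
      apply Rdiv_lt_0_compat; [| now apply Rmult_lt_0_compat].
      apply Rmult_lt_0_compat; [now apply Rmult_lt_0_compat | lra]. }
  assert (HGs : 0 < G s0).
  { assert (A1 := HG0 (alpha - e / 4) ltac:(lra)).
    assert (A2 := HGmono s0 (alpha - e / 2) ltac:(lra) ltac:(lra) ltac:(lra)). lra. }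
  unfold G in HGs. apply Rnot_le_lt. intros HY.
  assert (0 < s0 * s0 * / T (r s0)).
  { apply Rmult_lt_0_compat; [nra | apply Rinv_0_lt_compat, HTp; lra]. }
  rewrite Rmult_assoc in HGs. nra.
Qed.

Lemma slope_decreasing (s t : R) : beta <= s -> s < t -> t < alpha -> y t < y s.
Proof.
  intros Hs Hst Ht. assert (Hb := fo_b Fo). assert (- y s < - y t); [| lra].
  apply (increasing_of_derive (fun z => - y z) (fun z => - - (Y z / (z * y z)))); [assumption | |].
  - intros z Hz. apply (is_derive_opp (slope r rho)), slope_derive. lra.
  - intros z Hz. rewrite Ropp_involutive. assert (HY := steepening_pos z ltac:(lra)).
    assert (Hy := slope_pos z ltac:(lra)).
    apply Rdiv_lt_0_compat; [assumption | apply Rmult_lt_0_compat; lra].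
Qed.

Lemma slope_inverse : exists inv : R -> R, forall e, 0 < e < y beta ->
  beta < inv e < alpha /\ y (inv e) = e /\
  is_derive inv e (- (inv e * e / Y (inv e))).
Proof.
  assert (Hb := fo_b Fo).
  destruct (inverse_of_decreasing (slope r rho) (fun s => - (Y s / (s * y s))) beta alpha 0 (y beta))
    as [inv Hinv].
  - intros x Hx Hxa. simpl in Hxa. split; [apply slope_derive; lra |].
    assert (HY := steepening_pos x ltac:(lra)). assert (Hy := slope_pos x ltac:(lra)).
    assert (0 < Y x / (x * y x)); [| lra].
    apply Rdiv_lt_0_compat; [assumption | apply Rmult_lt_0_compat; lra].
  - intros e He.
    destruct (filter_ex (F := at_left alpha) (fun x => beta < x < alpha /\ y x < e)) as (x & Hx & Hyx).
    { apply filter_and; [apply at_left_interval; lra |].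
      apply (lim_lt (Fl := at_left alpha) _ 0); [apply slope_vanishes | lra]. }
    destruct (lowest_zero (fun s => y s - e) beta x) as (z & Hz & H0 & _); try lra.
    + intros t Ht. eapply is_derive_continuous, derive_minus;
        [apply slope_derive; lra | apply (is_derive_const (V := R_NormedModule) e)].
    + exists z. simpl. lra.
  - exists inv. intros e He. destruct (Hinv e He) as (H1 & H2 & H3 & H4). simpl in H2.
    split; [lra |]. split; [assumption |].
    assert (HY := steepening_pos (inv e) ltac:(lra)).
    eapply is_derive_value; [exact H4 |]. rewrite H3. field. lra.
Qed.
End OneBranch.

Section Matching.
Context {lo alpha1 alpha2 : R} {r1 rho1 r2 rho2 : R -> R}.
Context (B1 : branch c q dq f F lo alpha1 r1 rho1) (B2 : branch c q dq f F lo alpha2 r2 rho2).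
Context (Hlo : lo < beta) (Hal1 : beta < alpha1) (Hal2 : alpha1 < alpha2).
Context (Hda1 : in_dom c alpha1).
Context (L1 : rests (at_left alpha1) r1 rho1 0) (L2 : rests (at_left alpha2) r2 rho2 0).

Local Notation y1 := (slope r1 rho1).
Local Notation y2 := (slope r2 rho2).
Local Notation N1 := (load r1).
Local Notation N2 := (load r2).
Local Notation Y1 := (steepening r1 rho1).
Local Notation Y2 := (steepening r2 rho2).

Lemma tail_decreasing (x z : R) : 0 < x -> x < z -> T z < T x.
Proof.
  intros Hx Hxz. assert (- T x < - T z); [| lra].
  apply (increasing_of_derive (fun t => - T t) (fun t => - - / q t)); [assumption | |].
  - intros t Ht. apply (is_derive_opp T), (tw_der Tw). lra.
  - intros t Ht. rewrite Ropp_involutive. apply Rinv_0_lt_compat, (w_pos Wt). lra.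
Qed.

(** f / s has elasticity at most 2 l in s, and h has elasticity at most - l in T; so
    h^2 f / s drops if T increases by a larger factor than s. *)
Lemma load_comparison (s s' x x' : R) : beta <= s -> s < s' -> in_dom c s' ->
  0 < x' -> 0 < x -> s' / s < T x' / T x ->
  (q x' * T x') * (q x' * T x') * (f s' / s') < (q x * T x) * (q x * T x) * (f s / s).
Proof.
  intros Hs Hss Hd Hx' Hx HT. assert (Hb := fo_b Fo). assert (Hl := tw_l Tw).
  assert (HTx := tw_pos Tw x Hx). assert (HTx' := tw_pos Tw x' Hx').
  assert (Hxx : x' < x).
  { apply Rnot_le_lt. intros [Hc | Hc].
    - assert (T x' < T x) by now apply tail_decreasing.
      assert (T x' / T x < 1) by (apply Rmult_lt_reg_r with (T x); [assumption |];
        unfold Rdiv; rewrite Rmult_assoc, Rinv_l; lra).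
      assert (1 < s' / s) by (apply Rmult_lt_reg_r with s; [lra |];
        unfold Rdiv; rewrite Rmult_assoc, Rinv_l; lra). lra.
    - rewrite Hc in HT. unfold Rdiv in HT at 2. rewrite Rinv_r in HT by lra.
      assert (1 < s' / s) by (apply Rmult_lt_reg_r with s; [lra |];
        unfold Rdiv; rewrite Rmult_assoc, Rinv_l; lra). lra. }
  assert (Hdom : forall t, s <= t <= s' -> in_dom c t).
  { intros t Ht. unfold in_dom in *. apply Rbar_le_lt_trans with (Rabs s'); [| assumption].
    simpl. rewrite !Rabs_pos_eq by lra. lra. }
  assert (Hfp : forall t, s <= t <= s' -> 0 < f t).
  { intros t Ht. apply (fo_pos Fo); [lra | now apply Hdom]. }
  assert (I1 : ln (f s') - (1 + 2 * l) * ln s' <= ln (f s) - (1 + 2 * l) * ln s).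
  { apply (nonincreasing_of_derive (fun t => ln (f t) - (1 + 2 * l) * ln t)
      (fun t => / f t * df t - (1 + 2 * l) * / t)); [lra | |].
    - intros t Ht. assert (Hf := Hfp t Ht). apply derive_minus.
      + apply (derive_comp ln f); [now apply is_derive_ln | apply (el_der El); [lra | now apply Hdom]].
      + apply (is_derive_scal ln); apply is_derive_ln; lra.
    - intros t Ht. assert (Hf := Hfp t ltac:(lra)).
      assert (G := el_bound El t ltac:(lra) (Hdom t ltac:(lra))).
      assert (E : / f t * df t - (1 + 2 * l) * / t = (t * df t / f t - (1 + 2 * l)) * / t)
        by (field; lra).
      rewrite E. assert (0 < / t) by (apply Rinv_0_lt_compat; lra). nra. }
  assert (Hhp : forall t, 0 < t -> 0 < q t * T t) by apply h_pos.
  assert (I2 : ln (q x' * T x') + l * ln (T x') <= ln (q x * T x) + l * ln (T x)).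
  { apply (nondecreasing_of_derive (fun t => ln (q t * T t) + l * ln (T t))
      (fun t => / (q t * T t) * h_slope t + l * (/ T t * - / q t))); [lra | |].
    - intros t Ht. assert (Ht0 : 0 < t) by lra. apply derive_plus.
      + apply (derive_comp ln (fun t => q t * T t)); [apply is_derive_ln, Hhp; assumption |
          now apply h_derive].
      + apply (is_derive_scal (fun t => ln (T t))).
        apply (derive_comp ln T); [now apply is_derive_ln, (tw_pos Tw) | now apply (tw_der Tw)].
    - intros t Ht. assert (Ht0 : 0 < t) by lra.
      assert (Hq := w_pos Wt t Ht0). assert (HTt := tw_pos Tw t Ht0).
      assert (L := tw_low Tw t Ht0).
      assert (E : / (q t * T t) * h_slope t + l * (/ T t * - / q t) = (h_slope t - l) * / (q t * T t))
        by (field; lra).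
      rewrite E. apply Rmult_le_pos; [unfold h_slope; lra |].
      apply Rlt_le, Rinv_0_lt_compat, Hhp, Ht0. }
  assert (I3 : ln s' - ln s < ln (T x') - ln (T x)).
  { rewrite <- !ln_div by lra. apply ln_increasing; [apply Rdiv_lt_0_compat; lra | assumption]. }
  assert (Hh := Hhp x Hx). assert (Hh' := Hhp x' Hx').
  assert (Hf := Hfp s ltac:(lra)). assert (Hf' := Hfp s' ltac:(lra)).
  assert (P1 : 0 < f s / s) by (apply Rdiv_lt_0_compat; lra).
  assert (P2 : 0 < f s' / s') by (apply Rdiv_lt_0_compat; lra).
  set (h := q x * T x) in *. set (h' := q x' * T x') in *. clearbody h h'.
  set (g := f s / s) in *. set (g' := f s' / s') in *.
  assert (Eg : ln g = ln (f s) - ln s) by (apply ln_div; lra).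
  assert (Eg' : ln g' = ln (f s') - ln s') by (apply ln_div; lra).
  clearbody g g'.
  apply ln_lt_inv; [repeat apply Rmult_lt_0_compat; assumption |
    repeat apply Rmult_lt_0_compat; assumption |].
  rewrite !ln_mult by (try apply Rmult_lt_0_compat; assumption).
  rewrite Eg, Eg'. nra.
Qed.

(** Match the level s of branch 1 with the level sg (s) of branch 2 at which the slope
    is the same. A contact of the fluxes while solution 1 is later gives s < sg (s)
    and, by [load_comparison], N2 < N1 for the loads at matched levels. Both persist
    upwards: psi = 1 - N2 / N1 satisfies psi' >= - (2 l / beta) psi as long as it is
    positive. But near the top, where the slopes are below 1, N1 - N2 does not
    decrease upwards, and N1 tends to 0 there. *)
Lemma no_flux_contact_while_later (s0 : R) : beta <= s0 < alpha1 -> r2 s0 < r1 s0 ->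
  q (r1 s0) * rho1 s0 <> q (r2 s0) * rho2 s0.
Proof.
  intros Hs0 Hr Hw. assert (Hb := fo_b Fo). assert (Hl := tw_l Tw).
  destruct (slope_inverse B2 Hlo ltac:(lra) L2) as [inv Hinv].
  assert (Hin1 : forall s, s0 <= s < alpha1 -> lo < s < alpha1) by (intros; lra).
  assert (R10 := br_r B1 s0 ltac:(lra)). assert (R20 := br_r B2 s0 ltac:(lra)).
  assert (W10 := flux_pos Wt B1 s0 ltac:(lra)).
  assert (HT0 : T (r1 s0) < T (r2 s0)) by now apply tail_decreasing.
  assert (HT10 := tw_pos Tw _ R10).
  assert (Hy0 : y1 s0 < y2 s0).
  { unfold slope.
    replace (q (r1 s0) * T (r1 s0) * rho1 s0 / s0) with
      (T (r1 s0) * ((q (r1 s0) * rho1 s0) / s0)) by (field; lra).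
    replace (q (r2 s0) * T (r2 s0) * rho2 s0 / s0) with
      (T (r2 s0) * ((q (r2 s0) * rho2 s0) / s0)) by (field; lra).
    rewrite <- Hw. apply Rmult_lt_compat_r; [| assumption]. apply Rdiv_lt_0_compat; lra. }
  assert (Hy0b : y2 s0 <= y2 beta).
  { destruct (proj1 Hs0) as [Hlt | Heq]; [| rewrite Heq; lra].
    apply Rlt_le, (slope_decreasing B2 Hlo ltac:(lra) L2); lra. }
  assert (Hy1 : forall s, s0 <= s < alpha1 -> 0 < y1 s < y2 beta).
  { intros s Hs. split; [apply (slope_pos B1 Hlo); lra |].
    destruct (proj1 Hs) as [Hlt | Heq]; [| subst; lra].
    assert (y1 s < y1 s0); [| lra]. apply (slope_decreasing B1 Hlo Hal1 L1); lra. }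
  set (sg := fun s => inv (y1 s)).
  assert (Hsg : forall s, s0 <= s < alpha1 -> beta < sg s < alpha2 /\ y2 (sg s) = y1 s).
  { intros s Hs. destruct (Hinv (y1 s) (Hy1 s Hs)) as (G1 & G2 & _). now split. }
  assert (HY1 : forall s, s0 <= s < alpha1 -> 0 < Y1 s).
  { intros s Hs. apply (steepening_pos B1 Hlo Hal1 L1). lra. }
  assert (HY2 : forall s, s0 <= s < alpha1 -> 0 < Y2 (sg s)).
  { intros s Hs. destruct (Hsg s Hs). apply (steepening_pos B2 Hlo ltac:(lra) L2). lra. }
  assert (HN1 : forall s, s0 <= s < alpha1 -> 0 < N1 s).
  { intros s Hs. apply (load_pos B1 Hlo). lra. }
  assert (HN2 : forall s, s0 <= s < alpha1 -> 0 < N2 (sg s)).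
  { intros s Hs. destruct (Hsg s Hs). apply (load_pos B2 Hlo). lra. }
  assert (HYY : forall s, s0 <= s < alpha1 -> Y1 s - Y2 (sg s) = N1 s - N2 (sg s)).
  { intros s Hs. destruct (Hsg s Hs) as [_ E]. unfold steepening. rewrite E. ring. }
  assert (Dsg : forall s, s0 <= s < alpha1 ->
    is_derive sg s (Y1 s * sg s / (Y2 (sg s) * s))).
  { intros s Hs. destruct (Hinv (y1 s) (Hy1 s Hs)) as (_ & _ & G).
    assert (HY := HY2 s Hs). assert (Hy := Hy1 s Hs).
    eapply is_derive_value.
    - apply (derive_comp inv (slope r1 rho1)); [exact G | apply (slope_derive B1 Hlo); lra].
    - fold (sg s). field. lra. }
  (* A and C start above 1 with A < C, and increase as long as N2 < N1 *)
  set (A := fun s => sg s / s).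
  set (C := fun s => T (r2 (sg s)) * / T (r1 s)).
  assert (HT1 : forall s, s0 <= s < alpha1 -> 0 < T (r1 s)).
  { intros s Hs. apply (tw_pos Tw), (br_r B1). lra. }
  assert (HT2 : forall s, s0 <= s < alpha1 -> 0 < T (r2 (sg s))).
  { intros s Hs. destruct (Hsg s Hs). apply (tw_pos Tw), (br_r B2). lra. }
  assert (DA : forall s, s0 <= s < alpha1 ->
    is_derive A s (sg s / (s * s) * ((Y1 s - Y2 (sg s)) / Y2 (sg s)))).
  { intros s Hs. assert (HY := HY2 s Hs). eapply is_derive_value.
    - apply (is_derive_div sg (fun s => s)); [now apply Dsg | apply is_derive_id | lra].
    - unfold one; simpl. field. lra. }
  assert (DC : forall s, s0 <= s < alpha1 ->
    is_derive C s (C s / (s * y1 s) * ((Y1 s - Y2 (sg s)) / Y2 (sg s)))).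
  { intros s Hs. assert (HY := HY2 s Hs). destruct (Hsg s Hs) as [Hsl Hse].
    assert (R1 := br_r B1 s ltac:(lra)). assert (R2 := br_r B2 (sg s) ltac:(lra)).
    assert (P1 := br_rho B1 s ltac:(lra)). assert (P2 := br_rho B2 (sg s) ltac:(lra)).
    assert (Q1 := w_pos Wt _ R1). assert (Q2 := w_pos Wt _ R2).
    assert (K1 := HT1 s Hs). assert (K2 := HT2 s Hs). assert (Hy := proj1 (Hy1 s Hs)).
    eapply is_derive_value.
    - apply (derive_mult (fun s => T (r2 (sg s))) (fun s => / T (r1 s))).
      + apply (derive_comp (fun t => T (r2 t)) sg); [| now apply Dsg].
        apply (is_derive_on_branch B2 T); [lra | now apply (tw_der Tw)].
      + apply (is_derive_inv (fun s => T (r1 s))); [| lra].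
        apply (is_derive_on_branch B1 T); [lra | now apply (tw_der Tw)].
    - assert (E1 : q (r1 s) = s * y1 s / (T (r1 s) * rho1 s)) by (unfold slope; field; lra).
      assert (E2 : q (r2 (sg s)) = sg s * y1 s / (T (r2 (sg s)) * rho2 (sg s)))
        by (rewrite <- Hse; unfold slope; field; lra).
      unfold C. rewrite E1, E2. field. repeat split; lra. }
  assert (A0 : 1 < A s0).
  { assert (s0 < sg s0).
    { destruct (Hsg s0 ltac:(lra)) as [Hsl Hse]. apply Rnot_le_lt. intros [Hlt | Heq].
      - assert (y2 s0 < y2 (sg s0)); [| lra].
        apply (slope_decreasing B2 Hlo ltac:(lra) L2); lra.
      - rewrite Heq in Hse. lra. }
    unfold A. apply Rmult_lt_reg_r with s0; [lra |]. unfold Rdiv.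
    rewrite Rmult_assoc, Rinv_l; lra. }
  assert (Hs0' : s0 <= s0 < alpha1) by lra.
  assert (Hgt0 : s0 < sg s0).
  { unfold A in A0. apply (Rmult_lt_compat_r s0) in A0; [| lra].
    unfold Rdiv in A0. rewrite Rmult_assoc, Rinv_l in A0; lra. }
  assert (C0 : A s0 < C s0).
  { destruct (Hsg s0 Hs0') as [Hsl Hse].
    assert (R2 := br_r B2 (sg s0) ltac:(lra)). assert (P2 := br_rho B2 (sg s0) ltac:(lra)).
    assert (Q2 := w_pos Wt _ R2). assert (K2 := HT2 s0 Hs0').
    assert (Hww : q (r2 (sg s0)) * rho2 (sg s0) < q (r2 s0) * rho2 s0).
    { assert (- (q (r2 s0) * rho2 s0) < - (q (r2 (sg s0)) * rho2 (sg s0))); [| lra].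
      apply (increasing_of_derive (fun t => - (q (r2 t) * rho2 t))
        (fun t => - - (q (r2 t) * f t / rho2 t))); [assumption | |].
      - intros t Ht. apply (is_derive_opp (fun t => q (r2 t) * rho2 t)), (flux_derive Wt B2). lra.
      - intros t Ht. rewrite Ropp_involutive. apply Rdiv_lt_0_compat; [| apply (br_rho B2); lra].
        apply Rmult_lt_0_compat; [apply (w_pos Wt), (br_r B2); lra |].
        apply (force_pos_above B2 Hlo); lra. }
    rewrite <- Hw in Hww.
    unfold slope in Hse.
    assert (E : T (r2 (sg s0)) * (q (r2 (sg s0)) * rho2 (sg s0)) * s0 =
                T (r1 s0) * (q (r1 s0) * rho1 s0) * sg s0).
    { apply (f_equal (fun z => z * (sg s0 * s0))) in Hse.
      replace (q (r2 (sg s0)) * T (r2 (sg s0)) * rho2 (sg s0) / sg s0 * (sg s0 * s0)) with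
        (T (r2 (sg s0)) * (q (r2 (sg s0)) * rho2 (sg s0)) * s0) in Hse by (field; lra).
      rewrite Hse. field. lra. }
    set (w1 := q (r1 s0) * rho1 s0) in *. set (w2 := q (r2 (sg s0)) * rho2 (sg s0)) in *.
    assert (W2 : 0 < w2) by now apply Rmult_lt_0_compat.
    unfold A, C. clearbody w1 w2.
    apply Rmult_lt_reg_r with (s0 * T (r1 s0) * w1);
      [repeat apply Rmult_lt_0_compat; lra |].
    replace (sg s0 / s0 * (s0 * T (r1 s0) * w1)) with (T (r1 s0) * w1 * sg s0) by (field; lra).
    replace (T (r2 (sg s0)) * / T (r1 s0) * (s0 * T (r1 s0) * w1)) with
      (T (r2 (sg s0)) * w1 * s0) by (field; lra).
    rewrite <- E. apply Rmult_lt_compat_r; [lra |]. apply Rmult_lt_compat_l; assumption. }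
  set (psi := fun s => 1 - N2 (sg s) / N1 s).
  assert (Hpsi : forall s, s0 <= s < alpha1 -> (0 < psi s <-> N2 (sg s) < N1 s)).
  { intros s Hs. assert (K := HN1 s Hs). unfold psi.
    assert (E : 1 - N2 (sg s) / N1 s = (N1 s - N2 (sg s)) * / N1 s) by (field; lra).
    rewrite E. assert (0 < / N1 s) by now apply Rinv_0_lt_compat.
    split; intros; nra. }
  assert (Psi0 : 0 < psi s0).
  { apply Hpsi; [assumption |]. destruct (Hsg s0 Hs0') as [Hsl _].
    apply load_comparison; try assumption; try lra.
    - apply (br_dom B2). lra.
    - apply (br_r B2). lra. }
  assert (DN2 : forall s, s0 <= s < alpha1 -> is_derive (fun s => N2 (sg s)) s
    (- (N2 (sg s) / (s * y1 s) * excess r2 rho2 (sg s) * (Y1 s / Y2 (sg s))))).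
  { intros s Hs. destruct (Hsg s Hs) as [Hsl Hse]. assert (HY := HY2 s Hs).
    assert (Hy := proj1 (Hy1 s Hs)). eapply is_derive_value.
    - apply (derive_comp (load r2) sg); [apply (load_derive B2 Hlo); lra | now apply Dsg].
    - rewrite Hse. field. lra. }
  assert (DN1 : forall s, s0 <= s < alpha1 -> is_derive N1 s
    (- (N1 s / (s * y1 s) * excess r1 rho1 s))).
  { intros s Hs. apply (load_derive B1 Hlo). lra. }
  assert (Dpsi : forall s, s0 <= s < alpha1 -> is_derive psi s
    (N2 (sg s) / N1 s / (s * y1 s) *
      (excess r2 rho2 (sg s) * (Y1 s / Y2 (sg s)) - excess r1 rho1 s))).
  { intros s Hs. assert (K1 := HN1 s Hs). assert (K2 := HY2 s Hs).
    assert (K3 := proj1 (Hy1 s Hs)). unfold psi. eapply is_derive_value.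
    - apply (derive_minus (fun _ => 1) (fun s => N2 (sg s) / N1 s));
        [apply (is_derive_const (V := R_NormedModule) 1) |].
      apply (is_derive_div (fun s => N2 (sg s)) (load r1)); [exact (DN2 s Hs) | exact (DN1 s Hs) | lra].
    - unfold zero; simpl. field. repeat split; lra. }
  assert (Hlater : forall z, s0 <= z < alpha1 -> (forall t, s0 < t < z -> 0 < psi t) ->
    z < sg z /\ r2 (sg z) < r1 z).
  { intros z Hz Hp.
    assert (Hrat : forall t, s0 < t < z -> 0 <= (Y1 t - Y2 (sg t)) / Y2 (sg t)).
    { intros t Ht. assert (K := proj1 (Hpsi t ltac:(lra)) (Hp t Ht)).
      rewrite HYY by lra. apply Rlt_le, Rdiv_lt_0_compat; [lra | apply HY2; lra]. }
    assert (HA : A s0 <= A z).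
    { apply (nondecreasing_of_derive A
        (fun s => sg s / (s * s) * ((Y1 s - Y2 (sg s)) / Y2 (sg s)))); [lra | |].
      - intros t Ht. apply DA. lra.
      - intros t Ht. apply Rmult_le_pos; [| now apply Hrat].
        destruct (Hsg t ltac:(lra)). apply Rlt_le, Rdiv_lt_0_compat; [lra | nra]. }
    assert (HC : C s0 <= C z).
    { apply (nondecreasing_of_derive C
        (fun s => C s / (s * y1 s) * ((Y1 s - Y2 (sg s)) / Y2 (sg s)))); [lra | |].
      - intros t Ht. apply DC. lra.
      - intros t Ht. apply Rmult_le_pos; [| now apply Hrat].
        apply Rlt_le, Rdiv_lt_0_compat.
        + apply Rmult_lt_0_compat; [apply HT2; lra | apply Rinv_0_lt_compat, HT1; lra].
        + apply Rmult_lt_0_compat; [lra | apply Hy1; lra]. }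
    assert (K1 := HT1 z Hz). assert (K2 := HT2 z Hz).
    split.
    - assert (K : 1 < A z) by lra. unfold A in K. apply (Rmult_lt_compat_r z) in K; [| lra].
      unfold Rdiv in K. rewrite Rmult_assoc, Rinv_l in K; lra.
    - assert (K : 1 < C z) by lra. unfold C in K.
      apply (Rmult_lt_compat_r (T (r1 z))) in K; [| assumption].
      rewrite Rmult_assoc, Rinv_l in K by lra.
      apply Rnot_le_lt. intros [Hlt | Heq]; [| rewrite Heq in K; lra].
      assert (T (r2 (sg z)) < T (r1 z)); [| lra].
      apply tail_decreasing; [apply (br_r B1); lra | assumption]. }
  assert (Hexc : forall t, s0 <= t < alpha1 -> t < sg t -> r2 (sg t) < r1 t ->
    excess r1 rho1 t <= excess r2 rho2 (sg t)).
  { intros t Ht Hlt Hrr. destruct (Hsg t Ht) as [Hsl Hse]. unfold excess. rewrite Hse.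
    assert (G1 := tw_mono Tw _ _ (br_r B2 (sg t) ltac:(lra)) (Rlt_le _ _ Hrr)).
    assert (G2 := el_mono El t (sg t) ltac:(lra) ltac:(lra) (br_dom B2 (sg t) ltac:(lra))).
    assert (Hy := proj1 (Hy1 t Ht)). unfold h_slope.
    set (g := t * df t / f t) in *. set (g' := sg t * df (sg t) / f (sg t)) in *.
    assert (0 <= (g - g') * y1 t) by (apply Rmult_le_pos; lra). nra. }
  (* psi exp (2 l s / beta) is nondecreasing as long as psi is positive *)
  assert (Hall : forall z, s0 <= z < alpha1 -> 0 < psi z).
  { intros z0 Hz0. apply (propagate_up psi s0 z0); [| assumption | | lra].
    - intros z Hz. eapply is_derive_continuous, Dpsi. lra.
    - intros z Hz Hp.
      set (K := 2 * l / beta).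
      assert (HK : 0 <= K) by (apply Rlt_le, Rdiv_lt_0_compat; lra).
      assert (M : psi s0 * exp (K * s0) <= psi z * exp (K * z)).
      { apply (nondecreasing_of_derive (fun s => psi s * exp (K * s)) (fun s =>
          (N2 (sg s) / N1 s / (s * y1 s) *
            (excess r2 rho2 (sg s) * (Y1 s / Y2 (sg s)) - excess r1 rho1 s)) * exp (K * s)
          + psi s * (exp (K * s) * K))); [lra | |].
        - intros t Ht. assert (Ht' : s0 <= t < alpha1) by lra.
          apply (derive_mult psi (fun s => exp (K * s))).
          + now apply Dpsi.
          + apply (derive_comp exp (fun s => K * s)); [apply is_derive_exp |].
            eapply is_derive_value; [apply (is_derive_scal (fun s => s)), is_derive_id |].
            unfold one; simpl. ring.
        - intros t Ht. assert (Ht' : s0 <= t < alpha1) by lra.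
          assert (K1 := HN1 t Ht'). assert (K2 := HY2 t Ht'). assert (K3 := proj1 (Hy1 t Ht')).
          assert (K4 := HN2 t Ht'). assert (K5 := HY1 t Ht').
          destruct (Hlater t Ht') as [L3 L4]; [intros u Hu; apply Hp; lra |].
          assert (Hx := Hexc t Ht' L3 L4).
          assert (Hpt := Hp t ltac:(lra)). assert (HNN := proj1 (Hpsi t Ht') Hpt).
          assert (HYYt := HYY t Ht').
          assert (He := exp_pos (K * t)).
          replace (N2 (sg t) / N1 t / (t * y1 t) *
            (excess r2 rho2 (sg t) * (Y1 t / Y2 (sg t)) - excess r1 rho1 t) * exp (K * t)
            + psi t * (exp (K * t) * K)) with
            ((N2 (sg t) / N1 t / (t * y1 t) *
            (excess r2 rho2 (sg t) * (Y1 t / Y2 (sg t)) - excess r1 rho1 t) + K * psi t) * exp (K * t))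
            by ring.
          apply Rmult_le_pos; [| lra].
          assert (I1 : N2 (sg t) / N1 t / (t * y1 t) * (excess r1 rho1 t * ((N1 t - N2 (sg t)) / Y2 (sg t)))
            <= N2 (sg t) / N1 t / (t * y1 t) *
            (excess r2 rho2 (sg t) * (Y1 t / Y2 (sg t)) - excess r1 rho1 t)).
          { apply Rmult_le_compat_l.
            - apply Rlt_le. repeat apply Rdiv_lt_0_compat; try assumption.
              apply Rmult_lt_0_compat; lra.
            - rewrite <- HYYt.
              replace ((Y1 t - Y2 (sg t)) / Y2 (sg t)) with (Y1 t / Y2 (sg t) - 1) by (field; lra).
              assert (0 < Y1 t / Y2 (sg t)) by now apply Rdiv_lt_0_compat. nra. }
          assert (I2 : - (K * psi t) <=
            N2 (sg t) / N1 t / (t * y1 t) * (excess r1 rho1 t * ((N1 t - N2 (sg t)) / Y2 (sg t)))).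
          { replace (N2 (sg t) / N1 t / (t * y1 t) *
              (excess r1 rho1 t * ((N1 t - N2 (sg t)) / Y2 (sg t)))) with
              (psi t * ((excess r1 rho1 t / (t * y1 t)) * (N2 (sg t) / Y2 (sg t))))
              by (unfold psi; field; repeat split; lra).
            assert (Hty : 0 < t * y1 t) by (apply Rmult_lt_0_compat; lra).
            assert (Hr2 : 0 < N2 (sg t) / Y2 (sg t)) by now apply Rdiv_lt_0_compat.
            assert (- K <= (excess r1 rho1 t / (t * y1 t)) * (N2 (sg t) / Y2 (sg t))); [| nra].
            destruct (Rle_or_lt 0 (excess r1 rho1 t)) as [Hx0 | Hx0].
            - assert (0 <= (excess r1 rho1 t / (t * y1 t)) * (N2 (sg t) / Y2 (sg t))); [| lra].
              apply Rmult_le_pos; [| lra]. apply Rmult_le_pos; [assumption |].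
              apply Rlt_le, Rinv_0_lt_compat, Hty.
            - assert (Hy1t : 1 <= y1 t).
              { apply Rnot_lt_le. intros Hc.
                assert (0 < excess r1 rho1 t) by (apply (excess_pos B1 Hlo); lra). lra. }
              assert (Hr2' : N2 (sg t) / Y2 (sg t) <= 1).
              { apply Rmult_le_reg_r with (Y2 (sg t)); [assumption |].
                unfold Rdiv. rewrite Rmult_assoc, Rinv_l by lra.
                destruct (Hsg t Ht') as [_ Hse]. unfold steepening. rewrite Hse. nra. }
              assert (Hge : - K <= excess r1 rho1 t / (t * y1 t)).
              { apply Rmult_le_reg_r with (t * y1 t); [assumption |].
                replace (excess r1 rho1 t / (t * y1 t) * (t * y1 t)) with (excess r1 rho1 t)
                  by (field; lra).
                assert (G1 := el_bound El t ltac:(lra) (br_dom B1 t ltac:(lra))).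
                assert (G2 := tw_low Tw _ (br_r B1 t ltac:(lra))).
                assert (2 * l * y1 t <= K * (t * y1 t)).
                { unfold K. replace (2 * l / beta * (t * y1 t)) with (2 * l * y1 t * (t / beta))
                    by (field; lra).
                  assert (1 <= t / beta).
                  { apply Rmult_le_reg_r with beta; [lra |]. unfold Rdiv.
                    rewrite Rmult_assoc, Rinv_l; lra. }
                  assert (0 < 2 * l * y1 t) by (apply Rmult_lt_0_compat; lra). nra. }
                unfold excess, h_slope.
                assert ((t * df t / f t - 1) * y1 t <= 2 * l * y1 t)
                  by (apply Rmult_le_compat_r; lra).
                lra. }
              assert (Hx1 : excess r1 rho1 t / (t * y1 t) < 0).
              { apply Rmult_lt_reg_r with (t * y1 t); [assumption |].
                replace (excess r1 rho1 t / (t * y1 t) * (t * y1 t)) with (excess r1 rho1 t)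
                  by (field; lra). lra. }
              nra. }
          lra. }
      assert (0 < exp (K * z)) by apply exp_pos.
      assert (0 < psi s0 * exp (K * s0)) by (apply Rmult_lt_0_compat; [assumption | apply exp_pos]).
      apply Rnot_le_lt. intros Hc. nra. }
  (* where the slope is below 1, N2 Y1 >= N1 Y2, so N1 - N2 does not decrease *)
  assert (Hnear : at_left alpha1 (fun s => s0 < s < alpha1 /\ y1 s < 1)).
  { apply filter_and; [apply at_left_interval; lra |].
    apply (lim_lt (Fl := at_left alpha1) _ 0); [apply (slope_vanishes B1 Hlo Hal1 L1) | lra]. }
  destruct Hnear as [d Hd]. assert (Hdp := cond_pos d).
  set (e := Rmin d (alpha1 - s0)). assert (He : 0 < e) by (apply Rmin_pos; lra).
  assert (He1 : e <= d) by apply Rmin_l. assert (He2 : e <= alpha1 - s0) by apply Rmin_r.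
  assert (Hlt1 : forall s, alpha1 - e < s < alpha1 -> y1 s < 1).
  { intros s Hs. apply Hd; [| lra]. unfold ball; simpl. apply Rabs_lt_between.
    unfold minus, plus, opp; simpl. lra. }
  set (ss := alpha1 - e / 2).
  assert (Hss : s0 <= ss < alpha1) by (unfold ss; lra).
  assert (Hgap := proj1 (Hpsi ss Hss) (Hall ss Hss)).
  assert (N1 ss - N2 (sg ss) <= 0); [| lra].
  apply (lim_le (Fl := at_left alpha1) (fun _ => N1 ss - N2 (sg ss)) N1);
    [apply filterlim_const | apply (load_vanishes B1 Hlo Hal1 Hda1 L1) |].
  apply (filter_imp (fun s => ss < s < alpha1)); [| apply at_left_interval; lra].
  intros s Hs. assert (Hs' : s0 <= s < alpha1) by lra. assert (K2 := HN2 s Hs').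
  assert (N1 ss - N2 (sg ss) <= N1 s - N2 (sg s)); [| lra].
  apply (nondecreasing_of_derive (fun t => N1 t - N2 (sg t)) (fun t =>
    - (N1 t / (t * y1 t) * excess r1 rho1 t) -
    - (N2 (sg t) / (t * y1 t) * excess r2 rho2 (sg t) * (Y1 t / Y2 (sg t))))); [lra | |].
  - intros t Ht. apply derive_minus; [apply DN1 | apply DN2]; lra.
  - intros t Ht. assert (Ht' : s0 <= t < alpha1) by lra.
    destruct (Hlater t Ht') as [L3 L4]; [intros u Hu; apply Hall; lra |].
    assert (Hx := Hexc t Ht' L3 L4).
    assert (Hx0 : 0 < excess r1 rho1 t).
    { apply (excess_pos B1 Hlo); [lra |]. apply Hlt1. unfold ss in *. lra. }
    assert (J1 := HN1 t Ht'). assert (J2 := HN2 t Ht'). assert (J3 := HY1 t Ht').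
    assert (J4 := HY2 t Ht'). assert (J5 := proj1 (Hy1 t Ht')).
    assert (HNN := proj1 (Hpsi t Ht') (Hall t Ht')).
    assert (Hy1t : y1 t < 1) by (apply Hlt1; unfold ss in *; lra).
    assert (I : 0 <= N2 (sg t) * Y1 t - N1 t * Y2 (sg t)).
    { destruct (Hsg t Ht') as [_ Hse]. unfold steepening. rewrite Hse.
      replace (N2 (sg t) * (y1 t * y1 t - y1 t + N1 t) - N1 t * (y1 t * y1 t - y1 t + N2 (sg t)))
        with ((y1 t - y1 t * y1 t) * (N1 t - N2 (sg t))) by ring.
      apply Rmult_le_pos; [nra | lra]. }
    replace (- (N1 t / (t * y1 t) * excess r1 rho1 t) -
      - (N2 (sg t) / (t * y1 t) * excess r2 rho2 (sg t) * (Y1 t / Y2 (sg t)))) with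
      ((excess r2 rho2 (sg t) * (N2 (sg t) * Y1 t) - excess r1 rho1 t * (N1 t * Y2 (sg t))) *
       / (t * y1 t * Y2 (sg t))) by (field; repeat split; lra).
    apply Rmult_le_pos.
    + assert (I1 : 0 < N2 (sg t) * Y1 t) by now apply Rmult_lt_0_compat.
      assert (I2 := Rmult_le_compat_r _ _ _ (Rlt_le _ _ I1) Hx).
      assert (I3 := Rmult_le_pos _ _ (Rlt_le _ _ Hx0) I). lra.
    + apply Rlt_le, Rinv_0_lt_compat.
      apply Rmult_lt_0_compat; [apply Rmult_lt_0_compat; lra | assumption].
Qed.
End Matching.
End Slope.

(** * Solutions as functions of the radius *)

(** The conditions at r = 0 are one-sided limits, since q' / q is singular there. *)
Record motion (c : Rbar) (q dq f : R -> R) (v dv : R -> R) : Prop := {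
  mo_dom : forall r, 0 <= r -> in_dom c (v r);
  mo_der : forall r, 0 < r -> is_derive v r (dv r);
  mo_acc : forall r, 0 < r -> is_derive dv r (- (dq r / q r * dv r) - f (v r));
  mo_start : filterlim v (at_right 0) (locally (v 0));
  mo_rest : filterlim dv (at_right 0) (locally 0);
  mo_lim : is_lim v p_infty 0
}.
Arguments mo_dom {c q dq f v dv}.
Arguments mo_der {c q dq f v dv}.
Arguments mo_acc {c q dq f v dv}.
Arguments mo_start {c q dq f v dv}.
Arguments mo_rest {c q dq f v dv}.
Arguments mo_lim {c q dq f v dv}.

(** On a branch this is [energy], as a function of the radius. *)
Definition total (F v dv : R -> R) (r : R) : R := dv r * dv r / 2 + F (v r).

(** In the second case the solution comes to rest at 0 in finite radius, which is
    possible as f need not be Lipschitz at 0. *)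
Inductive ending (beta : R) (v dv : R -> R) (t : R) (T : Rbar) : Prop :=
  | never_stops : T = p_infty -> ending beta v dv t T
  | stops_at_zero (R0 : R) : T = Finite R0 -> t < R0 -> dv R0 = 0 ->
      (forall r, R0 <= r -> v r = 0) -> ending beta v dv t T
  | turns_below (R0 : R) : T = Finite R0 -> t < R0 -> dv R0 = 0 -> v R0 < - beta ->
      ending beta v dv t T.

(** (r, rho) is the branch of v over the phase (t, T) of decrease. *)
Definition tracks (v dv : R -> R) (t : R) (T : Rbar) (lo hi : R) (r rho : R -> R) : Prop :=
  forall s, lo < s < hi -> t < r s /\ Rbar_lt (r s) T /\ v (r s) = s /\ rho s = - dv (r s).

Section Motion.
Context {c : Rbar} {q dq Q H f F : R -> R} {Hinf b beta : R}.
Context (Wt : weight q dq Q H Hinf) (Fo : force c f F b beta).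
Context (HF0 : F 0 = 0).
Context (Hwinf : forall K, exists M, 0 < M /\ forall r, M < r -> K < q r).
Context (Hcinf : forall eps, 0 < eps -> exists M, 0 < M /\ forall r, M < r -> Q r / (q r * q r) < eps).

Lemma motion_opp (v dv : R -> R) : motion c q dq f v dv ->
  motion c q dq f (fun r => - v r) (fun r => - dv r).
Proof.
  intros M. constructor.
  - intros r Hr. apply in_dom_opp, (mo_dom M r Hr).
  - intros r Hr. apply (is_derive_opp v), (mo_der M r Hr).
  - intros r Hr. eapply is_derive_value.
    + apply (is_derive_opp dv), (mo_acc M r Hr).
    + rewrite (fo_odd Fo) by (apply (mo_dom M); lra). unfold opp; simpl. ring.
  - apply lim_opp, (mo_start M).
  - replace 0 with (- 0) at 2 by ring. apply lim_opp, (mo_rest M).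
  - replace (Finite 0) with (Rbar_opp 0) by (simpl; f_equal; ring).
    apply is_lim_opp, (mo_lim M).
Qed.

Section OneMotion.
Context {v dv : R -> R} (M : motion c q dq f v dv).

Local Notation Etot := (total F v dv).

Lemma total_derive (r : R) : 0 < r -> is_derive Etot r (- (dq r / q r * (dv r * dv r))).
Proof.
  intros Hr. unfold Etot. eapply is_derive_value.
  - apply derive_plus.
    + apply derive_div_const, derive_mult; apply (mo_acc M r Hr).
    + apply (derive_comp F v); [apply (fo_prim Fo), (mo_dom M); lra | apply (mo_der M r Hr)].
  - field. apply Rgt_not_eq, (w_pos Wt r Hr).
Qed.

Lemma total_nonincreasing (x y : R) : 0 < x -> x <= y -> Etot y <= Etot x.
Proof.
  intros Hx Hxy. apply (nonincreasing_of_derive Etot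
    (fun r => - (dq r / q r * (dv r * dv r)))); [assumption | |].
  - intros z Hz. apply total_derive. lra.
  - intros z Hz. assert (0 <= dq z / q z * (dv z * dv z)); [| lra].
    apply Rmult_le_pos; [| nra].
    apply Rlt_le, Rdiv_lt_0_compat; [apply (w_dpos Wt) | apply (w_pos Wt)]; lra.
Qed.

Lemma eventually_close (eps : R) : 0 < eps -> exists X, forall r, X < r -> Rabs (v r) < eps.
Proof.
  intros Heps. assert (L := mo_lim M).
  apply is_lim_spec in L. destruct (L (mkposreal eps Heps)) as [X HX].
  exists X. intros r Hr. specialize (HX r Hr). simpl in HX. now rewrite Rminus_0_r in HX.
Qed.

(** The total energy decreases, and its potential part tends to F (0) = 0. *)
Lemma total_nonneg (r : R) : 0 < r -> 0 <= Etot r.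
Proof.
  intros Hr. apply Rnot_lt_le. intros Hneg.
  assert (Hd0 : in_dom c 0).
  { unfold in_dom. apply Rbar_le_lt_trans with (Rabs beta); [| apply (fo_dom Fo)].
    simpl. rewrite Rabs_R0. apply Rabs_pos. }
  assert (HFc : continuous F 0) by (eapply is_derive_continuous, (fo_prim Fo 0 Hd0)).
  destruct (continuous_pos_near (fun s => F s - Etot r) 0) as (d & Hd & Hn).
  - apply (continuous_minus F (fun _ => Etot r)); [assumption | apply continuous_const].
  - rewrite HF0. lra.
  - destruct (eventually_close d Hd) as [X HX].
    set (y := Rmax (X + 1) r).
    assert (Hy1 : X + 1 <= y) by apply Rmax_l. assert (Hy2 : r <= y) by apply Rmax_r.
    assert (A := HX y ltac:(lra)).
    assert (C := Hn (v y) ltac:(now rewrite Rminus_0_r)).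
    assert (D := total_nonincreasing r y Hr Hy2). unfold Etot at 1 in D. nra.
Qed.

(** The total energy vanishes from r0 on, hence so does its derivative - (q' / q)
    v'^2. *)
Lemma rest_forever (r0 : R) : 0 < r0 -> Etot r0 <= 0 -> forall r, r0 <= r -> v r = 0.
Proof.
  intros Hr0 HE.
  assert (HT : forall r, r0 <= r -> Etot r = 0).
  { intros r Hr. assert (A := total_nonincreasing r0 r Hr0 Hr).
    assert (C := total_nonneg r ltac:(lra)). lra. }
  assert (Hdv : forall r, r0 < r -> dv r = 0).
  { intros r Hr.
    assert (D0 : is_derive Etot r 0).
    { apply (is_derive_ext_loc (fun _ => 0)); [| apply (is_derive_const (V := R_NormedModule) 0)].
      exists (mkposreal (r - r0) ltac:(lra)). intros z Hz. unfold ball in Hz; simpl in Hz.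
      apply Rabs_lt_between in Hz. unfold minus, plus, opp in Hz; simpl in Hz.
      symmetry. apply HT. lra. }
    assert (E := is_derive_unique _ _ _ D0).
    rewrite (is_derive_unique _ _ _ (total_derive r ltac:(lra))) in E.
    assert (0 < dq r / q r) by (apply Rdiv_lt_0_compat; [apply (w_dpos Wt) | apply (w_pos Wt)]; lra).
    apply Rsqr_0_uniq. unfold Rsqr. apply (Rmult_eq_reg_l (dq r / q r)); lra. }
  assert (Hconst : forall x y, r0 <= x -> x < y -> v x = v y).
  { intros x y Hx Hxy. apply Rle_antisym.
    - apply (nondecreasing_of_derive v dv); [lra | |].
      + intros z Hz. apply (mo_der M). lra.
      + intros z Hz. rewrite Hdv; lra.
    - apply (nonincreasing_of_derive v dv); [lra | |].
      + intros z Hz. apply (mo_der M). lra.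
      + intros z Hz. rewrite Hdv; lra. }
  intros r Hr. destruct (Req_dec (v r) 0) as [| Hne]; [assumption | exfalso].
  destruct (eventually_close (Rabs (v r)) (Rabs_pos_lt _ Hne)) as [X HX].
  set (y := Rmax (X + 1) (r + 1)).
  assert (Hy1 : X + 1 <= y) by apply Rmax_l. assert (Hy2 : r + 1 <= y) by apply Rmax_r.
  assert (A := HX y ltac:(lra)). rewrite <- (Hconst r y) in A by lra. lra.
Qed.

Lemma motion_flux_derive (r : R) : 0 < r -> is_derive (fun x => q x * dv x) r (- (q r * f (v r))).
Proof.
  intros Hr. eapply is_derive_value.
  - apply derive_mult; [apply (w_der Wt r Hr) | apply (mo_acc M r Hr)].
  - field. apply Rgt_not_eq, (w_pos Wt r Hr).
Qed.

Lemma motion_continuous (r : R) : 0 < r -> continuous v r.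
Proof. intros Hr. eapply is_derive_continuous, (mo_der M r Hr). Qed.
Lemma motion_speed_continuous (r : R) : 0 < r -> continuous dv r.
Proof. intros Hr. eapply is_derive_continuous, (mo_acc M r Hr). Qed.

Section Phase.
Context {t mu : R} (Ht : 0 <= t) (Hmu : beta < mu).
Context (Hv : filterlim v (at_right t) (locally mu)) (Hdv : filterlim dv (at_right t) (locally 0)).

Lemma flux_lim_start : filterlim (fun r => q r * dv r) (at_right t) (locally 0).
Proof.
  assert (Q1 : 0 < q (t + 1)) by (apply (w_pos Wt); lra).
  intros P [eps Heps].
  assert (He : 0 < eps / q (t + 1)) by (apply Rdiv_lt_0_compat; [apply cond_pos | assumption]).
  assert (A : at_right t (fun r => Rabs (dv r) < eps / q (t + 1))).
  { apply (Hdv (fun z => Rabs z < eps / q (t + 1))).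
    exists (mkposreal _ He). intros z Hz. unfold ball in Hz; simpl in Hz.
    unfold AbsRing_ball, abs, minus, plus, opp in Hz; simpl in Hz.
    now rewrite Ropp_0, Rplus_0_r in Hz. }
  assert (C : at_right t (fun r => t < r < t + 1)) by (apply at_right_interval; lra).
  change (at_right t (fun r => P (q r * dv r))).
  generalize (filter_and _ _ A C). apply filter_imp. intros r [X Z].
  apply Heps. unfold ball; simpl. unfold AbsRing_ball, abs, minus, plus, opp; simpl.
  rewrite Ropp_0, Rplus_0_r, Rabs_mult.
  assert (Qr : 0 < q r) by (apply (w_pos Wt); lra).
  assert (Qle : q r <= q (t + 1)) by (apply (weight_monotone Wt); lra).
  rewrite (Rabs_pos_eq (q r)) by lra.
  apply Rle_lt_trans with (q (t + 1) * Rabs (dv r)).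
  - apply Rmult_le_compat_r; [apply Rabs_pos | assumption].
  - apply Rlt_le_trans with (q (t + 1) * (eps / q (t + 1))).
    + apply Rmult_lt_compat_l; assumption.
    + apply Req_le. field. lra.
Qed.

(** The flux q v' starts from 0 and decreases while v > beta. *)
Lemma falls_at_start : exists d, 0 < d /\ forall r, t < r < t + d -> dv r < 0.
Proof.
  assert (Hb := fo_b Fo).
  assert (A := lim_gt (Fl := at_right t) v mu beta Hv Hmu).
  destruct A as [d Hd]. exists d. split; [apply cond_pos |]. intros r Hr.
  assert (Hfp : forall z, t < z < t + d -> 0 < f (v z)).
  { intros z Hz. apply (fo_pos Fo); [| apply (mo_dom M); lra].
    assert (beta < v z); [| lra].
    apply Hd; [| lra]. unfold ball; simpl. apply Rabs_lt_between.
    unfold minus, plus, opp; simpl. lra. }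
  assert (Hdec : forall x y, t < x -> x < y -> y < t + d -> q y * dv y < q x * dv x).
  { intros x y Hx Hxy Hy.
    assert (- (q x * dv x) < - (q y * dv y)); [| lra].
    apply (increasing_of_derive (fun z => - (q z * dv z)) (fun z => - - (q z * f (v z))));
      [assumption | |].
    - intros z Hz. apply (is_derive_opp (fun z => q z * dv z)), motion_flux_derive. lra.
    - intros z Hz. rewrite Ropp_involutive. apply Rmult_lt_0_compat; [apply (w_pos Wt) | apply Hfp]; lra. }
  set (m := (t + r) / 2).
  assert (W1 : q r * dv r < q m * dv m) by (apply Hdec; unfold m; lra).
  assert (W2 : q m * dv m <= 0).
  { apply (lim_le (Fl := at_right t) (fun _ => q m * dv m) (fun r => q r * dv r));
      [apply filterlim_const | apply flux_lim_start |].
    apply (filter_imp (fun z => t < z < m)); [| apply at_right_interval; unfold m; lra].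
    intros z Hz. apply Rlt_le, Hdec; unfold m in *; lra. }
  assert (0 < q r) by (apply (w_pos Wt); lra). nra.
Qed.

(** At the first zero R0 of v' the total energy is F (v (R0)). If |v (R0)| <= beta it
    is nonpositive and [rest_forever] applies; v (R0) > beta would contradict the
    decrease of the flux. *)
Lemma phase_ends : exists T : Rbar, Rbar_lt t T /\
  (forall r, t < r -> Rbar_lt r T -> dv r < 0) /\ ending beta v dv t T.
Proof.
  assert (Hb := fo_b Fo).
  destruct falls_at_start as (d & Hd & Hfall).
  destruct (classic (forall r, t < r -> dv r < 0)) as [Hall | Hnot].
  { exists p_infty. split; [exact I |]. split; [intros r Hr _; now apply Hall |].
    now apply never_stops. }
  apply not_all_ex_not in Hnot. destruct Hnot as [r1 Hr1].
  apply imply_to_and in Hr1. destruct Hr1 as [Hr1 Hn]. apply Rnot_lt_le in Hn.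
  assert (Hr1d : t + d <= r1).
  { apply Rnot_lt_le. intros Hc. assert (dv r1 < 0) by (apply Hfall; lra). lra. }
  destruct (lowest_zero (fun r => - dv r) (t + d / 2) r1) as (R0 & HR & H0 & Hbelow).
  - lra.
  - intros z Hz. apply (continuous_opp dv), motion_speed_continuous. lra.
  - assert (dv (t + d / 2) < 0) by (apply Hfall; lra). lra.
  - lra.
  - assert (HR0 : dv R0 = 0) by lra.
    assert (Hneg : forall r, t < r -> r < R0 -> dv r < 0).
    { intros r Ha Hc. destruct (Rlt_or_le r (t + d / 2)); [apply Hfall; lra |].
      assert (0 < - dv r) by (apply Hbelow; lra). lra. }
    exists (Finite R0). split; [simpl; lra |]. split; [intros r Ha Hc; now apply Hneg |].
    assert (Etot : Etot R0 = F (v R0)) by (unfold Etot; rewrite HR0; field).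
    destruct (Rle_or_lt (Rabs (v R0)) beta) as [Hsmall | Hbig].
    + apply (stops_at_zero _ _ _ _ _ R0); [reflexivity | lra | assumption |].
      apply rest_forever; [lra |]. rewrite Etot. now apply (fo_Fnonpos Fo).
    + destruct (Rle_or_lt 0 (v R0)) as [Hp | Hp].
      * exfalso. rewrite Rabs_pos_eq in Hbig by assumption.
        destruct (continuous_pos_near (fun r => v r - beta) R0) as (e & He & Hn').
        { apply (continuous_minus v (fun _ => beta)); [apply motion_continuous; lra | apply continuous_const]. }
        { lra. }
        set (x := Rmax ((t + R0) / 2) (R0 - e / 2)).
        assert (X1 : (t + R0) / 2 <= x) by apply Rmax_l.
        assert (X2 : R0 - e / 2 <= x) by apply Rmax_r.
        assert (X3 : x < R0) by (apply Rmax_lub_lt; lra).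
        assert (Hflux : - (q x * dv x) < - (q R0 * dv R0)).
        { apply (increasing_of_derive (fun z => - (q z * dv z)) (fun z => - - (q z * f (v z))));
            [assumption | |].
          - intros z Hz. apply (is_derive_opp (fun z => q z * dv z)), motion_flux_derive. lra.
          - intros z Hz. rewrite Ropp_involutive.
            apply Rmult_lt_0_compat; [apply (w_pos Wt); lra |].
            apply (fo_pos Fo); [| apply (mo_dom M); lra].
            assert (0 < v z - beta) by (apply Hn', Rabs_lt_between; lra). lra. }
        rewrite HR0 in Hflux. assert (dv x < 0) by (apply Hneg; lra).
        assert (0 < q x) by (apply (w_pos Wt); lra). nra.
      * apply (turns_below _ _ _ _ _ R0); [reflexivity | lra | assumption |].
        rewrite Rabs_left in Hbig by assumption. lra.
Qed.

Section Profile.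
Context {T : Rbar} (HtT : Rbar_lt t T) (Hneg : forall r, t < r -> Rbar_lt r T -> dv r < 0).

Lemma phase_falls (x y : R) : t < x -> x < y -> Rbar_lt y T -> v y < v x.
Proof.
  apply (strictly_decreasing_of_derive v dv t T).
  intros z Hz HzT. split; [apply (mo_der M); lra | now apply Hneg].
Qed.

Lemma below_start (x : R) : t < x -> Rbar_lt x T -> v x < mu.
Proof.
  intros Hx HxT. set (m := (t + x) / 2).
  assert (HmT : Rbar_lt m T) by (apply Rbar_lt_trans with x; [unfold m; simpl; lra | assumption]).
  apply Rlt_le_trans with (v m); [apply phase_falls; unfold m in *; try assumption; lra |].
  apply (lim_le (Fl := at_right t) (fun _ => v m) v); [apply filterlim_const | assumption |].
  apply (filter_imp (fun z => t < z < m)); [| apply at_right_interval; unfold m; lra].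
  intros z Hz. apply Rlt_le, phase_falls; [lra | lra | assumption].
Qed.

Local Notation tracks lo r rho := (tracks v dv t T lo mu r rho).

Lemma profile (lo : R) : lo < mu ->
  (forall s, lo < s < mu -> exists x, t < x /\ Rbar_lt x T /\ v x < s) ->
  exists r rho, branch c q dq f F lo mu r rho /\ tracks lo r rho.
Proof.
  intros Hlo Hreach.
  destruct (inverse_of_decreasing v dv t T lo mu) as [r Hr].
  - intros x Hx HxT. split; [apply (mo_der M); lra | now apply Hneg].
  - intros s Hs. destruct (Hreach s Hs) as (x & Hx & HxT & Hxs).
    destruct (filter_ex (F := at_right t) (fun z => t < z < x /\ s < v z)) as (z & Hz & Hzs).
    { apply filter_and; [now apply at_right_interval |].
      apply (lim_gt (Fl := at_right t) v mu); [assumption | lra]. }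
    destruct (lowest_zero (fun y => v y - s) z x) as (y & Hy & H0 & _); try lra.
    + intros u Hu. apply (continuous_minus v (fun _ => s)); [apply motion_continuous; lra | apply continuous_const].
    + exists y. split; [lra |]. split; [| lra].
      apply Rbar_le_lt_trans with x; [simpl; lra | assumption].
  - exists r, (fun s => - dv (r s)).
    assert (Hpos : forall s, lo < s < mu -> 0 < r s /\ 0 < - dv (r s)).
    { intros s Hs. destruct (Hr s Hs) as (A & C & _). assert (D := Hneg _ A C). lra. }
    split; [constructor |].
    + intros s Hs. destruct (Hr s Hs) as (A & _ & D & _). rewrite <- D. apply (mo_dom M). lra.
    + intros s Hs. apply (Hpos s Hs).
    + intros s Hs. apply (Hpos s Hs).
    + intros s Hs. destruct (Hr s Hs) as (_ & _ & _ & D). destruct (Hpos s Hs).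
      eapply is_derive_value; [exact D |]. field. lra.
    + intros s Hs. destruct (Hr s Hs) as (_ & _ & E & D). destruct (Hpos s Hs).
      assert (Hq := w_pos Wt (r s) ltac:(lra)).
      eapply is_derive_value.
      * apply (is_derive_opp (fun s => dv (r s))).
        apply (derive_comp dv r); [apply (mo_acc M); lra | exact D].
      * rewrite E. unfold opp; simpl. field. lra.
    + intros s Hs. destruct (Hr s Hs) as (A & C & E & _). destruct (Hpos s Hs).
      unfold energy. replace (- dv (r s) * - dv (r s) / 2 + F s) with (Etot (r s))
        by (unfold Etot; rewrite E; field).
      apply Rnot_le_lt. intros Hle.
      assert (Hz := rest_forever (r s) ltac:(lra) Hle).
      assert (Hex : exists x, r s < x /\ Rbar_lt x T).
      { destruct T as [T0 | |]; simpl in *; [| | easy].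
        - exists ((r s + T0) / 2). lra.
        - exists (r s + 1). split; [lra | exact I]. }
      destruct Hex as (x & Hx & HxT).
      assert (D := phase_falls (r s) x A Hx HxT). rewrite !Hz in D by lra. lra.
    + intros s Hs. destruct (Hr s Hs) as (A & C & D & _). now repeat split.
Qed.

Lemma tracks_before (lo : R) (r rho : R -> R) : tracks lo r rho ->
  forall s x, lo < s < mu -> t < x -> x < r s -> s < v x.
Proof.
  intros Htr s x Hs Hx Hxr. destruct (Htr s Hs) as (A & C & D & _).
  rewrite <- D. now apply phase_falls.
Qed.

Lemma tracks_after (lo : R) (r rho : R -> R) : tracks lo r rho ->
  forall s x, lo < s < mu -> t < x -> Rbar_lt x T -> s < v x -> x < r s.
Proof.
  intros Htr s x Hs Hx HxT Hsv. destruct (Htr s Hs) as (A & C & D & _).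
  apply Rnot_le_lt. intros [Hc | Hc].
  - assert (v x < v (r s)) by now apply phase_falls. lra.
  - rewrite Hc in D. lra.
Qed.

Lemma profile_starts (lo : R) (r rho : R -> R) : lo < mu -> tracks lo r rho ->
  rests (at_left mu) r rho t.
Proof.
  intros Hlo Htr.
  assert (Hr : filterlim r (at_left mu) (at_right t)).
  { intros P [d HP].
    assert (Hex : exists x, t < x < t + d /\ Rbar_lt x T).
    { assert (Hdp := cond_pos d). destruct T as [T0 | |]; simpl in *; [| | easy].
      - exists (Rmin ((t + T0) / 2) (t + d / 2)).
        assert (A := Rmin_l ((t + T0) / 2) (t + d / 2)).
        assert (C := Rmin_r ((t + T0) / 2) (t + d / 2)).
        assert (t < Rmin ((t + T0) / 2) (t + d / 2)) by (apply Rmin_glb_lt; lra).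
        split; simpl; lra.
      - exists (t + d / 2). split; [lra | exact I]. }
    destruct Hex as (x & Hx & HxT). assert (Hvx := below_start x ltac:(lra) HxT).
    change (at_left mu (fun s => P (r s))).
    apply (filter_imp (fun s => Rmax lo (v x) < s < mu)).
    - intros s Hs. assert (A := Rmax_l lo (v x)). assert (C := Rmax_r lo (v x)).
      assert (Hs' : lo < s < mu) by lra. destruct (Htr s Hs') as (D & E & G & _).
      apply HP; [| assumption].
      assert (r s < x).
      { apply Rnot_le_lt. intros [Hc | Hc].
        - assert (v (r s) < v x) by (apply phase_falls; [lra | assumption | assumption]). lra.
        - rewrite <- Hc in G. lra. }
      unfold ball; simpl. apply Rabs_lt_between. unfold minus, plus, opp; simpl. lra.
    - apply at_left_interval. apply Rmax_lub_lt; lra. }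
  split.
  - intros P HP. apply Hr. destruct HP as [d Hd]. exists d. intros z Hz _. now apply Hd.
  - apply (filterlim_ext_loc (fun s => - dv (r s))).
    + apply (filter_imp (fun s => lo < s < mu)); [| now apply at_left_interval].
      intros s Hs. destruct (Htr s Hs) as (_ & _ & _ & D). now rewrite D.
    + replace 0 with (- 0) by ring. apply lim_opp.
      exact (filterlim_comp _ _ _ r dv _ _ _ Hr Hdv).
Qed.

Lemma tracked_energy (lo : R) (r rho : R -> R) : tracks lo r rho ->
  forall s, lo < s < mu -> energy F rho s = Etot (r s).
Proof.
  intros Htr s Hs. destruct (Htr s Hs) as (_ & _ & E & D).
  unfold energy, total. rewrite D, E. field.
Qed.

(** On levels below beta, where F <= 0, q^2 E stays bounded, and so does the flux on
    levels below b, where f <= 0; moreover q tends to infinity and Q / q^2 to 0. *)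
Lemma decays_at_infinity (r rho : R -> R) : T = p_infty ->
  branch c q dq f F 0 mu r rho -> tracks 0 r rho -> decays q Q F r rho.
Proof.
  intros HT Br Htr eps Heps. assert (Hb := fo_b Fo).
  set (K := q (r beta) * q (r beta) * energy F rho beta).
  set (K2 := q (r b) * rho b).
  assert (Hqr : forall s, 0 < s < mu -> 0 < q (r s)).
  { intros s Hs. apply (w_pos Wt), (br_r Br s Hs). }
  assert (HK : 0 < K).
  { assert (0 < q (r beta)) by (apply Hqr; lra).
    repeat apply Rmult_lt_0_compat; try assumption. apply (br_energy Br). lra. }
  assert (HK2 : 0 < K2).
  { apply Rmult_lt_0_compat; [apply Hqr | apply (br_rho Br)]; lra. }
  assert (HqK : forall s, 0 < s <= beta -> q (r s) * q (r s) * energy F rho s <= K).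
  { intros s Hs. apply (nondecreasing_of_derive (fun t => q (r t) * q (r t) * energy F rho t)
      (fun t => - (2 * (dq (r t) * q (r t)) * F t / rho t))); [lra | |].
    - intros z Hz. apply (weight_sq_energy_derive Wt Fo Br). lra.
    - intros z Hz. assert (HF := fo_Fnonpos Fo z ltac:(apply Rabs_le; lra)).
      assert (0 < dq (r z) * q (r z)).
      { apply Rmult_lt_0_compat; [apply (w_dpos Wt), (br_r Br); lra | apply Hqr; lra]. }
      assert (0 < / rho z) by (apply Rinv_0_lt_compat, (br_rho Br); lra).
      replace (- (2 * (dq (r z) * q (r z)) * F z / rho z)) with
        (2 * (dq (r z) * q (r z)) * / rho z * - F z) by (unfold Rdiv; ring).
      apply Rmult_le_pos; [| lra]. apply Rmult_le_pos; lra. }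
  assert (HwK : forall s, 0 < s <= b -> q (r s) * rho s <= K2).
  { intros s Hs. apply (nondecreasing_of_derive (fun t => q (r t) * rho t)
      (fun t => - (q (r t) * f t / rho t))); [lra | |].
    - intros z Hz. apply (flux_derive Wt Br). lra.
    - intros z Hz. assert (Hf := fo_nonpos Fo z ltac:(lra)).
      assert (0 < q (r z)) by (apply Hqr; lra).
      assert (0 < / rho z) by (apply Rinv_0_lt_compat, (br_rho Br); lra).
      replace (- (q (r z) * f z / rho z)) with (q (r z) * / rho z * - f z) by (unfold Rdiv; ring).
      apply Rmult_le_pos; [| lra]. apply Rmult_le_pos; lra. }
  set (e := Rmin 1 (Rmin (eps / (K + 1)) (eps / (K2 + 1)))).
  assert (He : 0 < e).
  { repeat apply Rmin_pos; [lra | |]; apply Rdiv_lt_0_compat; lra. }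
  assert (He1 : e <= 1) by apply Rmin_l.
  assert (HeK : e * (K + 1) <= eps).
  { apply Rle_trans with (eps / (K + 1) * (K + 1)); [| apply Req_le; field; lra].
    apply Rmult_le_compat_r; [lra |].
    eapply Rle_trans; [apply Rmin_r | apply Rmin_l]. }
  assert (HeK2 : e * (K2 + 1) <= eps).
  { apply Rle_trans with (eps / (K2 + 1) * (K2 + 1)); [| apply Req_le; field; lra].
    apply Rmult_le_compat_r; [lra |].
    eapply Rle_trans; [apply Rmin_r | apply Rmin_r]. }
  destruct (Hwinf (K / eps)) as (M1 & HM1 & HM1').
  destruct (Hcinf e He) as (M2 & HM2 & HM2').
  set (x := Rmax (t + 1) (Rmax M1 M2)).
  assert (Hx1 : t + 1 <= x) by apply Rmax_l.
  assert (Hx2 : M1 <= x) by (eapply Rle_trans; [apply Rmax_l | apply Rmax_r]).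
  assert (Hx3 : M2 <= x) by (eapply Rle_trans; [apply Rmax_r | apply Rmax_r]).
  assert (HTx : forall y : R, Rbar_lt y T) by (intros y; rewrite HT; exact I).
  assert (Hvx : 0 < v x).
  { apply Rnot_le_lt. intros Hle.
    assert (Hlt : v (x + 1) < v x) by (apply phase_falls; [lra | lra | apply HTx]).
    destruct (eventually_close (- v (x + 1)) ltac:(lra)) as [X HX].
    set (y := Rmax (X + 1) (x + 2)).
    assert (Hy1 : X + 1 <= y) by apply Rmax_l. assert (Hy2 : x + 2 <= y) by apply Rmax_r.
    assert (A := HX y ltac:(lra)).
    assert (C : v y < v (x + 1)) by (apply phase_falls; [lra | lra | apply HTx]).
    apply Rabs_lt_between in A. lra. }
  exists (Rmin b (v x)). split; [apply Rmin_pos; lra |]. intros s Hs.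
  assert (Hs1 := Rmin_l b (v x)). assert (Hs2 := Rmin_r b (v x)).
  assert (Hs' : 0 < s < mu) by lra.
  assert (Hrs : x < r s) by (apply (tracks_after 0 r rho Htr s x Hs'); [lra | apply HTx | lra]).
  assert (Hq := Hqr s Hs'). assert (HqM := HM1' (r s) ltac:(lra)).
  assert (HcM := HM2' (r s) ltac:(lra)).
  assert (HKs := HqK s ltac:(lra)). assert (HK2s := HwK s ltac:(lra)).
  assert (Hc0 : 0 < Q (r s) / (q (r s) * q (r s))).
  { apply Rdiv_lt_0_compat; [apply (w_primpos Wt), (br_r Br s Hs') | now apply Rmult_lt_0_compat]. }
  assert (HE := br_energy Br s Hs'). assert (Hrho := br_rho Br s Hs').
  assert (HqE : 0 < q (r s) * q (r s) * energy F rho s)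
    by (apply Rmult_lt_0_compat; [now apply Rmult_lt_0_compat | assumption]).
  assert (Hw0 : 0 < q (r s) * rho s) by now apply Rmult_lt_0_compat.
  set (cc := Q (r s) / (q (r s) * q (r s))) in *.
  split; [| split].
  - apply Rmult_lt_reg_l with (q (r s)); [assumption |].
    apply Rle_lt_trans with K; [rewrite <- Rmult_assoc; assumption |].
    apply (Rmult_lt_compat_r eps) in HqM; [| assumption].
    unfold Rdiv in HqM. rewrite Rmult_assoc, Rinv_l in HqM; lra.
  - replace (Q (r s) / q (r s) * rho s) with (cc * (q (r s) * rho s)) by (unfold cc; field; lra).
    apply Rle_lt_trans with (cc * K2); [apply Rmult_le_compat_l; lra |]. nra.
  - replace (Q (r s) / q (r s) * (Q (r s) / q (r s)) * energy F rho s) with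
      (cc * cc * (q (r s) * q (r s) * energy F rho s)) by (unfold cc; field; lra).
    apply Rle_lt_trans with (cc * cc * K); [apply Rmult_le_compat_l; nra |].
    assert (cc * cc <= cc) by nra. nra.
Qed.

(** The three quantities are continuous at the end, where speed and energy vanish. *)
Lemma decays_at_finite_end (R0 : R) (r rho : R -> R) : T = Finite R0 -> dv R0 = 0 -> v R0 = 0 ->
  branch c q dq f F 0 mu r rho -> tracks 0 r rho -> decays q Q F r rho.
Proof.
  intros HT Hd0 Hv0 Br Htr eps Heps. rewrite HT in HtT. simpl in HtT.
  assert (HR0 : 0 < R0) by lra.
  assert (Hq0 := w_pos Wt R0 HR0).
  assert (Hqc : continuous q R0) by (eapply is_derive_continuous, (w_der Wt R0 HR0)).
  assert (Hac : continuous (fun x => Q x / q x) R0)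
    by (eapply is_derive_continuous, (weight_ratio_derive Wt R0 HR0)).
  assert (Htc : continuous Etot R0) by (eapply is_derive_continuous, (total_derive R0 HR0)).
  assert (Ht0 : Etot R0 = 0) by (unfold total; rewrite Hd0, Hv0, HF0; field).
  assert (Hdc := motion_speed_continuous R0 HR0).
  assert (Hmul : forall g k : R -> R, continuous g R0 -> continuous k R0 ->
    continuous (fun x => g x * k x) R0).
  { intros g k Hg Hk. apply (continuous_mult g k); assumption. }
  assert (Hsm : forall g : R -> R, continuous g R0 -> g R0 = 0 ->
    exists d, 0 < d /\ forall x, Rabs (x - R0) < d -> g x < eps).
  { intros g Hg Hg0. destruct (continuous_pos_near (fun x => eps - g x) R0) as (d & Hd & Hn).
    - apply (continuous_minus (fun _ => eps) g); [apply continuous_const | assumption].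
    - lra.
    - exists d. split; [assumption |]. intros x Hx. specialize (Hn x Hx). lra. }
  destruct (Hsm (fun x => q x * Etot x)) as (d1 & Hd1 & Hn1);
    [now apply Hmul | rewrite Ht0; ring |].
  destruct (Hsm (fun x => Q x / q x * - dv x)) as (d2 & Hd2 & Hn2);
    [apply (Hmul (fun x => Q x / q x)); [assumption | now apply (continuous_opp dv)] |
     rewrite Hd0; ring |].
  destruct (Hsm (fun x => Q x / q x * (Q x / q x) * Etot x)) as (d3 & Hd3 & Hn3);
    [apply (Hmul (fun x => Q x / q x * (Q x / q x))); [now apply Hmul | assumption] |
     rewrite Ht0; ring |].
  set (d := Rmin d1 (Rmin d2 d3)).
  assert (Hd : 0 < d) by (repeat apply Rmin_pos; assumption).
  assert (Hdd1 : d <= d1) by apply Rmin_l.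
  assert (Hdd2 : d <= d2) by (eapply Rle_trans; [apply Rmin_r | apply Rmin_l]).
  assert (Hdd3 : d <= d3) by (eapply Rle_trans; [apply Rmin_r | apply Rmin_r]).
  set (x := Rmax ((t + R0) / 2) (R0 - d / 2)).
  assert (X1 : (t + R0) / 2 <= x) by apply Rmax_l.
  assert (X2 : R0 - d / 2 <= x) by apply Rmax_r.
  assert (X3 : x < R0) by (apply Rmax_lub_lt; lra).
  assert (Hvx : 0 < v x).
  { apply Rle_lt_trans with (v ((x + R0) / 2)).
    - rewrite <- Hv0. apply (nonincreasing_of_derive v dv); [lra | |].
      + intros z Hz. apply (mo_der M). lra.
      + intros z Hz. apply Rlt_le, Hneg; [lra | rewrite HT; simpl; lra].
    - apply phase_falls; [lra | lra | rewrite HT; simpl; lra]. }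
  assert (Hvxm : v x < mu) by (apply below_start; [lra | rewrite HT; simpl; lra]).
  exists (v x). split; [assumption |]. intros s Hs.
  assert (Hs' : 0 < s < mu) by lra.
  assert (Hrs : x < r s).
  { apply (tracks_after 0 r rho Htr s x Hs'); [lra | rewrite HT; simpl; lra | lra]. }
  destruct (Htr s Hs') as (A & C & E & D). rewrite HT in C. simpl in C.
  rewrite (tracked_energy 0 r rho Htr s Hs'), D.
  assert (Hcl : Rabs (r s - R0) < d) by (apply Rabs_lt_between; lra).
  split; [| split]; [apply Hn1 | apply Hn2 | apply Hn3]; lra.
Qed.

Lemma profile_turns (R0 : R) (r rho : R -> R) : T = Finite R0 -> dv R0 = 0 -> v R0 < mu ->
  tracks (v R0) r rho -> rests (at_right (v R0)) r rho R0.
Proof.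
  intros HT Hd0 Hv0 Htr. rewrite HT in HtT. simpl in HtT.
  assert (Hr : filterlim r (at_right (v R0)) (locally R0)).
  { intros P [d HP].
    set (x := Rmax ((t + R0) / 2) (R0 - d / 2)). assert (Hdp := cond_pos d).
    assert (X1 : (t + R0) / 2 <= x) by apply Rmax_l.
    assert (X2 : R0 - d / 2 <= x) by apply Rmax_r.
    assert (X3 : x < R0) by (apply Rmax_lub_lt; lra).
    assert (Hvx : v R0 < v x).
    { apply Rle_lt_trans with (v ((x + R0) / 2)).
      - apply (nonincreasing_of_derive v dv); [lra | |].
        + intros z Hz. apply (mo_der M). lra.
        + intros z Hz. apply Rlt_le, Hneg; [lra | rewrite HT; simpl; lra].
      - apply phase_falls; [lra | lra | rewrite HT; simpl; lra]. }
    assert (Hvxm : v x < mu) by (apply below_start; [lra | rewrite HT; simpl; lra]).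
    change (at_right (v R0) (fun s => P (r s))).
    apply (filter_imp (fun s => v R0 < s < v x)); [| now apply at_right_interval].
    intros s Hs. assert (Hs' : v R0 < s < mu) by lra.
    assert (Hrs : x < r s).
    { apply (tracks_after (v R0) r rho Htr s x Hs'); [lra | rewrite HT; simpl; lra | lra]. }
    destruct (Htr s Hs') as (A & C & E & D). rewrite HT in C. simpl in C.
    apply HP. unfold ball; simpl. apply Rabs_lt_between. unfold minus, plus, opp; simpl. lra. }
  split; [assumption |].
  apply (filterlim_ext_loc (fun s => - dv (r s))).
  - apply (filter_imp (fun s => v R0 < s < mu)); [| now apply at_right_interval].
    intros s Hs. destruct (Htr s Hs) as (_ & _ & _ & D). now rewrite D.
  - replace 0 with (- dv R0) by (rewrite Hd0; ring). apply lim_opp.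
    apply lim_continuous; [apply motion_speed_continuous; lra | assumption].
Qed.
End Profile.
End Phase.
End OneMotion.
End Motion.

(** * The shape of a solution *)

Section Shapes.
Context {c : Rbar} {q dq Q H f F : R -> R} {Hinf b beta : R}.
Context (Wt : weight q dq Q H Hinf) (Fo : force c f F b beta).
Context (HF0 : F 0 = 0).
Context (Hwinf : forall K, exists M, 0 < M /\ forall r, M < r -> K < q r).
Context (Hcinf : forall eps, 0 < eps -> exists M, 0 < M /\ forall r, M < r -> Q r / (q r * q r) < eps).
Context {v dv : R -> R} (M : motion c q dq f v dv) (Hv0 : 0 < v 0).

(** Otherwise the energy is nonpositive from the start, and the solution is at rest. *)
Lemma start_above_beta : beta < v 0.
Proof.
  assert (Hb := fo_b Fo).
  assert (Hlim : filterlim (total F v dv) (at_right 0) (locally (F (v 0)))).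
  { replace (F (v 0)) with (0 * (0 * / 2) + F (v 0)) by ring.
    apply (filterlim_ext (fun x => dv x * (dv x * / 2) + F (v x))).
    { intros x. unfold total. field. }
    apply lim_plus.
    - apply lim_mult; [apply (mo_rest M) |]. apply lim_mult; [apply (mo_rest M) | apply filterlim_const].
    - apply lim_continuous; [| apply (mo_start M)].
      eapply is_derive_continuous, (fo_prim Fo), (mo_dom M). lra. }
  assert (Hle : forall r, 0 < r -> total F v dv r <= F (v 0)).
  { intros r Hr. apply (lim_le (Fl := at_right 0) (fun _ => total F v dv r) (total F v dv));
      [apply filterlim_const | assumption |].
    apply (filter_imp (fun z => 0 < z < r)); [| now apply at_right_interval].
    intros z Hz. apply (total_nonincreasing Wt Fo M); lra. }
  apply Rnot_le_lt. intros Hc.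
  assert (HF : F (v 0) <= 0) by (apply (fo_Fnonpos Fo); rewrite Rabs_pos_eq; lra).
  assert (Hz : forall r, 0 < r -> v r = 0).
  { intros r Hr. apply (rest_forever Wt Fo HF0 M r Hr); [| lra]. specialize (Hle r Hr). lra. }
  assert (v 0 <= 0); [| lra].
  apply (lim_le (Fl := at_right 0) v (fun _ => 0)); [apply (mo_start M) | apply filterlim_const |].
  apply (filter_imp (fun z => 0 < z < 1)); [| apply at_right_interval; lra].
  intros z Hz'. rewrite Hz; lra.
Qed.

Lemma decaying_phase {t mu : R} {T : Rbar} : 0 <= t -> beta < mu ->
  filterlim v (at_right t) (locally mu) -> filterlim dv (at_right t) (locally 0) ->
  Rbar_lt t T -> (forall r, t < r -> Rbar_lt r T -> dv r < 0) ->
  (T = p_infty \/ exists R0, T = Finite R0 /\ dv R0 = 0 /\ forall r, R0 <= r -> v r = 0) ->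
  exists r rho, branch c q dq f F 0 mu r rho /\ tracks v dv t T 0 mu r rho /\
    rests (at_left mu) r rho t /\ decays q Q F r rho.
Proof.
  intros Ht Hmu Hlv Hldv HtT Hneg Hend. assert (Hb := fo_b Fo).
  destruct (profile Wt Fo HF0 M Ht Hlv HtT Hneg 0 ltac:(lra)) as (r & rho & Br & Htr).
  { intros s Hs. destruct Hend as [-> | (R0 & -> & Hd & Hz)].
    - destruct (eventually_close M s ltac:(lra)) as [X HX].
      exists (Rmax (X + 1) (t + 1)).
      assert (A := Rmax_l (X + 1) (t + 1)). assert (C := Rmax_r (X + 1) (t + 1)).
      split; [lra |]. split; [exact I |].
      assert (D := HX (Rmax (X + 1) (t + 1)) ltac:(lra)). apply Rabs_lt_between in D. lra.
    - simpl in HtT. destruct (continuous_pos_near (fun x => s - v x) R0) as (d & Hd' & Hn).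
      + apply (continuous_minus (fun _ => s) v); [apply continuous_const | apply (motion_continuous M); lra].
      + rewrite Hz; lra.
      + set (x := Rmax ((t + R0) / 2) (R0 - d / 2)).
        assert (X1 : (t + R0) / 2 <= x) by apply Rmax_l.
        assert (X2 : R0 - d / 2 <= x) by apply Rmax_r.
        assert (X3 : x < R0) by (apply Rmax_lub_lt; lra).
        exists x. split; [lra |]. split; [simpl; lra |].
        assert (0 < s - v x) by (apply Hn, Rabs_lt_between; lra). lra. }
  exists r, rho. split; [assumption |]. split; [assumption |]. split.
  - apply (profile_starts M Ht Hlv Hldv HtT Hneg 0 r rho ltac:(lra) Htr).
  - destruct Hend as [HT | (R0 & HT & Hd & Hz)].
    + eapply (decays_at_infinity Wt Fo Hwinf Hcinf M Ht Hmu Hneg); eassumption.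
    + assert (Hz0 : v R0 = 0) by (apply Hz; lra).
      eapply (decays_at_finite_end Wt Fo HF0 M Ht Hlv HtT Hneg R0); eassumption.
Qed.

Lemma turning_phase {t mu R0 : R} : 0 <= t -> beta < mu ->
  filterlim v (at_right t) (locally mu) -> filterlim dv (at_right t) (locally 0) ->
  t < R0 -> (forall r, t < r -> r < R0 -> dv r < 0) -> dv R0 = 0 -> v R0 < mu ->
  exists r rho, branch c q dq f F (v R0) mu r rho /\ tracks v dv t (Finite R0) (v R0) mu r rho /\
    rests (at_left mu) r rho t /\ rests (at_right (v R0)) r rho R0.
Proof.
  intros Ht Hmu Hlv Hldv HtT Hneg Hd0 HvR. assert (Hb := fo_b Fo).
  assert (HtT' : Rbar_lt t (Finite R0)) by exact HtT.
  assert (Hneg' : forall r, t < r -> Rbar_lt r (Finite R0) -> dv r < 0) by (intros; now apply Hneg).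
  destruct (profile Wt Fo HF0 M Ht Hlv HtT' Hneg' (v R0) HvR) as (r & rho & Br & Htr).
  { intros s Hs. destruct (continuous_pos_near (fun x => s - v x) R0) as (d & Hd' & Hn).
    - apply (continuous_minus (fun _ => s) v); [apply continuous_const | apply (motion_continuous M); lra].
    - lra.
    - set (x := Rmax ((t + R0) / 2) (R0 - d / 2)).
      assert (X1 : (t + R0) / 2 <= x) by apply Rmax_l.
      assert (X2 : R0 - d / 2 <= x) by apply Rmax_r.
      assert (X3 : x < R0) by (apply Rmax_lub_lt; lra).
      exists x. split; [lra |]. split; [simpl; lra |].
      assert (0 < s - v x) by (apply Hn, Rabs_lt_between; lra). lra. }
  exists r, rho. split; [assumption |]. split; [assumption |]. split.
  - apply (profile_starts M Ht Hlv Hldv HtT' Hneg' (v R0) r rho HvR Htr).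
  - eapply (profile_turns M Ht Hlv HtT' Hneg' R0); try eassumption; reflexivity.
Qed.

(** What is kept of the motion itself, for comparisons at equal radius. *)
Definition first_passage (lo : R) (r : R -> R) : Prop :=
  forall s, lo < s < v 0 -> v (r s) = s /\ forall x, 0 < x -> x < r s -> s < v x.

Lemma tracks_first_passage {T : Rbar} {lo : R} {r rho : R -> R} :
  (forall r, 0 < r -> Rbar_lt r T -> dv r < 0) -> tracks v dv 0 T lo (v 0) r rho ->
  first_passage lo r.
Proof.
  intros Hneg Htr s Hs. destruct (Htr s Hs) as (A & C & E & D). split; [assumption |].
  intros x Hx Hxr. exact (tracks_before M (Rle_refl 0) Hneg lo r rho Htr s x Hs Hx Hxr).
Qed.

Lemma nonnegative_profile : (forall r, 0 <= r -> 0 <= v r) ->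
  exists r rho, branch c q dq f F 0 (v 0) r rho /\ first_passage 0 r /\
    rests (at_left (v 0)) r rho 0 /\ decays q Q F r rho.
Proof.
  intros Hnn. assert (Hb := fo_b Fo). assert (Hbv := start_above_beta).
  destruct (phase_ends Wt Fo HF0 M (Rle_refl 0) Hbv (mo_start M) (mo_rest M)) as (T & HtT & Hneg & Hend).
  destruct (decaying_phase (Rle_refl 0) Hbv (mo_start M) (mo_rest M) HtT Hneg)
    as (r & rho & Br & Htr & Hst & Hdec).
  - destruct Hend as [-> | R0 -> HR Hd Hz | R0 -> HR Hd Hv].
    + now left.
    + right. now exists R0.
    + exfalso. assert (0 <= v R0) by (apply Hnn; lra). lra.
  - exists r, rho. split; [assumption |]. split; [| now split].
    exact (tracks_first_passage Hneg Htr).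
Qed.
End Shapes.

Section SignChangingShape.
Context {c : Rbar} {q dq Q H f F : R -> R} {Hinf b beta : R}.
Context (Wt : weight q dq Q H Hinf) (Fo : force c f F b beta).
Context (HF0 : F 0 = 0).
Context (Hwinf : forall K, exists M, 0 < M /\ forall r, M < r -> K < q r).
Context (Hcinf : forall eps, 0 < eps -> exists M, 0 < M /\ forall r, M < r -> Q r / (q r * q r) < eps).
Context {v dv : R -> R} (M : motion c q dq f v dv) (Hv0 : 0 < v 0).

(** The first phase must end below - beta, since otherwise v >= 0 throughout; the next
    phase, that of - v, cannot end in this way, since this would be a second change of
    sign. *)
Lemma sign_changing_profile : one_sign_change v ->
  exists mu t r rho sg sig, beta < mu /\ in_dom c mu /\ 0 < t /\
    branch c q dq f F (- mu) (v 0) r rho /\ first_passage (v := v) (- mu) r /\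
    rests (at_left (v 0)) r rho 0 /\ rests (at_right (- mu)) r rho t /\
    branch c q dq f F 0 mu sg sig /\ rests (at_left mu) sg sig t /\ decays q Q F sg sig.
Proof.
  intros [(x0 & x1 & Hx0 & Hx01 & Hxs) Hno]. assert (Hb := fo_b Fo).
  assert (Hbv := start_above_beta Wt Fo HF0 M Hv0).
  destruct (phase_ends Wt Fo HF0 M (Rle_refl 0) Hbv (mo_start M) (mo_rest M)) as (T & HtT & Hneg & Hend).
  assert (Hdecr : forall x y, 0 < x -> x < y -> Rbar_lt y T -> v y < v x)
    by apply (phase_falls M (Rle_refl 0) Hneg).
  assert (Hnn : (T = p_infty \/ exists R0, T = Finite R0 /\ 0 < R0 /\ forall r, R0 <= r -> v r = 0) ->
    forall r, 0 < r -> 0 <= v r).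
  { intros Hcase r Hr. apply Rnot_lt_le. intros Hlt.
    destruct Hcase as [HT | (R0 & HT & HR0 & Hz)].
    - destruct (eventually_close M (- v r) ltac:(lra)) as [X HX].
      set (y := Rmax (X + 1) (r + 1)).
      assert (Hy1 : X + 1 <= y) by apply Rmax_l. assert (Hy2 : r + 1 <= y) by apply Rmax_r.
      assert (A := HX y ltac:(lra)).
      assert (C : v y < v r) by (apply Hdecr; [lra | lra | rewrite HT; exact I]).
      apply Rabs_lt_between in A. lra.
    - destruct (Rle_or_lt R0 r) as [Hge | Hl]; [rewrite Hz in Hlt; lra |].
      assert (v R0 <= v r); [| rewrite (Hz R0) in *; lra].
      apply (nonincreasing_of_derive v dv); [lra | |].
      + intros z Hz'. apply (mo_der M). lra.
      + intros z Hz'. apply Rlt_le, Hneg; [lra | rewrite HT; simpl; lra]. }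
  assert (Hturn : exists R0, T = Finite R0 /\ 0 < R0 /\ dv R0 = 0 /\ v R0 < - beta).
  { destruct Hend as [HT | R0 HT HR Hd Hz | R0 HT HR Hd Hv].
    - exfalso. assert (A := Hnn (or_introl HT)).
      assert (0 <= v x0) by (apply A; lra). assert (0 <= v x1) by (apply A; lra). nra.
    - exfalso. assert (A := Hnn ltac:(right; exists R0; now repeat split)).
      assert (0 <= v x0) by (apply A; lra). assert (0 <= v x1) by (apply A; lra). nra.
    - now exists R0. }
  destruct Hturn as (R0 & HT & HR0 & Hd0 & HvR0). subst T.
  destruct (turning_phase Wt Fo HF0 M (Rle_refl 0) Hbv (mo_start M) (mo_rest M) HR0
    (fun r Hr Hr' => Hneg r Hr Hr') Hd0 ltac:(lra)) as (r & rho & Br & Htr & Hst & Hbot).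
  set (mu := - v R0). assert (Hmu : beta < mu) by (unfold mu; lra).
  assert (Emu : v R0 = - mu) by (unfold mu; ring).
  assert (Mo := motion_opp Fo v dv M).
  assert (Hlv : filterlim (fun r => - v r) (at_right R0) (locally mu)).
  { unfold mu. apply (continuous_at_right (fun r => - v r)), (continuous_opp v), (motion_continuous M); lra. }
  assert (Hldv : filterlim (fun r => - dv r) (at_right R0) (locally 0)).
  { replace 0 with (- dv R0) by (rewrite Hd0; ring).
    apply (continuous_at_right (fun r => - dv r)), (continuous_opp dv), (motion_speed_continuous M); lra. }
  destruct (phase_ends Wt Fo HF0 Mo (Rlt_le _ _ HR0) Hmu Hlv Hldv) as (T2 & HtT2 & Hneg2 & Hend2).
  destruct (decaying_phase Wt Fo HF0 Hwinf Hcinf Mo (Rlt_le _ _ HR0) Hmu Hlv Hldv HtT2 Hneg2)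
    as (sg & sig & Br2 & Htr2 & Hst2 & Hdec2).
  - destruct Hend2 as [-> | R1 -> HR Hd Hz | R1 -> HR Hd Hv].
    + now left.
    + right. now exists R1.
    + exfalso. apply Hno.
      destruct (filter_ex (F := at_right 0) (fun z => 0 < z < R0 /\ 0 < v z)) as (z & Hz & Hvz).
      { apply filter_and; [now apply at_right_interval |].
        apply (lim_gt (Fl := at_right 0) v (v 0)); [apply (mo_start M) | assumption]. }
      exists z, R0, R1. repeat split; try lra; nra.
  - exists mu, R0, r, rho, sg, sig. rewrite Emu in *.
    split; [assumption |]. split.
    { replace mu with (- v R0) by (rewrite Emu; ring). apply in_dom_opp, (mo_dom M). lra. }
    split; [assumption |]. split; [assumption |]. split.
    { exact (tracks_first_passage M Hneg Htr). }
    now repeat (split; [assumption |]).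
Qed.
End SignChangingShape.

(** * The first descent *)

Section FirstDescent.
Context {c : Rbar} {q dq Q H f F : R -> R} {Hinf b beta : R}.
Context (Wt : weight q dq Q H Hinf) (Fo : force c f F b beta).
Context {lo alpha1 alpha2 : R} {r1 rho1 r2 rho2 : R -> R}.
Context (B1 : branch c q dq f F lo alpha1 r1 rho1) (B2 : branch c q dq f F lo alpha2 r2 rho2).
Context (Hlo : lo < beta) (Hal1 : beta < alpha1) (Hal2 : alpha1 < alpha2).
Context (Hd1 : in_dom c alpha1).
Context (L1 : rests (at_left alpha1) r1 rho1 0).

Local Notation leads := (leads F r1 rho1 r2 rho2).

(** Near the level alpha1 solution 1 is almost at rest at a radius close to 0, while
    solution 2 arrives there later and in motion. *)
Lemma leads_at_start : exists y, beta < y < alpha1 /\ leads y.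
Proof.
  assert (Hin : lo < alpha1 < alpha2) by lra.
  set (Fl := at_left alpha1).
  assert (LE1 : filterlim (energy F rho1) Fl (locally (F alpha1))).
  { eapply (energy_at_rest Fo); try eassumption. apply level_at_left. }
  assert (LE2 : filterlim (energy F rho2) Fl (locally (energy F rho2 alpha1))).
  { apply continuous_at_left. eapply is_derive_continuous, (energy_derive Wt Fo B2 _ Hin). }
  assert (LR2 : filterlim r2 Fl (locally (r2 alpha1))).
  { apply continuous_at_left. eapply is_derive_continuous, (br_dr B2 _ Hin). }
  assert (P2 := br_rho B2 _ Hin). assert (R2 := br_r B2 _ Hin).
  assert (HE : F alpha1 < energy F rho2 alpha1) by (unfold energy; nra).
  set (ke := (F alpha1 + energy F rho2 alpha1) / 2).
  assert (X1 := lim_lt _ _ ke LE1 ltac:(unfold ke; lra)).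
  assert (X2 := lim_gt _ _ ke LE2 ltac:(unfold ke; lra)).
  assert (X3 := lim_lt _ _ (r2 alpha1 / 2) (proj1 L1) ltac:(lra)).
  assert (X4 := lim_gt _ _ (r2 alpha1 / 2) LR2 ltac:(lra)).
  assert (X5 : Fl (fun s => beta < s < alpha1)) by (apply at_left_interval; lra).
  apply (filter_ex (F := Fl)).
  generalize (filter_and _ _ X1 (filter_and _ _ X2 (filter_and _ _ X3 (filter_and _ _ X4 X5)))).
  apply filter_imp. intros s Hall. repeat split; lra.
Qed.

Lemma first_descent_dichotomy :
  leads beta \/ exists z, beta <= z < alpha1 /\ r1 z = r2 z /\ lags q r1 rho1 r2 rho2 z.
Proof.
  destruct leads_at_start as (y & Hy & Hl).
  assert (C2 := branch_sub lo alpha1 B2 (Rle_refl _) (Rlt_le _ _ Hal2)).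
  destruct (leads_until_crossing Wt Fo B1 C2 beta y) as [Hall | (z & Hz & Hr & HE & _)];
    try lra; try assumption.
  - left. apply Hall. lra.
  - right. exists z. split; [lra |]. split; [assumption |].
    apply (crossing_lags Wt B1 C2); [lra | assumption | assumption].
Qed.

(** After a crossing, the flux order could be lost above beta only through a contact
    of the fluxes, at a level where solution 1 is later: excluded by
    [no_flux_contact_while_later]. *)
Lemma first_descent_superlinear {T df : R -> R} {l : R} :
  tail_weight q dq T l -> elastic c f df beta l ->
  rests (at_left alpha2) r2 rho2 0 ->
  leads beta \/ lags q r1 rho1 r2 rho2 beta.
Proof.
  intros Tw El L2.
  destruct first_descent_dichotomy as [Hl | (z & Hz & Hrz & Hr & Hw)]; [now left | right].
  assert (C2 := branch_sub lo alpha1 B2 (Rle_refl _) (Rlt_le _ _ Hal2)).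
  assert (Hall : forall t, beta <= t <= z -> 0 < q (r2 t) * rho2 t - q (r1 t) * rho1 t).
  { apply (propagate_down (fun t => q (r2 t) * rho2 t - q (r1 t) * rho1 t)).
    - intros t Ht. apply (flux_gap_continuous Wt B1 C2). lra.
    - lra.
    - intros t Ht Hab.
      assert (Hsl : forall u, t < u <= z -> rho1 u < rho2 u).
      { intros u Hu. apply (later_and_slower Wt B1 C2 u z); try lra.
        intros x Hx. specialize (Hab x). lra. }
      destruct (nonneg_at_left_end (fun t => q (r2 t) * rho2 t - q (r1 t) * rho1 t) t z)
        as [Hpos | Hzero]; try lra; try assumption.
      + apply (flux_gap_continuous Wt B1 C2). lra.
      + exfalso.
        assert (Hlate : r2 t < r1 t).
        { assert (r1 z - r2 z < r1 t - r2 t); [| lra].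
          apply (delay_grows_strictly B1 C2); try lra. intros u Hu. apply Hsl. lra. }
        apply (no_flux_contact_while_later Wt Fo Tw El B1 B2 Hlo Hal1 Hal2 Hd1 L1 L2 t); lra. }
  destruct (later_and_slower Wt B1 C2 beta z) with (t := beta) as [G1 G2]; try lra.
  - intros u Hu. specialize (Hall u Hu). lra.
  - split; [assumption |]. specialize (Hall beta). lra.
Qed.

(** Sturm comparison for u - b. As f (t) / (t - b) does not increase, the Wronskian W
    = q (u1' (u2 - b) - u2' (u1 - b)) is nonpositive, so that (u2 - b) / (u1 - b),
    which starts above 1, does not decrease before the first meeting. The radii
    therefore do not cross above b. *)
Lemma first_descent_sublinear {v1 dv1 v2 dv2 : R -> R} :
  motion c q dq f v1 dv1 -> motion c q dq f v2 dv2 ->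
  v1 0 = alpha1 -> v2 0 = alpha2 ->
  first_passage (v := v1) lo r1 -> first_passage (v := v2) lo r2 ->
  (forall s t, b < s -> s <= t -> in_dom c t -> f t / (t - b) <= f s / (s - b)) ->
  leads beta.
Proof.
  intros M1 M2 E1 E2 T1 T2 Hg. assert (Hb := fo_b Fo).
  destruct first_descent_dichotomy as [Hl | (z & Hz & Hrz & _)]; [assumption | exfalso].
  destruct (T1 z ltac:(lra)) as [V1 A1]. destruct (T2 z ltac:(lra)) as [V2 A2].
  set (R0 := r1 z). assert (HR0 : 0 < R0) by (apply (br_r B1); lra).
  rewrite <- Hrz in V2, A2. fold R0 in V1, V2, A1, A2.
  destruct (filter_ex (F := at_right 0) (fun x => 0 < x < R0 /\ forall y, 0 < y <= x -> v1 y < v2 y))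
    as (x0 & Hx0 & Hlt0).
  { assert (X1 := lim_lt (Fl := at_right 0) v1 _ ((alpha1 + alpha2) / 2) (mo_start M1) ltac:(lra)).
    assert (X2 := lim_gt (Fl := at_right 0) v2 _ ((alpha1 + alpha2) / 2) (mo_start M2) ltac:(lra)).
    assert (X3 := filter_and _ _ X1 X2). destruct X3 as [d Hd].
    exists (mkposreal (Rmin d R0) (Rmin_pos _ _ (cond_pos d) HR0)). intros x Hx Hx0.
    unfold ball in Hx; simpl in Hx. apply Rabs_lt_between in Hx.
    unfold minus, plus, opp in Hx; simpl in Hx.
    assert (Q1 := Rmin_l d R0). assert (Q2 := Rmin_r d R0).
    split; [lra |]. intros y Hy. destruct (Hd y); [| lra | lra].
    unfold ball; simpl. apply Rabs_lt_between. unfold minus, plus, opp; simpl. lra. }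
  destruct (lowest_zero (fun x => v2 x - v1 x) x0 R0) as (m & Hm & Hm0 & Hbelow).
  - lra.
  - intros x Hx. apply (continuous_minus v2 v1);
      [apply (motion_continuous M2) | apply (motion_continuous M1)]; lra.
  - specialize (Hlt0 x0). lra.
  - lra.
  - assert (Hlt : forall x, 0 < x < m -> v1 x < v2 x).
    { intros x Hx. destruct (Rle_or_lt x x0); [apply Hlt0; lra |]. specialize (Hbelow x). lra. }
    assert (Hz1 : forall x, 0 < x <= m -> b < v1 x /\ b < v2 x).
    { intros x Hx. destruct (Rle_lt_or_eq_dec x R0) as [Hl | He]; [lra | |].
      - specialize (A1 x ltac:(lra) Hl). specialize (A2 x ltac:(lra) Hl). lra.
      - rewrite He, V1, V2. lra. }
    set (W := fun x => q x * dv1 x * (v2 x - b) - q x * dv2 x * (v1 x - b)).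
    set (dW := fun x => q x * (f (v2 x) * (v1 x - b) - f (v1 x) * (v2 x - b))).
    assert (DW : forall x, 0 < x -> is_derive W x (dW x)).
    { intros x Hx. unfold W. eapply is_derive_value.
      - apply derive_minus.
        + apply (derive_mult (fun x => q x * dv1 x) (fun x => v2 x - b));
            [apply (motion_flux_derive Wt M1 x Hx) |].
          apply (derive_minus v2 (fun _ => b)); [apply (mo_der M2 x Hx) |
            apply (is_derive_const (V := R_NormedModule) b)].
        + apply (derive_mult (fun x => q x * dv2 x) (fun x => v1 x - b));
            [apply (motion_flux_derive Wt M2 x Hx) |].
          apply (derive_minus v1 (fun _ => b)); [apply (mo_der M1 x Hx) |
            apply (is_derive_const (V := R_NormedModule) b)].
      - unfold zero, dW; simpl. ring. }
    assert (dWneg : forall x, 0 < x < m -> dW x <= 0).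
    { intros x Hx. destruct (Hz1 x ltac:(lra)) as [Z1 Z2]. assert (Hl := Hlt x Hx).
      assert (G := Hg (v1 x) (v2 x) Z1 (Rlt_le _ _ Hl) (mo_dom M2 x ltac:(lra))).
      assert (Hq : 0 < q x) by (apply (w_pos Wt); lra).
      assert (f (v2 x) * (v1 x - b) <= f (v1 x) * (v2 x - b)).
      { apply (Rmult_le_compat_r ((v1 x - b) * (v2 x - b))) in G;
          [| apply Rmult_le_pos; lra].
        replace (f (v2 x) / (v2 x - b) * ((v1 x - b) * (v2 x - b))) with (f (v2 x) * (v1 x - b)) in G
          by (field; lra).
        replace (f (v1 x) / (v1 x - b) * ((v1 x - b) * (v2 x - b))) with (f (v1 x) * (v2 x - b)) in G
          by (field; lra). assumption. }
      unfold dW. assert (0 <= q x * (f (v1 x) * (v2 x - b) - f (v2 x) * (v1 x - b)))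
        by (apply Rmult_le_pos; lra). lra. }
    assert (LW : filterlim W (at_right 0) (locally 0)).
    { assert (L0 : filterlim W (at_right 0) (locally (0 * (alpha2 - b) - 0 * (alpha1 - b)))).
      { unfold W. rewrite <- E1, <- E2.
        apply lim_minus; apply lim_mult.
        - apply (flux_lim_start Wt (Rle_refl 0)), (mo_rest M1).
        - apply lim_minus; [apply (mo_start M2) | apply filterlim_const].
        - apply (flux_lim_start Wt (Rle_refl 0)), (mo_rest M2).
        - apply lim_minus; [apply (mo_start M1) | apply filterlim_const]. }
      now replace (0 * (alpha2 - b) - 0 * (alpha1 - b)) with 0 in L0 by ring. }
    assert (Wneg : forall x, 0 < x < m -> W x <= 0).
    { intros x Hx. apply (lim_le (Fl := at_right 0) (fun _ => W x) W);
        [apply filterlim_const | assumption |].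
      apply (filter_imp (fun y => 0 < y < x)); [| apply at_right_interval; lra].
      intros y Hy. apply (nonincreasing_of_derive W dW); [lra | |].
      - intros t Ht. apply DW. lra.
      - intros t Ht. apply dWneg. lra. }
    set (x := m / 2). assert (Hx : 0 < x < m) by (unfold x; lra).
    assert (Hq' : (v2 x - b) / (v1 x - b) <= (v2 m - b) / (v1 m - b)).
    { apply (nondecreasing_of_derive (fun y => (v2 y - b) / (v1 y - b))
        (fun y => - W y / (q y * ((v1 y - b) * (v1 y - b))))); [lra | |].
      - intros y Hy. destruct (Hz1 y ltac:(lra)) as [Z1 Z2].
        assert (Hqy : 0 < q y) by (apply (w_pos Wt); lra).
        eapply is_derive_value.
        + apply (is_derive_div (fun y => v2 y - b) (fun y => v1 y - b)); [| | lra].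
          * apply (derive_minus v2 (fun _ => b)); [apply (mo_der M2); lra |
              apply (is_derive_const (V := R_NormedModule) b)].
          * apply (derive_minus v1 (fun _ => b)); [apply (mo_der M1); lra |
              apply (is_derive_const (V := R_NormedModule) b)].
        + unfold zero, W; simpl. field. lra.
      - intros y Hy. destruct (Hz1 y ltac:(lra)) as [Z1 Z2].
        assert (Hqy : 0 < q y) by (apply (w_pos Wt); lra).
        assert (WW := Wneg y ltac:(lra)).
        apply Rmult_le_pos; [lra |]. apply Rlt_le, Rinv_0_lt_compat.
        repeat apply Rmult_lt_0_compat; lra. }
    destruct (Hz1 m ltac:(lra)) as [Z1 Z2]. destruct (Hz1 x ltac:(lra)) as [Z3 Z4].
    replace (v2 m) with (v1 m) in Hq' by lra.
    unfold Rdiv in Hq' at 2. rewrite Rinv_r in Hq' by lra.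
    assert (Hxx := Hlt x Hx).
    apply (Rmult_le_compat_r (v1 x - b)) in Hq'; [| lra].
    unfold Rdiv in Hq'. rewrite Rmult_assoc, Rinv_l in Hq'; lra.
Qed.
End FirstDescent.

(** * The weight q *)

Lemma C1_derive (g dg : R -> R) (r : R) : C1_Rplus g dg -> 0 < r -> is_derive g r (dg r).
Proof.
  intros [Hd _] Hr. apply is_derive_Reals. intros eps Heps.
  destruct (Hd r (Rlt_le _ _ Hr) (fun y => Rabs (y - dg r) < eps)) as [d Hd'].
  { exists (mkposreal eps Heps). intros y Hy. exact Hy. }
  exists (mkposreal (Rmin d r) (Rmin_pos _ _ (cond_pos d) Hr)). intros h Hh Hhd. simpl in Hhd.
  assert (M1 := Rmin_l d r). assert (M2 := Rmin_r d r). apply Rabs_lt_between in Hhd.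
  replace ((g (r + h) - g r) / h) with ((g (r + h) - g r) / (r + h - r)) by (f_equal; ring).
  apply Hd'; [| lra | lra].
  unfold ball; simpl. apply Rabs_lt_between. unfold minus, plus, opp; simpl. lra.
Qed.

Lemma at_right_half_line (P : R -> Prop) (r : R) :
  within (fun x => 0 <= x) (locally' r) P -> 0 <= r -> at_right r P.
Proof.
  intros [d Hd] Hr. exists d. intros y Hy Hlt. apply Hd; [assumption | lra | lra].
Qed.

Lemma C1_start (g dg : R -> R) : C1_Rplus g dg -> filterlim g (at_right 0) (locally (g 0)).
Proof.
  intros [Hd _].
  assert (L : filterlim (fun x => (g x - g 0) / (x - 0)) (at_right 0) (locally (dg 0))).
  { intros P HP. apply at_right_half_line; [| lra]. apply (Hd 0 (Rle_refl 0) P HP). }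
  assert (L2 : filterlim (fun x => g 0 + (g x - g 0) / (x - 0) * x) (at_right 0) (locally (g 0 + dg 0 * 0))).
  { apply lim_plus; [apply filterlim_const | apply lim_mult; [assumption | apply level_at_right]]. }
  replace (g 0 + dg 0 * 0) with (g 0) in L2 by ring.
  apply (filterlim_ext_loc (fun x => g 0 + (g x - g 0) / (x - 0) * x)); [| assumption].
  apply (filter_imp (fun z => 0 < z < 1)); [| apply at_right_interval; lra].
  intros z Hz. field. lra.
Qed.

Lemma start_of_continuous_on (g : R -> R) :
  continuous_on (fun r => 0 <= r) g -> filterlim g (at_right 0) (locally (g 0)).
Proof.
  intros Hg P HP. destruct (Hg 0 (Rle_refl 0) P HP) as [d Hd].
  exists d. intros y Hy Hlt. apply Hd; [assumption | lra].
Qed.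

(** The constant extension to negative arguments turns one-sided continuity at 0 into
    continuity on the line. *)
Lemma extension_continuous (g : R -> R) :
  (forall r, 0 < r -> continuous g r) -> filterlim g (at_right 0) (locally (g 0)) ->
  forall r, continuous (fun x => g (Rmax 0 x)) r.
Proof.
  intros Hc H0 r P HP. destruct (Rtotal_order r 0) as [Hr | [-> | Hr]].
  - exists (mkposreal (- r) ltac:(lra)). intros y Hy. unfold ball in Hy; simpl in Hy.
    apply Rabs_lt_between in Hy. unfold minus, plus, opp in Hy; simpl in Hy.
    apply (locally_singleton _ _) in HP. rewrite Rmax_left in HP by lra.
    now rewrite Rmax_left by lra.
  - rewrite Rmax_left in HP by lra. destruct (H0 P HP) as [d Hd].
    exists d. intros y Hy. destruct (Rle_or_lt y 0) as [Hy0 | Hy0].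
    + rewrite Rmax_left by lra. exact (locally_singleton _ _ HP).
    + rewrite Rmax_right by lra. now apply Hd.
  - rewrite Rmax_right in HP by lra. destruct (Hc r Hr P HP) as [d Hd].
    exists (mkposreal (Rmin d r) (Rmin_pos _ _ (cond_pos d) Hr)). intros y Hy.
    assert (M1 := Rmin_l d r). assert (M2 := Rmin_r d r).
    unfold ball in Hy; simpl in Hy.
    apply Rabs_lt_between in Hy. unfold minus, plus, opp in Hy; simpl in Hy.
    rewrite Rmax_right by lra. apply Hd.
    unfold ball; simpl. apply Rabs_lt_between. unfold minus, plus, opp; simpl. lra.
Qed.

Lemma primitive_extension (g : R -> R) (r : R) : 0 <= r ->
  primitive g r = primitive (fun x => g (Rmax 0 x)) r.
Proof.
  intros Hr. apply RInt_ext. intros x Hx. rewrite Rmin_left, Rmax_right in Hx by lra.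
  now rewrite Rmax_right by lra.
Qed.

Lemma primitive_derive_everywhere (g : R -> R) (r : R) : (forall x, continuous g x) ->
  is_derive (primitive g) r (g r).
Proof.
  intros Hc. apply (is_derive_RInt g (primitive g) 0).
  - exists (mkposreal 1 Rlt_0_1). intros y _.
    apply (RInt_correct (V := R_CompleteNormedModule)), (ex_RInt_continuous (V := R_CompleteNormedModule)).
    intros z _. apply Hc.
  - apply Hc.
Qed.

Section HalfLinePrimitive.
Context {g : R -> R} (Hc : forall r, 0 < r -> continuous g r).
Context (H0 : filterlim g (at_right 0) (locally (g 0))).

Lemma primitive_derive (r : R) : 0 < r -> is_derive (primitive g) r (g r).
Proof.
  intros Hr.
  apply (is_derive_ext_loc (primitive (fun x => g (Rmax 0 x)))).
  - exists (mkposreal r Hr). intros y Hy. unfold ball in Hy; simpl in Hy.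
    apply Rabs_lt_between in Hy. unfold minus, plus, opp in Hy; simpl in Hy.
    symmetry. apply primitive_extension. lra.
  - eapply is_derive_value.
    + apply primitive_derive_everywhere. intros z. now apply extension_continuous.
    + cbv beta. now rewrite Rmax_right by lra.
Qed.

Lemma primitive_mean (r : R) : 0 < r -> exists x, 0 < x < r /\ primitive g r = g x * r.
Proof.
  intros Hr.
  destruct (MVT_cor2 (primitive (fun x => g (Rmax 0 x))) (fun x => g (Rmax 0 x)) 0 r Hr) as (x & E & Hx).
  - intros x _. apply is_derive_Reals, (primitive_derive_everywhere (fun x => g (Rmax 0 x))).
    intros z. now apply extension_continuous.
  - exists x. split; [assumption |]. rewrite primitive_extension by lra.
    unfold primitive at 2 in E. rewrite RInt_point in E. unfold zero in E; simpl in E.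
    rewrite Rmax_right in E by lra. lra.
Qed.
End HalfLinePrimitive.

Section WeightFacts.
Context {q : R -> R} {Hinf linf : R}.
Context (hq1 : cond_q1 q) (hq2 : cond_q2 q) (hq3 : cond_q3 q Hinf) (hq4 : cond_q4 q linf) (hq5 : cond_q5 q).

Local Notation dq := (Derive q).
Local Notation Q := (primitive q).
Local Notation H := (Hfun q).

Lemma weight_derive (r : R) : 0 < r -> is_derive q r (dq r).
Proof.
  intros Hr. destruct (q1_C1 _ hq1) as [q' Hq']. apply Derive_correct.
  exists (q' r). now apply C1_derive.
Qed.

Lemma weight_increases (x y : R) : 0 < x -> x < y -> q x < q y.
Proof.
  intros Hx Hxy. apply (increasing_of_derive q dq); [assumption | |].
  - intros z Hz. apply weight_derive. lra.
  - intros z Hz. apply (q1_deriv_pos _ hq1). lra.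
Qed.

Lemma weight_positive (r : R) : 0 < r -> 0 < q r.
Proof.
  intros Hr. assert (0 <= q (r / 2)) by (apply (q1_nonneg _ hq1); lra).
  assert (q (r / 2) < q r) by (apply weight_increases; lra). lra.
Qed.

Lemma weight_continuous (r : R) : 0 < r -> continuous q r.
Proof. intros Hr. eapply is_derive_continuous, weight_derive, Hr. Qed.

Lemma weight_start : filterlim q (at_right 0) (locally (q 0)).
Proof. destruct (q1_C1 _ hq1) as [q' Hq']. exact (C1_start _ _ Hq'). Qed.

Lemma weight_primitive_derive (r : R) : 0 < r -> is_derive Q r (q r).
Proof. apply (primitive_derive weight_continuous weight_start). Qed.

Lemma weight_primitive_bounds (r : R) : 0 < r -> 0 < Q r < r * q r.
Proof.
  intros Hr. destruct (primitive_mean weight_continuous weight_start r Hr) as (x & Hx & ->).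
  assert (0 < q x) by (apply weight_positive; lra).
  assert (q x < q r) by (apply weight_increases; lra).
  split; [apply Rmult_lt_0_compat; lra |].
  rewrite (Rmult_comm (q x)). apply Rmult_lt_compat_l; lra.
Qed.

Lemma weight_H (r : R) : 0 < r -> H r = 1 - Q r * dq r / (q r * q r).
Proof.
  intros Hr. assert (Hq := weight_positive r Hr).
  apply is_derive_unique. eapply is_derive_value.
  - apply (is_derive_div Q q); [now apply weight_primitive_derive | now apply weight_derive | lra].
  - field. lra.
Qed.

Lemma H_above_limit (r : R) : 0 < r -> Hinf <= H r.
Proof.
  intros Hr. apply (lim_le (Fl := Rbar_locally p_infty) H (fun _ => H r)).
  - exact (q3_Hinf_lim _ _ hq3).
  - apply filterlim_const.
  - exists r. intros x Hx. apply (q3_H_noninc _ _ hq3); lra.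
Qed.

Lemma H_bound : exists H0, H0 < 1 / 2 /\ forall r, 0 < r -> H r <= H0.
Proof.
  destruct (q3_H0 _ _ hq3) as (H0 & L & Hl). exists H0. split; [assumption |].
  intros r Hr. apply (lim_le (Fl := at_right 0) (fun _ => H r) H); [apply filterlim_const | assumption |].
  apply (filter_imp (fun z => 0 < z < r)); [| now apply at_right_interval].
  intros z Hz. apply (q3_H_noninc _ _ hq3); lra.
Qed.

Lemma weight_of_conditions : weight q dq Q H Hinf.
Proof.
  constructor.
  - apply weight_positive.
  - apply weight_derive.
  - apply (q1_deriv_pos _ hq1).
  - apply weight_primitive_derive.
  - intros r Hr. apply (weight_primitive_bounds r Hr).
  - apply weight_H.
  - apply (q3_H_noninc _ _ hq3).
  - intros r Hr. assert (A := H_above_limit r Hr). assert (C := q3_Hinf_pos _ _ hq3). lra.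
  - apply H_above_limit.
  - intros r Hr. destruct H_bound as (H0 & Hl & HH). specialize (HH r Hr). lra.
  - apply (q3_qH_nondec _ _ hq3).
  - intros x y Hx [Hxy | <-]; [| lra]. apply Rlt_le, hq2; assumption.
  - intros x y Hx [Hxy | <-]; [| lra]. apply Rlt_le, hq5; assumption.
Qed.

Local Notation T := (fun r => RInt_gen (fun s => 1 / q s) (at_point r) (Rbar_locally p_infty)).

Lemma inverse_weight_continuous (r : R) : 0 < r -> continuous (fun s => 1 / q s) r.
Proof.
  intros Hr. assert (Hq := weight_positive r Hr).
  apply (continuous_mult (fun _ => 1) (fun s => / q s)); [apply continuous_const |].
  apply continuous_comp; [now apply weight_continuous | apply continuous_Rinv; lra].
Qed.

Local Notation G := (RInt (fun s => 1 / q s) 1).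

Lemma inverse_weight_integral (x y : R) : 0 < x -> 0 < y ->
  is_RInt (fun s => 1 / q s) x y (G y - G x).
Proof.
  intros Hx Hy.
  assert (Hex : forall a b, 0 < a -> 0 < b -> ex_RInt (fun s => 1 / q s) a b).
  { intros a b Ha Hb. apply (ex_RInt_continuous (V := R_CompleteNormedModule)). intros z Hz.
    apply inverse_weight_continuous. assert (0 < Rmin a b) by now apply Rmin_pos. lra. }
  replace (G y - G x) with (RInt (fun s => 1 / q s) x y).
  - apply (RInt_correct (V := R_CompleteNormedModule)), Hex; assumption.
  - assert (E := RInt_Chasles (fun s => 1 / q s) 1 x y (Hex 1 x Rlt_0_1 Hx) (Hex x y Hx Hy)).
    unfold plus in E; simpl in E. lra.
Qed.

Lemma inverse_weight_primitive (r : R) : 0 < r -> is_derive G r (1 / q r).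
Proof.
  intros Hr. apply (is_derive_RInt (fun s => 1 / q s) G 1).
  - exists (mkposreal r Hr). intros y Hy. unfold ball in Hy; simpl in Hy.
    apply Rabs_lt_between in Hy. unfold minus, plus, opp in Hy; simpl in Hy.
    replace (G y) with (G y - G 1) by (rewrite RInt_point; unfold zero; simpl; ring).
    apply inverse_weight_integral; lra.
  - now apply inverse_weight_continuous.
Qed.

(** As 1 / q is positive, its absolute integrability is convergence of the integral. *)
Lemma inverse_weight_limit : exists L, filterlim G (Rbar_locally p_infty) (locally L).
Proof.
  destruct (q4_L1_infty _ _ hq4) as [L HL]. exists L. intros P [eps Heps].
  assert (He : 0 < eps / 2) by (assert (A := cond_pos eps); lra).
  destruct (HL (ball L (mkposreal _ He)) (locally_ball L _)) as [A C HA [X HC] HAC].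
  assert (L1 : filterlim G (at_right 1) (locally (G 1))).
  { apply continuous_at_right. eapply is_derive_continuous, inverse_weight_primitive. lra. }
  assert (Hsmall := L1 (ball (G 1) (mkposreal _ He)) (locally_ball (G 1) _)).
  destruct (filter_ex (F := at_right 1) _ (filter_and _ _ (filter_and _ _ HA Hsmall)
    (at_right_interval 1 2 ltac:(lra)))) as (x & (Ax & Gx) & Hx).
  exists (Rmax X 2). intros y Hy. apply Heps.
  assert (Y1 := Rmax_l X 2). assert (Y2 := Rmax_r X 2).
  destruct (HAC x y Ax) as (I & HI & HIL); [apply HC; [lra | exact Logic.I] |].
  simpl in HI.
  assert (E : I = G y - G x).
  { apply (is_RInt_unique (V := R_CompleteNormedModule)) in HI. rewrite <- HI.
    rewrite <- (is_RInt_unique (V := R_CompleteNormedModule) _ _ _ _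
      (inverse_weight_integral x y ltac:(lra) ltac:(lra))).
    apply RInt_ext. intros z Hz. rewrite Rmin_left in Hz by lra.
    apply Rabs_pos_eq, Rlt_le, Rdiv_lt_0_compat; [lra | apply weight_positive; lra]. }
  rewrite E in HIL.
  change (Rabs (G x - G 1) < eps / 2) in Gx. change (Rabs (G y - G x - L) < eps / 2) in HIL.
  rewrite RInt_point in Gx. unfold zero in Gx; simpl in Gx.
  change (Rabs (G y - L) < eps).
  apply Rabs_lt_between in Gx. apply Rabs_lt_between in HIL. apply Rabs_lt_between. lra.
Qed.

Lemma tail_value : exists L, filterlim G (Rbar_locally p_infty) (locally L) /\
  forall r, 0 < r -> T r = L - G r.
Proof.
  destruct inverse_weight_limit as [L HL]. exists L. split; [assumption |].
  intros r Hr. apply (is_RInt_gen_unique (V := R_CompleteNormedModule)).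
  assert (LL : filterlim (fun y => G y - G r) (Rbar_locally p_infty) (locally (L - G r))).
  { apply lim_minus; [assumption | apply filterlim_const]. }
  intros P HP. destruct (LL P HP) as [X HX].
  apply (Filter_prod _ _ _ (fun x => x = r) (fun y => Rmax X 1 < y)).
  - reflexivity.
  - now exists (Rmax X 1).
  - intros x y -> Hy. exists (G y - G r).
    assert (Y1 := Rmax_l X 1). assert (Y2 := Rmax_r X 1). simpl.
    split; [apply inverse_weight_integral; lra | apply HX; lra].
Qed.

Lemma tail_derive (r : R) : 0 < r -> is_derive T r (- / q r).
Proof.
  intros Hr. destruct tail_value as (L & _ & HT).
  apply (is_derive_ext_loc (fun x => L - G x)).
  - exists (mkposreal r Hr). intros y Hy. unfold ball in Hy; simpl in Hy.
    apply Rabs_lt_between in Hy. unfold minus, plus, opp in Hy; simpl in Hy.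
    symmetry. apply HT. lra.
  - eapply is_derive_value.
    + apply (derive_minus (fun _ => L) G); [apply (is_derive_const (V := R_NormedModule) L) |
        now apply inverse_weight_primitive].
    + unfold zero; simpl. field. apply Rgt_not_eq, weight_positive, Hr.
Qed.

Lemma tail_vanishes : filterlim T (Rbar_locally p_infty) (locally 0).
Proof.
  destruct tail_value as (L & HL & HT).
  apply (filterlim_ext_loc (fun r => L - G r)).
  - exists 0. intros r Hr. symmetry. now apply HT.
  - replace 0 with (L - L) by ring. apply lim_minus; [apply filterlim_const | assumption].
Qed.

Lemma tail_mean (x y : R) : 0 < x -> x < y -> exists z, x < z < y /\ T x - T y = (y - x) / q z.
Proof.
  intros Hx Hxy.
  destruct (MVT_cor2 T (fun z => - / q z) x y Hxy) as (z & E & Hz).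
  - intros z Hz. apply is_derive_Reals, tail_derive. lra.
  - exists z. split; [assumption |]. unfold Rdiv. cbv beta in E. lra.
Qed.

Lemma tail_positive (r : R) : 0 < r -> 0 < T r.
Proof.
  intros Hr.
  assert (Hdec : forall x y, 0 < x -> x < y -> T y < T x).
  { intros x y Hx Hxy. destruct (tail_mean x y Hx Hxy) as (z & Hz & E).
    assert (0 < (y - x) / q z) by (apply Rdiv_lt_0_compat; [| apply weight_positive]; lra).
    cbv beta in *. lra. }
  apply Rle_lt_trans with (T (r + 1)); [| apply Hdec; lra].
  apply (lim_le (Fl := Rbar_locally p_infty) T (fun _ => T (r + 1)));
    [apply tail_vanishes | apply filterlim_const |].
  exists (r + 1). intros x Hx. apply Rlt_le, Hdec; lra.
Qed.

(** The integral of 1 / q over (r / 2, r) exceeds r / (2 q (r)) and tends to 0. *)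
Lemma radius_over_weight_vanishes (eps : R) : 0 < eps ->
  exists M, 0 < M /\ forall r, M < r -> r / q r < eps.
Proof.
  intros Heps. assert (He : 0 < eps / 2) by lra.
  destruct (lim_lt (Fl := Rbar_locally p_infty) T 0 _ tail_vanishes He) as [X HX].
  exists (Rmax (2 * X) 1). split; [apply Rlt_le_trans with 1; [lra | apply Rmax_r] |].
  intros r Hr. assert (Y1 := Rmax_l (2 * X) 1). assert (Y2 := Rmax_r (2 * X) 1).
  destruct (tail_mean (r / 2) r) as (z & Hz & E); [lra | lra |].
  assert (A := HX (r / 2) ltac:(lra)). assert (C := tail_positive r ltac:(lra)).
  assert (Qz := weight_positive z ltac:(lra)). assert (Qr := weight_increases z r ltac:(lra) ltac:(lra)).
  assert (r / q r < r / q z).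
  { apply Rmult_lt_compat_l; [lra |]. apply Rinv_lt_contravar; [apply Rmult_lt_0_compat |]; lra. }
  cbv beta in *. replace ((r - r / 2) / q z) with (r / q z / 2) in E by (field; lra). lra.
Qed.

Lemma weight_unbounded (K : R) : exists M, 0 < M /\ forall r, M < r -> K < q r.
Proof.
  destruct (radius_over_weight_vanishes 1 Rlt_0_1) as (M & HM & Hr).
  exists (Rmax M K). split; [apply Rlt_le_trans with M; [assumption | apply Rmax_l] |].
  intros r Hlt. assert (Y1 := Rmax_l M K). assert (Y2 := Rmax_r M K).
  assert (A := Hr r ltac:(lra)). assert (Qr := weight_positive r ltac:(lra)).
  apply (Rmult_lt_compat_r (q r)) in A; [| assumption].
  unfold Rdiv in A. rewrite Rmult_assoc, Rinv_l in A; lra.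
Qed.

Lemma weight_ratio_sq_vanishes (eps : R) : 0 < eps ->
  exists M, 0 < M /\ forall r, M < r -> Q r / (q r * q r) < eps.
Proof.
  intros Heps. destruct (radius_over_weight_vanishes eps Heps) as (M & HM & Hr).
  exists M. split; [assumption |]. intros r Hlt. assert (A := Hr r Hlt).
  assert (Qr := weight_positive r ltac:(lra)).
  apply Rlt_trans with (r / q r); [| assumption].
  replace (r / q r) with (r * q r / (q r * q r)) by (field; lra).
  apply Rmult_lt_compat_r; [apply Rinv_0_lt_compat; nra |].
  apply weight_primitive_bounds. lra.
Qed.

(** Q / q^2 - (1 - 2 k) T vanishes at infinity and has the derivative 2 (H - k) / q.
    With an upper bound k < 1 / 2 of H this shows that h = q T vanishes at 0; with k =
    H (r0) it bounds the growth of h at infinity. *)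
Lemma tail_bound (r0 k : R) : 0 < r0 -> (forall r, r0 <= r -> H r <= k) ->
  forall r, r0 <= r -> (1 - 2 * k) * (q r * T r) <= Q r / q r.
Proof.
  intros Hr0 Hk r Hr.
  set (Phi := fun x => Q x / (q x * q x) - (1 - 2 * k) * T x).
  assert (D : forall x, 0 < x -> is_derive Phi x (2 * (H x - k) / q x)).
  { intros x Hx. assert (Qx := weight_positive x Hx). unfold Phi. eapply is_derive_value.
    - apply derive_minus.
      + apply (is_derive_div Q (fun x => q x * q x)); [now apply weight_primitive_derive | |].
        * apply derive_mult; now apply weight_derive.
        * apply Rgt_not_eq. nra.
      + apply (derive_mult (fun _ => 1 - 2 * k) T);
          [apply (is_derive_const (V := R_NormedModule) (1 - 2 * k)) | now apply tail_derive].
    - rewrite weight_H by assumption. unfold zero; simpl. field. lra. }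
  assert (L : filterlim Phi (Rbar_locally p_infty) (locally (0 - (1 - 2 * k) * 0))).
  { apply lim_minus.
    - intros P [eps Heps]. destruct (weight_ratio_sq_vanishes eps (cond_pos eps)) as (M & HM & HMr).
      exists M. intros x Hx. apply Heps. specialize (HMr x Hx).
      change (Rabs (Q x / (q x * q x) - 0) < eps). rewrite Rminus_0_r, Rabs_pos_eq; [assumption |].
      assert (Qx := weight_positive x ltac:(lra)).
      apply Rlt_le, Rdiv_lt_0_compat; [apply weight_primitive_bounds; lra | nra].
    - apply lim_mult; [apply filterlim_const | apply tail_vanishes]. }
  assert (Hpos : 0 - (1 - 2 * k) * 0 <= Phi r).
  { apply (lim_le (Fl := Rbar_locally p_infty) Phi (fun _ => Phi r)); [assumption | apply filterlim_const |].
    exists r. intros x Hx. apply (nonincreasing_of_derive Phi (fun x => 2 * (H x - k) / q x)); [lra | |].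
    - intros z Hz. apply D. lra.
    - intros z Hz. assert (A := Hk z ltac:(lra)). assert (Qz := weight_positive z ltac:(lra)).
      assert (A' : 0 <= 2 * (k - H z) / q z).
      { apply Rmult_le_pos; [lra | now apply Rlt_le, Rinv_0_lt_compat]. }
      replace (2 * (H z - k) / q z) with (- (2 * (k - H z) / q z)) by (field; lra). lra. }
  assert (Qr := weight_positive r ltac:(lra)).
  unfold Phi in Hpos.
  clear L D. cbv beta. revert Hpos. cbv beta.
  generalize (RInt_gen (fun s => 1 / q s) (at_point r) (Rbar_locally p_infty)). intros t Ht.
  assert (Hm : 0 <= q r * (Q r / (q r * q r) - (1 - 2 * k) * t)) by (apply Rmult_le_pos; lra).
  replace (q r * (Q r / (q r * q r) - (1 - 2 * k) * t))
    with (Q r / q r - (1 - 2 * k) * (q r * t)) in Hm by (field; lra). lra.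
Qed.

Lemma hfun_derive (r : R) : 0 < r -> is_derive (hfun q) r (dq r * T r - 1).
Proof.
  intros Hr. unfold hfun. eapply is_derive_value.
  - apply (derive_mult q T); [now apply weight_derive | now apply tail_derive].
  - field. apply Rgt_not_eq, weight_positive, Hr.
Qed.

Lemma hfun_slope (r : R) : 0 < r -> linf <= dq r * T r - 1.
Proof.
  intros Hr. cbv beta. rewrite <- (is_derive_unique _ _ _ (hfun_derive r Hr)).
  apply (lim_le (Fl := Rbar_locally p_infty) (Derive (hfun q)) (fun _ => Derive (hfun q) r)).
  - exact (q4_linf_lim _ _ hq4).
  - apply filterlim_const.
  - exists r. intros x Hx. apply (q4_h'_noninc _ _ hq4); lra.
Qed.

Lemma tail_weight_of_conditions : tail_weight q dq T linf.
Proof.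
  constructor.
  - apply (q4_linf_pos _ _ hq4).
  - apply tail_positive.
  - apply tail_derive.
  - apply hfun_slope.
  - intros x y Hx Hxy. assert (A := q4_h'_noninc _ _ hq4 x y Hx Hxy).
    rewrite (is_derive_unique _ _ _ (hfun_derive x Hx)) in A.
    rewrite (is_derive_unique _ _ _ (hfun_derive y ltac:(lra))) in A. assumption.
  - destruct H_bound as (H0 & Hh & HH). intros P [eps Heps].
    assert (Hd : 0 < (1 - 2 * H0) * eps) by (apply Rmult_lt_0_compat; [lra | apply cond_pos]).
    change (at_right 0 (fun r => P (q r * T r))).
    apply (filter_imp (fun r => 0 < r < (1 - 2 * H0) * eps)); [| now apply at_right_interval].
    intros r Hr. apply Heps.
    change (Rabs (q r * T r - 0) < eps). rewrite Rminus_0_r.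
    assert (Qr := weight_positive r ltac:(lra)). assert (Tr := tail_positive r ltac:(lra)). cbv beta in Tr.
    rewrite Rabs_pos_eq by (apply Rlt_le, Rmult_lt_0_compat; assumption).
    assert (A := tail_bound r H0 ltac:(lra) ltac:(intros; apply HH; lra) r (Rle_refl r)). cbv beta in A.
    assert (C : Q r / q r < r).
    { apply (Rmult_lt_reg_r (q r)); [assumption |]. unfold Rdiv. rewrite Rmult_assoc, Rinv_l by lra.
      rewrite Rmult_1_r. apply weight_primitive_bounds. lra. }
    apply (Rmult_lt_reg_l (1 - 2 * H0)); lra.
Qed.

(** Beyond r0, (1 - 2 H (r0)) h <= Q / q by [tail_bound]. Here h grows at least like
    linf r, and Q / q at most like H (r0) r; finally r0 tends to infinity. *)
Lemma limit_slopes : (1 - 2 * Hinf) * linf <= Hinf.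
Proof.
  assert (Hfix : forall r0, 0 < r0 -> (1 - 2 * H r0) * linf <= H r0).
  { intros r0 Hr0. apply Rnot_lt_le. intros Hlt.
    assert (Hh : H r0 < 1 / 2) by (apply (w_Hhalf weight_of_conditions); assumption).
    set (k := 1 - 2 * H r0) in *. set (A := Q r0 / q r0).
    assert (Hlin : forall r, r0 <= r -> k * (linf * (r - r0)) <= A + H r0 * (r - r0)).
    { intros r Hr.
      assert (B1 := tail_bound r0 (H r0) Hr0 ltac:(intros; apply (q3_H_noninc _ _ hq3); lra) r Hr).
      cbv beta in B1. fold k in B1.
      assert (B2 : hfun q r0 - linf * r0 <= hfun q r - linf * r).
      { apply (nondecreasing_of_derive (fun x => hfun q x - linf * x)
          (fun x => dq x * T x - 1 - linf)); [assumption | |].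
        - intros z Hz. eapply is_derive_value.
          + apply derive_minus; [apply hfun_derive; lra |].
            apply (derive_mult (fun _ => linf) (fun x => x));
              [apply (is_derive_const (V := R_NormedModule) linf) | apply (is_derive_id (K := R_AbsRing))].
          + unfold zero, one; simpl. ring.
        - intros z Hz. assert (E := hfun_slope z ltac:(lra)). cbv beta in *. lra. }
      assert (B3 : Q r / q r - H r0 * r <= Q r0 / q r0 - H r0 * r0).
      { apply (nonincreasing_of_derive (fun x => Q x / q x - H r0 * x) (fun x => H x - H r0)); [assumption | |].
        - intros z Hz. eapply is_derive_value.
          + apply derive_minus; [apply (weight_ratio_derive weight_of_conditions); lra |].
            apply (derive_mult (fun _ => H r0) (fun x => x));
              [apply (is_derive_const (V := R_NormedModule) (H r0)) | apply (is_derive_id (K := R_AbsRing))].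
          + unfold zero, one; simpl. ring.
        - intros z Hz. assert (E := q3_H_noninc _ _ hq3 r0 z Hr0 ltac:(lra)). lra. }
      assert (B4 : 0 < hfun q r0).
      { unfold hfun. apply Rmult_lt_0_compat; [now apply weight_positive | now apply tail_positive]. }
      unfold hfun in *. fold A in B3.
      assert (B5 : linf * (r - r0) <= q r * RInt_gen (fun s => 1 / q s) (at_point r) (Rbar_locally p_infty)) by lra.
      apply (Rmult_le_compat_l k) in B5; [lra | unfold k; lra]. }
    assert (HA : 0 < A) by (apply (ratio_pos weight_of_conditions); assumption).
    set (d := k * linf - H r0). assert (Hd : 0 < d) by (unfold d; lra).
    assert (E := Hlin (r0 + 2 * A / d)).
    assert (HX : 0 < 2 * A / d) by (apply Rdiv_lt_0_compat; lra).
    specialize (E ltac:(lra)).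
    assert (HY : d * (2 * A / d) = 2 * A) by (field; lra).
    replace (k * (linf * (r0 + 2 * A / d - r0))) with (d * (2 * A / d) + H r0 * (r0 + 2 * A / d - r0)) in E
      by (unfold d at 1; ring). lra. }
  apply (lim_le (Fl := Rbar_locally p_infty) (fun r => (1 - 2 * H r) * linf) H).
  - apply lim_mult; [| apply filterlim_const]. apply lim_minus; [apply filterlim_const |].
    apply lim_mult; [apply filterlim_const | exact (q3_Hinf_lim _ _ hq3)].
  - exact (q3_Hinf_lim _ _ hq3).
  - exists 0. intros r Hr. now apply Hfix.
Qed.
End WeightFacts.

Lemma derive_reflection (x : R) : is_derive Ropp x (- 1).
Proof. auto_derive; [exact I | ring]. Qed.

(** * The force f *)

Section ForceFacts.
Context {c : Rbar} {f : R -> R} {b beta : R}.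
Context (hf : forall s, in_dom c s -> continuous f s).
Context (hf1 : cond_f1 c f b beta) (hf2 : cond_f2 c f).

Local Notation F := (primitive f).
Local Notation df := (Derive f).

Lemma potential_derive (s : R) : in_dom c s -> is_derive F s (f s).
Proof.
  intros Hs. destruct (in_dom_open s Hs) as (m & Hm & Hdm).
  apply (is_derive_RInt f F 0); [| now apply hf].
  exists (mkposreal (m - Rabs s) ltac:(lra)). intros y Hy.
  change (Rabs (y - s) < m - Rabs s) in Hy.
  apply (RInt_correct (V := R_CompleteNormedModule)), (ex_RInt_continuous (V := R_CompleteNormedModule)).
  intros z Hz. apply hf, (in_dom_le m); [assumption |].
  assert (Rabs y < m) by (assert (A := Rabs_triang_inv y s); lra).
  apply Rabs_lt_between in H. rewrite (Rabs_pos_eq m) by (assert (B := Rabs_pos s); lra).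
  apply Rabs_le. unfold Rmin, Rmax in Hz. destruct (Rle_dec 0 y); lra.
Qed.

Lemma potential_zero : F 0 = 0.
Proof. unfold primitive. rewrite RInt_point. reflexivity. Qed.

Lemma beta_in_dom : in_dom c beta.
Proof.
  assert (A := f1_b_pos _ _ _ _ hf1). assert (B := f1_b_lt_beta _ _ _ _ hf1).
  apply in_dom_pos; [lra | apply (f1_beta_lt_c _ _ _ _ hf1)].
Qed.

Lemma in_dom_between (s t : R) : in_dom c t -> 0 <= s <= t -> in_dom c s.
Proof. intros Ht Hs. apply (in_dom_le t); [assumption |]. rewrite !Rabs_pos_eq; lra. Qed.

Lemma potential_even (s : R) : in_dom c s -> F (- s) = F s.
Proof.
  assert (Hpos : forall s, 0 <= s -> in_dom c s -> F (- s) = F s).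
  { intros t Ht Hd.
    assert (D : forall z, 0 <= z <= t -> is_derive (fun x => F (- x) - F x) z 0).
    { intros z Hz. assert (Hdz : in_dom c z) by now apply (in_dom_between z t).
      eapply is_derive_value.
      - apply derive_minus; [| now apply potential_derive].
        apply (derive_comp F Ropp); [now apply potential_derive, in_dom_opp |].
        apply derive_reflection.
      - rewrite (f1_odd _ _ _ _ hf1) by assumption. unfold opp, one; simpl. ring. }
    assert (A := nondecreasing_of_derive _ (fun _ => 0) 0 t Ht D (fun _ _ => Rle_refl 0)).
    assert (B := nonincreasing_of_derive _ (fun _ => 0) 0 t Ht D (fun _ _ => Rle_refl 0)).
    cbv beta in A, B. rewrite Ropp_0 in A, B. lra. }
  intros Hs. destruct (Rle_or_lt 0 s) as [H | H]; [now apply Hpos |].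
  rewrite <- (Hpos (- s)); [now rewrite Ropp_involutive | lra | now apply in_dom_opp].
Qed.

Lemma force_vanishes_at_b : f b = 0.
Proof.
  assert (A := f1_b_pos _ _ _ _ hf1). assert (B := f1_b_lt_beta _ _ _ _ hf1).
  assert (C := f1_nonpos _ _ _ _ hf1 b ltac:(lra)).
  assert (0 <= f b); [| lra].
  apply (nonneg_at_left_end f b beta B).
  - apply hf, (in_dom_between b beta beta_in_dom). lra.
  - intros t Ht. apply (f1_pos _ _ _ _ hf1); [lra |].
    apply in_dom_pos; [lra |]. apply (in_dom_between t beta beta_in_dom). lra.
Qed.

Lemma potential_monotone_above_b (s t : R) : b <= s -> s < t -> in_dom c t -> F s < F t.
Proof.
  assert (A := f1_b_pos _ _ _ _ hf1). intros Hs Hst Ht.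
  apply (increasing_of_derive F f); [assumption | |].
  - intros z Hz. apply potential_derive, (in_dom_between z t Ht). lra.
  - intros z Hz. apply (f1_pos _ _ _ _ hf1); [lra |].
    apply in_dom_pos; [lra |]. apply (in_dom_between z t Ht). lra.
Qed.

Lemma force_of_conditions : force c f F b beta.
Proof.
  assert (A := f1_b_pos _ _ _ _ hf1). assert (B := f1_b_lt_beta _ _ _ _ hf1).
  constructor.
  - apply potential_derive.
  - apply (f1_odd _ _ _ _ hf1).
  - apply potential_even.
  - lra.
  - apply force_vanishes_at_b.
  - apply beta_in_dom.
  - apply (f1_nonpos _ _ _ _ hf1).
  - intros s Hs Hd. apply (f1_pos _ _ _ _ hf1); [assumption |]. apply in_dom_pos; [lra | assumption].
  - assert (Hpos : forall s, 0 <= s <= beta -> F s <= 0).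
    { intros s Hs. destruct (Rle_or_lt s b) as [Hsb | Hsb].
      - rewrite <- potential_zero. apply (nonincreasing_of_derive F f); [lra | |].
        + intros z Hz. apply potential_derive, (in_dom_between z beta beta_in_dom). lra.
        + intros z Hz. apply (f1_nonpos _ _ _ _ hf1). lra.
      - assert (E := f1_F_beta _ _ _ _ hf1). destruct (Rle_lt_or_eq_dec s beta) as [Hl | ->]; [lra | | lra].
        assert (F s < F beta) by (apply potential_monotone_above_b; [lra | assumption | apply beta_in_dom]).
        lra. }
    intros s Hs. destruct (Rle_or_lt 0 s) as [H | H].
    + apply Hpos. rewrite Rabs_pos_eq in Hs; lra.
    + rewrite <- potential_even.
      * apply Hpos. rewrite Rabs_left in Hs; lra.
      * apply (in_dom_le beta); [apply beta_in_dom |]. now rewrite (Rabs_pos_eq beta) by lra.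
  - apply (f1_F_beta _ _ _ _ hf1).
  - intros s Hs Hd.
    assert (Hpos : forall t, beta < t -> in_dom c t -> 0 < F t).
    { intros t Ht Hdt. rewrite <- (f1_F_beta _ _ _ _ hf1). apply potential_monotone_above_b; [lra | lra | assumption]. }
    destruct (Rle_or_lt 0 s) as [H | H].
    + apply Hpos; [rewrite Rabs_pos_eq in Hs; lra | assumption].
    + rewrite <- potential_even by assumption.
      apply Hpos; [rewrite Rabs_left in Hs; lra | now apply in_dom_opp].
Qed.

Lemma force_derive (s : R) : 0 < s -> in_dom c s -> is_derive f s (df s).
Proof.
  intros Hs Hd. apply Derive_correct, (f2_derivable _ _ hf2); [assumption |].
  apply in_dom_pos; [lra | assumption].
Qed.

Lemma potential_ratio_derive (s : R) : b < s -> in_dom c s ->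
  is_derive (fun t => F t / f t) s (1 - F s * df s / (f s * f s)).
Proof.
  assert (A := f1_b_pos _ _ _ _ hf1). intros Hs Hd.
  assert (P := fo_pos force_of_conditions s Hs Hd).
  eapply is_derive_value.
  - apply (is_derive_div F f); [now apply potential_derive | apply force_derive; [lra | assumption] | lra].
  - field. lra.
Qed.

(** At beta the derivative of F / f is 1, since F (beta) = 0; for negative levels F /
    f is odd. *)
Lemma growth_of_outer_bound (kmin : R) : kmin <= 1 ->
  (forall s, beta < s -> in_dom c s -> kmin <= 1 - F s * df s / (f s * f s)) ->
  growth c f F beta kmin.
Proof.
  intros Hk Hout. assert (A := f1_b_pos _ _ _ _ hf1). assert (B := f1_b_lt_beta _ _ _ _ hf1).
  assert (Hpos : forall s, beta <= s -> in_dom c s ->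
    exists k, is_derive (fun t => F t / f t) s k /\ kmin <= k).
  { intros s Hs Hd. exists (1 - F s * df s / (f s * f s)).
    split; [apply potential_ratio_derive; [lra | assumption] |].
    destruct (Rle_lt_or_eq_dec _ _ Hs) as [Hl | <-]; [now apply Hout |].
    rewrite (f1_F_beta _ _ _ _ hf1). unfold Rdiv. rewrite !Rmult_0_l. lra. }
  intros s Hs Hd. destruct (Rle_or_lt 0 s) as [H0 | H0].
  - apply Hpos; [rewrite Rabs_pos_eq in Hs; lra | assumption].
  - rewrite Rabs_left in Hs by assumption.
    destruct (Hpos (- s) Hs (in_dom_opp s Hd)) as (k & D & Hkk). exists k. split; [| assumption].
    apply (is_derive_ext_loc (fun t => - (F (- t) / f (- t)))).
    + destruct (in_dom_open s Hd) as (m & Hm & Hdm).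
      exists (mkposreal (m - Rabs s) ltac:(lra)). intros y Hy.
      change (Rabs (y - s) < m - Rabs s) in Hy.
      assert (Hy' : Rabs y < m) by (assert (X := Rabs_triang_inv y s); lra).
      assert (Hdy : in_dom c y).
      { apply (in_dom_le m); [assumption |]. assert (X := Rle_abs m). lra. }
      rewrite potential_even, (f1_odd _ _ _ _ hf1) by assumption.
      unfold Rdiv. now rewrite Rinv_opp, Ropp_mult_distr_r, Ropp_involutive.
    + eapply is_derive_value.
      * apply (is_derive_opp (fun t => F (- t) / f (- t))).
        apply (derive_comp (fun t => F t / f t) Ropp); [exact D |].
        apply derive_reflection.
      * unfold opp, one; simpl. ring.
Qed.

Lemma sublinear_slope (s t : R) :
  (forall s, b <= s -> Rbar_lt s c -> df s * (s - b) <= f s) ->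
  b < s -> s <= t -> in_dom c t -> f t / (t - b) <= f s / (s - b).
Proof.
  intros Hsub Hs Hst Ht. assert (A := f1_b_pos _ _ _ _ hf1).
  apply (nonincreasing_of_derive (fun x => f x / (x - b))
    (fun x => (df x * (x - b) - f x) / ((x - b) * (x - b)))); [assumption | |].
  - intros z Hz. assert (Hd : in_dom c z) by (apply (in_dom_between z t Ht); lra).
    eapply is_derive_value.
    + apply (is_derive_div f (fun x => x - b)); [apply force_derive; [lra | assumption] | | lra].
      apply (derive_minus (fun x => x) (fun _ => b)); [apply (is_derive_id (K := R_AbsRing)) |
        apply (is_derive_const (V := R_NormedModule) b)].
    + unfold zero, one; simpl. field. lra.
  - intros z Hz. assert (Hd : in_dom c z) by (apply (in_dom_between z t Ht); lra).
    assert (E := Hsub z ltac:(lra) (proj1 (in_dom_pos z ltac:(lra)) Hd)).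
    assert (0 <= (f z - df z * (z - b)) / ((z - b) * (z - b))).
    { apply Rmult_le_pos; [lra |]. apply Rlt_le, Rinv_0_lt_compat, Rmult_lt_0_compat; lra. }
    replace ((df z * (z - b) - f z) / ((z - b) * (z - b)))
      with (- ((f z - df z * (z - b)) / ((z - b) * (z - b)))) by (field; lra). lra.
Qed.

Section Superlinear.
Context {l Hinf : R} (Hl : 0 < l) (HHl : (1 - 2 * Hinf) * l <= Hinf) (HHinf : 0 < Hinf < 1 / 2).
Context (Hmono : forall s1 s2, b < s1 -> s1 <= s2 -> Rbar_lt s2 c ->
  s2 * df s2 / f s2 <= s1 * df s1 / f s1).
Context (Hbeta : beta * df beta / f beta <= 1 + 2 * l).

Lemma elastic_of_conditions : elastic c f df beta l.
Proof.
  assert (A := f1_b_pos _ _ _ _ hf1). assert (B := f1_b_lt_beta _ _ _ _ hf1).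
  assert (M : forall s t, beta <= s -> s <= t -> in_dom c t -> t * df t / f t <= s * df s / f s).
  { intros s t Hs Hst Ht. apply Hmono; [lra | assumption |]. apply in_dom_pos; [lra | assumption]. }
  constructor.
  - intros s Hs Hd. apply force_derive; [lra | assumption].
  - exact M.
  - intros s Hs Hd. specialize (M beta s (Rle_refl _) Hs Hd). lra.
Qed.

(** Let p = s f' / f at the level s. As this elasticity does not increase, (t f)' >=
    (1 + p) f below s, whence s f >= (1 + p) F. If p > 0 this gives (F / f)' >= 1 / (1
    + p) >= 1 / (2 + 2 l), and if p <= 0 then (F / f)' >= 1. The inequality between
    Hinf and l makes 1 / (2 + 2 l) at least 1 / 2 - Hinf. *)
Lemma growth_of_elasticity : growth c f F beta (1 / 2 - Hinf).
Proof.
  assert (A := f1_b_pos _ _ _ _ hf1). assert (B := f1_b_lt_beta _ _ _ _ hf1).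
  apply growth_of_outer_bound; [lra |]. intros s Hs Hd.
  assert (Pf : 0 < f s) by (apply (fo_pos force_of_conditions); [lra | assumption]).
  assert (PF : 0 < F s).
  { apply (fo_Fpos force_of_conditions); [rewrite Rabs_pos_eq; lra | assumption]. }
  set (p := s * df s / f s).
  assert (Hp : p <= 1 + 2 * l) by (apply (el_bound elastic_of_conditions); [lra | assumption]).
  assert (Edf : df s = p * f s / s) by (unfold p; field; lra).
  assert (Hmean : (1 + p) * F s <= s * f s).
  { assert (Pfb : 0 < f beta) by (apply (fo_pos force_of_conditions); [lra | apply beta_in_dom]).
    assert (E : beta * f beta - (1 + p) * F beta <= s * f s - (1 + p) * F s).
    { apply (nondecreasing_of_derive (fun t => t * f t - (1 + p) * F t)
        (fun t => f t * (t * df t / f t - p))); [lra | |].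
      - intros z Hz. assert (Hdz : in_dom c z) by (apply (in_dom_between z s Hd); lra).
        assert (Pz : 0 < f z) by (apply (fo_pos force_of_conditions); [lra | assumption]).
        eapply is_derive_value.
        + apply derive_minus.
          * apply (derive_mult (fun t => t) f); [apply (is_derive_id (K := R_AbsRing)) |].
            apply force_derive; [lra | assumption].
          * apply (derive_mult (fun _ => 1 + p) F); [apply (is_derive_const (V := R_NormedModule) (1 + p)) |].
            now apply potential_derive.
        + unfold zero, one; simpl. field. lra.
      - intros z Hz. assert (Hdz : in_dom c z) by (apply (in_dom_between z s Hd); lra).
        assert (Pz : 0 < f z) by (apply (fo_pos force_of_conditions); [lra | assumption]).
        assert (E := el_mono elastic_of_conditions z s ltac:(lra) ltac:(lra) Hd). fold p in E.
        apply Rmult_le_pos; lra. }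
    rewrite (f1_F_beta _ _ _ _ hf1) in E. assert (0 < beta * f beta) by (apply Rmult_lt_0_compat; lra). lra. }
  rewrite Edf. replace (F s * (p * f s / s) / (f s * f s)) with (p * (F s / (s * f s))) by (field; lra).
  set (x := F s / (s * f s)).
  assert (Psf : 0 < s * f s) by (apply Rmult_lt_0_compat; lra).
  assert (Hx : 0 < x) by (apply Rdiv_lt_0_compat; assumption).
  assert (Hx1 : (1 + p) * x <= 1).
  { unfold x. apply (Rmult_le_reg_r (s * f s)); [assumption |].
    replace ((1 + p) * (F s / (s * f s)) * (s * f s)) with ((1 + p) * F s) by (field; lra). lra. }
  destruct (Rle_or_lt p 0) as [Hn | Hn].
  - assert (0 <= - p * x) by (apply Rmult_le_pos; lra). lra.
  - assert (Hx2 : 1 - p * x >= x) by lra.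
    assert (K : (1 - 2 * Hinf) * (1 + l) <= 1) by lra.
    assert (Hg : 1 - p * x >= 1 / (1 + p)).
    { assert (p * x <= p / (1 + p)).
      { apply (Rmult_le_reg_r (1 + p)); [lra |].
        replace (p / (1 + p) * (1 + p)) with p by (field; lra).
        replace (p * x * (1 + p)) with (p * ((1 + p) * x)) by ring.
        rewrite <- (Rmult_1_r p) at 3. apply Rmult_le_compat_l; lra. }
      replace (1 / (1 + p)) with (1 - p / (1 + p)) by (field; lra). lra. }
    assert (1 / 2 - Hinf <= 1 / (1 + p)); [| lra].
    apply (Rmult_le_reg_r (1 + p)); [lra |].
    replace (1 / (1 + p) * (1 + p)) with 1 by (field; lra).
    apply Rle_trans with ((1 / 2 - Hinf) * (2 + 2 * l)); [apply Rmult_le_compat_l; lra | lra].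
Qed.
End Superlinear.
End ForceFacts.

(** * Uniqueness for the initial value problem *)

Lemma motion_of_solution {c : Rbar} {q dq f : R -> R} (u : R -> R) :
  (forall r, 0 < r -> 0 < q r) -> (forall r, 0 < r -> is_derive q r (dq r)) ->
  is_solution c f q u -> exists du, motion c q dq f u du.
Proof.
  intros Hq Hdq (Hdom & (du & HC & H0 & Hacc) & Hlim). exists du. constructor.
  - exact Hdom.
  - intros r Hr. now apply (C1_derive u du).
  - intros r Hr. destruct (Hacc r Hr) as [Hex E]. assert (Qr := Hq r Hr).
    apply (is_derive_ext_loc (fun x => q x * du x / q x)).
    + exists (mkposreal r Hr). intros y Hy. change (Rabs (y - r) < r) in Hy.
      apply Rabs_lt_between in Hy. assert (Qy := Hq y ltac:(lra)).
      unfold Rdiv. rewrite (Rmult_comm (q y)), Rmult_assoc, Rinv_r by lra. apply Rmult_1_r.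
    + eapply is_derive_value.
      * apply (is_derive_div (fun x => q x * du x) q); [apply Derive_correct, Hex | now apply Hdq | lra].
      * replace (Derive (fun x => q x * du x) r) with (- (q r * f (u r))) by lra. field. lra.
  - exact (C1_start _ _ HC).
  - rewrite <- H0 at 2. apply start_of_continuous_on, HC.
  - exact Hlim.
Qed.

Lemma halving {I : R -> Prop} {m : R -> R} {K0 : R} :
  (forall x, I x -> m x <= K0) ->
  (forall K, (forall x, I x -> m x <= K) -> forall x, I x -> m x <= K / 2) ->
  forall x, I x -> m x <= 0.
Proof.
  intros H0 Hstep.
  assert (Hn : forall n x, I x -> m x <= K0 * (/ 2) ^ n).
  { induction n as [| n IH]; intros x Hx; simpl.
    - rewrite Rmult_1_r. now apply H0.
    - assert (A := Hstep _ IH x Hx). lra. }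
  intros x Hx. apply (is_lim_seq_le (fun _ => m x) (fun n => K0 * (/ 2) ^ n) (m x) 0).
  - intros n. now apply Hn.
  - apply is_lim_seq_const.
  - replace (Finite 0) with (Rbar_mult K0 0) by (simpl; f_equal; ring).
    apply is_lim_seq_scal_l, is_lim_seq_geom. rewrite Rabs_pos_eq; lra.
Qed.

Lemma small_from_start (g dg : R -> R) (t x B : R) : t < x ->
  filterlim g (at_right t) (locally 0) ->
  (forall z, t < z <= x -> is_derive g z (dg z)) ->
  (forall z, t < z <= x -> Rabs (dg z) <= B) -> Rabs (g x) <= B * (x - t).
Proof.
  intros Htx Hg Hd HB.
  assert (Hs : forall k dk, filterlim k (at_right t) (locally 0) ->
    (forall z, t < z <= x -> is_derive k z (dk z)) ->
    (forall z, t < z <= x -> dk z <= B) -> k x <= B * (x - t)).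
  { intros k dk Hk Hdk HBk.
    assert (k x - B * (x - t) <= 0 - B * (t - t)); [| lra].
    apply (lim_le (Fl := at_right t) (fun _ => k x - B * (x - t)) (fun z => k z - B * (z - t))).
    - apply filterlim_const.
    - apply lim_minus; [assumption |]. apply lim_mult; [apply filterlim_const |].
      apply lim_minus; [apply level_at_right | apply filterlim_const].
    - apply (filter_imp (fun z => t < z < x)); [| now apply at_right_interval].
      intros y Hy. apply (nonincreasing_of_derive (fun z => k z - B * (z - t)) (fun z => dk z - B)); [lra | |].
      + intros z Hz. eapply is_derive_value.
        * apply derive_minus; [apply Hdk; lra |].
          apply (derive_mult (fun _ => B) (fun z => z - t)); [apply (is_derive_const (V := R_NormedModule) B) |].
          apply (derive_minus (fun z => z) (fun _ => t));
            [apply (is_derive_id (K := R_AbsRing)) | apply (is_derive_const (V := R_NormedModule) t)].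
        * unfold zero, one; simpl. ring.
      + intros z Hz. specialize (HBk z). lra. }
  apply Rabs_le. split.
  - assert (A : - g x <= B * (x - t)); [| lra].
    apply (Hs (fun z => - g z) (fun z => - dg z)).
    + replace 0 with (- 0) by ring. now apply lim_opp.
    + intros z Hz. apply (is_derive_opp g), Hd, Hz.
    + intros z Hz. specialize (HB z Hz). apply Rabs_le_between in HB. lra.
  - apply (Hs g dg); [assumption | assumption |].
    intros z Hz. specialize (HB z Hz). apply Rabs_le_between in HB. lra.
Qed.

Lemma lipschitz_near (g dg : R -> R) (m : R) :
  locally m (fun x => is_derive g x (dg x)) -> continuous dg m ->
  exists L eta, 0 < L /\ 0 < eta /\ forall x y, Rabs (x - m) < eta -> Rabs (y - m) < eta ->
    Rabs (g x - g y) <= L * Rabs (x - y).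
Proof.
  intros [e1 He1] Hc.
  destruct (Hc (ball (dg m) (mkposreal 1 Rlt_0_1)) (locally_ball (dg m) _)) as [e2 He2].
  set (L := Rabs (dg m) + 1). set (eta := Rmin e1 e2).
  assert (HL : 0 < L) by (unfold L; assert (A := Rabs_pos (dg m)); lra).
  assert (E1 : eta <= e1) by apply Rmin_l. assert (E2 : eta <= e2) by apply Rmin_r.
  exists L, eta. split; [assumption |].
  split; [apply Rmin_pos; apply cond_pos |].
  assert (Hd : forall z, Rabs (z - m) < eta -> is_derive g z (dg z) /\ - L <= dg z <= L).
  { intros z Hz. split; [apply He1; change (Rabs (z - m) < e1); lra |].
    assert (A : Rabs (dg z - dg m) < 1) by (apply He2; change (Rabs (z - m) < e2); lra).
    apply Rabs_le_between. unfold L.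
    assert (C := Rabs_triang (dg z - dg m) (dg m)).
    replace (dg z - dg m + dg m) with (dg z) in C by ring. lra. }
  assert (Hle : forall x y, x <= y -> Rabs (x - m) < eta -> Rabs (y - m) < eta ->
    Rabs (g x - g y) <= L * (y - x)).
  { intros x y Hxy Hx Hy. apply Rabs_lt_between in Hx. apply Rabs_lt_between in Hy.
    assert (Hz : forall z, x <= z <= y -> is_derive g z (dg z) /\ - L <= dg z <= L).
    { intros z Hz. apply Hd, Rabs_lt_between. lra. }
    assert (DL : forall (s : R) z, is_derive (fun t => s * t) z s) by (intros s z; auto_derive; [exact I | ring]).
    assert (A : g y - L * y <= g x - L * x).
    { apply (nonincreasing_of_derive (fun t => g t - L * t) (fun t => dg t - L)); [assumption | |].
      - intros z Hzz. apply derive_minus; [now apply Hz | apply DL].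
      - intros z Hzz. destruct (Hz z); lra. }
    assert (C : g x + L * x <= g y + L * y).
    { apply (nondecreasing_of_derive (fun t => g t + L * t) (fun t => dg t + L)); [assumption | |].
      - intros z Hzz. apply derive_plus; [now apply Hz | apply DL].
      - intros z Hzz. destruct (Hz z); lra. }
    apply Rabs_le. lra. }
  intros x y Hx Hy. destruct (Rle_or_lt x y) as [H | H].
  - rewrite (Rabs_minus_sym x y), (Rabs_pos_eq (y - x)) by lra. now apply Hle.
  - rewrite Rabs_minus_sym, (Rabs_pos_eq (x - y)) by lra. apply Hle; [lra | assumption | assumption].
Qed.

Section Uniqueness.
Context {c : Rbar} {q dq Q H f F : R -> R} {Hinf b beta : R}.
Context (Wt : weight q dq Q H Hinf) (Fo : force c f F b beta) (HF0 : F 0 = 0).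
Context (hf : forall s, in_dom c s -> continuous f s) (hf2 : cond_f2 c f).
Context {v1 dv1 v2 dv2 : R -> R} (M1 : motion c q dq f v1 dv1) (M2 : motion c q dq f v2 dv2).

Lemma force_lipschitz (m : R) : m <> 0 -> in_dom c m ->
  exists L eta, 0 < L /\ 0 < eta /\ forall x y, Rabs (x - m) < eta -> Rabs (y - m) < eta ->
    in_dom c x -> in_dom c y -> Rabs (f x - f y) <= L * Rabs (x - y).
Proof.
  assert (Hpos : forall m, 0 < m -> in_dom c m ->
    exists L eta, 0 < L /\ 0 < eta /\ forall x y, Rabs (x - m) < eta -> Rabs (y - m) < eta ->
      Rabs (f x - f y) <= L * Rabs (x - y)).
  { intros s Hs Hd. destruct (in_dom_open s Hd) as (k & Hk & Hdk). rewrite Rabs_pos_eq in Hk by lra.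
    apply (lipschitz_near f (Derive f)).
    - assert (He : 0 < Rmin s (k - s)) by (apply Rmin_pos; lra).
      exists (mkposreal _ He). intros y Hy. change (Rabs (y - s) < Rmin s (k - s)) in Hy.
      assert (X1 := Rmin_l s (k - s)). assert (X2 := Rmin_r s (k - s)). apply Rabs_lt_between in Hy.
      apply Derive_correct, (f2_derivable _ _ hf2); [lra |].
      apply in_dom_pos; [lra |]. apply (in_dom_le k); [assumption |]. rewrite !Rabs_pos_eq; lra.
    - apply (f2_continuous _ _ hf2); [assumption |]. apply in_dom_pos; [lra | assumption]. }
  intros Hm Hd. destruct (Rlt_or_le 0 m) as [Hp | Hn].
  - destruct (Hpos m Hp Hd) as (L & eta & HL & He & HH). exists L, eta.
    split; [assumption |]. split; [assumption |]. intros. now apply HH.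
  - destruct (Hpos (- m)) as (L & eta & HL & He & HH); [lra | now apply in_dom_opp |].
    exists L, eta. split; [assumption |]. split; [assumption |].
    intros x y Hx Hy Hdx Hdy.
    replace (f x - f y) with (- (f (- x) - f (- y))) by (rewrite !(fo_odd Fo) by assumption; ring).
    replace (x - y) with (- (- x - - y)) by ring. rewrite !Rabs_Ropp.
    apply HH.
    + replace (- x - - m) with (- (x - m)) by ring. now rewrite Rabs_Ropp.
    + replace (- y - - m) with (- (y - m)) by ring. now rewrite Rabs_Ropp.
Qed.

Lemma eventually_near (g : R -> R) (t m eta : R) : filterlim g (at_right t) (locally m) -> 0 < eta ->
  exists d, 0 < d /\ forall x, t < x < t + d -> Rabs (g x - m) < eta.
Proof.
  intros Hg He. destruct (Hg (ball m (mkposreal eta He)) (locally_ball m _)) as [d Hd].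
  exists d. split; [apply cond_pos |]. intros x Hx.
  apply (Hd x); [| lra]. change (Rabs (x - t) < d). apply Rabs_lt_between.
  assert (A := cond_pos d). lra.
Qed.

Local Notation D := (fun x => v1 x - v2 x).

(** Off the level 0 the force is Lipschitz. Integrating the flux q v' instead of v'
    gives an estimate that does not see the singularity of q' / q at r = 0. *)
Lemma agree_beyond_nonzero (t m : R) : 0 <= t -> m <> 0 -> in_dom c m ->
  filterlim v1 (at_right t) (locally m) -> filterlim v2 (at_right t) (locally m) ->
  filterlim (fun x => q x * dv1 x - q x * dv2 x) (at_right t) (locally 0) ->
  exists d, 0 < d /\ forall x, t < x < t + d -> v1 x = v2 x.
Proof.
  intros Ht Hm Hdm L1 L2 LW.
  destruct (force_lipschitz m Hm Hdm) as (L & eta & HL & He & HLip).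
  destruct (eventually_near v1 t m eta L1 He) as (d1 & Hd1 & N1).
  destruct (eventually_near v2 t m eta L2 He) as (d2 & Hd2 & N2).
  set (d := Rmin (Rmin d1 d2) (Rmin 1 (/ (2 * L)))).
  assert (Hinv : 0 < / (2 * L)) by (apply Rinv_0_lt_compat; lra).
  assert (Hd : 0 < d) by (unfold d; repeat apply Rmin_pos; lra).
  assert (E1 : d <= d1) by (eapply Rle_trans; [apply Rmin_l | apply Rmin_l]).
  assert (E2 : d <= d2) by (eapply Rle_trans; [apply Rmin_l | apply Rmin_r]).
  assert (E3 : d <= 1) by (eapply Rle_trans; [apply Rmin_r | apply Rmin_l]).
  assert (E4 : d <= / (2 * L)) by (eapply Rle_trans; [apply Rmin_r | apply Rmin_r]).
  assert (HLd : L * d * d <= / 2).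
  { apply Rle_trans with (L * / (2 * L) * 1); [| apply Req_le; field; lra].
    apply Rmult_le_compat; [apply Rmult_le_pos; lra | lra | apply Rmult_le_compat_l; lra | lra]. }
  exists d. split; [assumption |].
  assert (LD : filterlim D (at_right t) (locally 0)).
  { replace 0 with (m - m) by ring. now apply lim_minus. }
  assert (Hall : forall x, t < x < t + d -> Rabs (D x) <= 0).
  { apply (halving (K0 := 2 * eta)).
    - intros x Hx. assert (A := N1 x ltac:(lra)). assert (B := N2 x ltac:(lra)).
      apply Rabs_lt_between in A. apply Rabs_lt_between in B. apply Rabs_le. lra.
    - intros K HK x Hx.
      assert (HK0 : 0 <= K) by (specialize (HK x Hx); assert (A := Rabs_pos (D x)); lra).
      assert (HdD : forall y, t < y < t + d -> Rabs (dv1 y - dv2 y) <= L * K * d).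
      { intros y Hy. assert (Qy : 0 < q y) by (apply (w_pos Wt); lra).
        assert (W : Rabs (q y * dv1 y - q y * dv2 y) <= q y * (L * K) * (y - t)).
        { apply (small_from_start (fun x => q x * dv1 x - q x * dv2 x)
            (fun x => - (q x * f (v1 x)) - - (q x * f (v2 x)))); [lra | assumption | |].
          - intros z Hz. apply derive_minus; [apply (motion_flux_derive Wt M1) | apply (motion_flux_derive Wt M2)]; lra.
          - intros z Hz. assert (Qz : 0 < q z) by (apply (w_pos Wt); lra).
            replace (- (q z * f (v1 z)) - - (q z * f (v2 z))) with (- (q z * (f (v1 z) - f (v2 z)))) by ring.
            rewrite Rabs_Ropp, Rabs_mult, (Rabs_pos_eq (q z)) by lra.
            apply Rmult_le_compat; [lra | apply Rabs_pos | apply (weight_monotone Wt); lra |].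
            eapply Rle_trans.
            + apply HLip; [apply N1; lra | apply N2; lra | apply (mo_dom M1); lra | apply (mo_dom M2); lra].
            + apply Rmult_le_compat_l; [lra |]. apply HK. lra. }
        replace (q y * dv1 y - q y * dv2 y) with (q y * (dv1 y - dv2 y)) in W by ring.
        rewrite Rabs_mult, (Rabs_pos_eq (q y)) in W by lra.
        apply (Rmult_le_reg_l (q y)); [assumption |]. eapply Rle_trans; [exact W |].
        rewrite Rmult_assoc. apply Rmult_le_compat_l; [lra |].
        apply Rmult_le_compat_l; [apply Rmult_le_pos; lra | lra]. }
      eapply Rle_trans.
      + apply (small_from_start D (fun z => dv1 z - dv2 z) t x (L * K * d)); [lra | assumption | |].
        * intros z Hz. apply derive_minus; [apply (mo_der M1) | apply (mo_der M2)]; lra.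
        * intros z Hz. apply HdD. lra.
      + apply Rle_trans with (L * K * d * d).
        * apply Rmult_le_compat_l; [| lra]. repeat apply Rmult_le_pos; lra.
        * replace (L * K * d * d) with (K * (L * d * d)) by ring.
          apply Rmult_le_compat_l; lra. }
  intros x Hx. assert (A := Hall x Hx). cbv beta in A. apply Rabs_le_between in A. lra.
Qed.

(** At the level 0 only the potential is Lipschitz. The difference of the squared
    speeds is therefore read off from the energies, and it controls the difference of
    the speeds since these do not vanish. *)
Lemma agree_beyond_simple_zero (t w : R) : 0 < t -> w <> 0 ->
  v1 t = 0 -> v2 t = 0 -> dv1 t = w -> dv2 t = w ->
  exists d, 0 < d /\ forall x, t < x < t + d -> v1 x = v2 x.
Proof.
  intros Ht Hw V1 V2 W1 W2.
  assert (Hd0 : in_dom c 0) by (rewrite <- V1; apply (mo_dom M1); lra).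
  destruct (lipschitz_near F f 0) as (C & eta & HC & He & HLip).
  { destruct (in_dom_open 0 Hd0) as (k & Hk & Hdk). rewrite Rabs_R0 in Hk.
    exists (mkposreal k Hk). intros y Hy. change (Rabs (y - 0) < k) in Hy. rewrite Rminus_0_r in Hy.
    apply (fo_prim Fo), (in_dom_le k); [assumption |]. rewrite (Rabs_pos_eq k); lra. }
  { now apply hf. }
  assert (Ha : 0 < Rabs w) by now apply Rabs_pos_lt.
  assert (LV : forall v dv, motion c q dq f v dv -> filterlim v (at_right t) (locally (v t)))
    by (intros v dv M; apply continuous_at_right, (motion_continuous M), Ht).
  assert (LdV : forall v dv, motion c q dq f v dv -> filterlim dv (at_right t) (locally (dv t)))
    by (intros v dv M; apply continuous_at_right, (motion_speed_continuous M), Ht).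
  assert (LV1 := LV _ _ M1). assert (LV2 := LV _ _ M2). rewrite V1 in LV1. rewrite V2 in LV2.
  assert (Ld1 := LdV _ _ M1). assert (Ld2 := LdV _ _ M2). rewrite W1 in Ld1. rewrite W2 in Ld2.
  destruct (eventually_near v1 t 0 eta LV1 He) as (d1 & Hd1 & N1).
  destruct (eventually_near v2 t 0 eta LV2 He) as (d2 & Hd2 & N2).
  destruct (eventually_near dv1 t w (Rabs w / 2) Ld1 ltac:(lra)) as (d3 & Hd3 & N3).
  destruct (eventually_near dv2 t w (Rabs w / 2) Ld2 ltac:(lra)) as (d4 & Hd4 & N4).
  set (Y := fun x => total F v1 dv1 x - total F v2 dv2 x).
  set (S := fun x => dv1 x * dv1 x - dv2 x * dv2 x).
  set (p := dq t / q t).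
  assert (Hp : 0 < p) by (apply Rdiv_lt_0_compat; [apply (w_dpos Wt) | apply (w_pos Wt)]; assumption).
  set (B := 2 * (1 + C) * (p + / Rabs w)).
  assert (Hiw : 0 < / Rabs w) by now apply Rinv_0_lt_compat.
  assert (HB : 0 < B) by (unfold B; repeat apply Rmult_lt_0_compat; lra).
  set (d := Rmin (Rmin d1 d2) (Rmin (Rmin d3 d4) (/ (2 * B)))).
  assert (Hinv : 0 < / (2 * B)) by (apply Rinv_0_lt_compat; lra).
  assert (Hd : 0 < d) by (unfold d; repeat apply Rmin_pos; lra).
  assert (E1 : d <= d1) by (eapply Rle_trans; [apply Rmin_l | apply Rmin_l]).
  assert (E2 : d <= d2) by (eapply Rle_trans; [apply Rmin_l | apply Rmin_r]).
  assert (E3 : d <= d3) by (eapply Rle_trans; [apply Rmin_r |]; eapply Rle_trans; [apply Rmin_l | apply Rmin_l]).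
  assert (E4 : d <= d4) by (eapply Rle_trans; [apply Rmin_r |]; eapply Rle_trans; [apply Rmin_l | apply Rmin_r]).
  assert (E5 : d <= / (2 * B)) by (eapply Rle_trans; [apply Rmin_r | apply Rmin_r]).
  assert (HBd : B * d <= / 2).
  { apply Rle_trans with (B * / (2 * B)); [apply Rmult_le_compat_l; lra | apply Req_le; field; lra]. }
  exists d. split; [assumption |].
  assert (LD : filterlim D (at_right t) (locally 0)).
  { replace 0 with (0 - 0) by ring. now apply lim_minus. }
  assert (LY : filterlim Y (at_right t) (locally 0)).
  { assert (Y0 : Y t = 0) by (unfold Y, total; rewrite V1, V2, W1, W2; ring). rewrite <- Y0.
    apply continuous_at_right. eapply is_derive_continuous. unfold Y.
    apply derive_minus; [apply (total_derive Wt Fo M1 _ Ht) | apply (total_derive Wt Fo M2 _ Ht)]. }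
  assert (Hall : forall x, t < x < t + d -> Rmax (Rabs (D x)) (Rabs (Y x)) <= 0).
  { apply (halving (K0 := Rmax (2 * eta) (B + 2 * eta * C + (3 * Rabs w) * (3 * Rabs w)))).
    - intros x Hx. assert (A1 := N1 x ltac:(lra)). assert (A2 := N2 x ltac:(lra)).
      assert (A3 := N3 x ltac:(lra)). assert (A4 := N4 x ltac:(lra)).
      assert (HLx := HLip (v1 x) (v2 x) A1 A2).
      rewrite Rminus_0_r in A1, A2.
      assert (HD : Rabs (D x) <= 2 * eta).
      { apply Rabs_lt_between in A1. apply Rabs_lt_between in A2. apply Rabs_le. lra. }
      apply Rmax_lub; [eapply Rle_trans; [exact HD | apply Rmax_l] |].
      eapply Rle_trans; [| apply Rmax_r].
      assert (Sq : forall z, Rabs (z - w) < Rabs w / 2 -> 0 <= z * z <= (3 * Rabs w) * (3 * Rabs w)).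
      { intros z Hz. assert (A : Rabs z <= 3 * Rabs w).
        { assert (T := Rabs_triang (z - w) w). replace (z - w + w) with z in T by ring. lra. }
        split; [nra |]. replace (z * z) with (Rabs z * Rabs z) by (rewrite <- Rabs_mult, Rabs_pos_eq; nra).
        apply Rmult_le_compat; try apply Rabs_pos; assumption. }
      assert (B1 := Sq _ A3). assert (B2 := Sq _ A4).
      assert (Rabs (F (v1 x) - F (v2 x)) <= 2 * eta * C).
      { eapply Rle_trans; [exact HLx |]. rewrite (Rmult_comm (2 * eta)). apply Rmult_le_compat_l; [lra | exact HD]. }
      unfold Y, total. apply Rabs_le_between in H0. apply Rabs_le. lra.
    - intros K HK x Hx.
      assert (HK0 : 0 <= K).
      { assert (A := HK x Hx). assert (A' := Rabs_pos (D x)). assert (A'' := Rmax_l (Rabs (D x)) (Rabs (Y x))). lra. }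
      assert (HS : forall y, t < y < t + d -> Rabs (S y) <= 2 * (1 + C) * K).
      { intros y Hy. assert (A := HK y Hy).
        assert (X1 := Rmax_l (Rabs (D y)) (Rabs (Y y))). assert (X2 := Rmax_r (Rabs (D y)) (Rabs (Y y))).
        assert (HLy := HLip (v1 y) (v2 y) (N1 y ltac:(lra)) (N2 y ltac:(lra))).
        assert (HCK : C * Rabs (D y) <= C * K) by (apply Rmult_le_compat_l; lra).
        assert (Rabs (F (v1 y) - F (v2 y)) <= C * K) by (cbv beta in HCK; lra).
        assert (X3 : Rabs (Y y) <= K) by lra.
        replace (S y) with (2 * Y y - 2 * (F (v1 y) - F (v2 y))) by (unfold S, Y, total; field).
        apply Rabs_le_between in H0. apply Rabs_le_between in X3. apply Rabs_le. lra. }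
      assert (Hsum : forall a, 0 <= a <= p + / Rabs w -> a * (2 * (1 + C) * K) * (x - t) <= K / 2).
      { intros a Ha'. apply Rle_trans with (B * K * d).
        - apply Rmult_le_compat; [repeat apply Rmult_le_pos; lra | lra | | lra].
          unfold B. replace (2 * (1 + C) * (p + / Rabs w) * K) with ((p + / Rabs w) * (2 * (1 + C) * K)) by ring.
          apply Rmult_le_compat_r; [repeat apply Rmult_le_pos; lra | lra].
        - replace (B * K * d) with (K * (B * d)) by ring.
          apply Rle_trans with (K * / 2); [apply Rmult_le_compat_l; lra | lra]. }
      apply Rmax_lub.
      + eapply Rle_trans; [| apply (Hsum (/ Rabs w)); lra].
        apply (small_from_start D (fun z => dv1 z - dv2 z)); [lra | assumption | |].
        * intros z Hz. apply derive_minus; [apply (mo_der M1) | apply (mo_der M2)]; lra.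
        * intros z Hz. assert (A := HS z ltac:(lra)).
          assert (A3 := N3 z ltac:(lra)). assert (A4 := N4 z ltac:(lra)).
          assert (Hsm : Rabs w <= Rabs (dv1 z + dv2 z)).
          { assert (T1 := Rabs_triang_inv (2 * w) (2 * w - (dv1 z + dv2 z))).
            replace (2 * w - (2 * w - (dv1 z + dv2 z))) with (dv1 z + dv2 z) in T1 by ring.
            rewrite Rabs_mult, (Rabs_pos_eq 2) in T1 by lra.
            assert (T2 := Rabs_triang (w - dv1 z) (w - dv2 z)).
            replace (w - dv1 z + (w - dv2 z)) with (2 * w - (dv1 z + dv2 z)) in T2 by ring.
            rewrite (Rabs_minus_sym w), (Rabs_minus_sym w) in T2. lra. }
          apply (Rmult_le_reg_l (Rabs w)); [assumption |].
          replace (Rabs w * (/ Rabs w * (2 * (1 + C) * K))) with (2 * (1 + C) * K) by (field; lra).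
          eapply Rle_trans; [| exact A]. unfold S.
          replace (dv1 z * dv1 z - dv2 z * dv2 z) with ((dv1 z + dv2 z) * (dv1 z - dv2 z)) by ring.
          rewrite Rabs_mult. apply Rmult_le_compat_r; [apply Rabs_pos | assumption].
      + eapply Rle_trans; [| apply (Hsum p); lra].
        apply (small_from_start Y (fun z => - (dq z / q z * (dv1 z * dv1 z)) - - (dq z / q z * (dv2 z * dv2 z))));
          [lra | assumption | |].
        * intros z Hz. apply derive_minus; [apply (total_derive Wt Fo M1) | apply (total_derive Wt Fo M2)]; lra.
        * intros z Hz. assert (A := HS z ltac:(lra)).
          assert (Hpz : 0 < dq z / q z) by (apply Rdiv_lt_0_compat; [apply (w_dpos Wt) | apply (w_pos Wt)]; lra).
          assert (Hpm : dq z / q z <= p) by (apply (w_logder Wt); lra).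
          replace (- (dq z / q z * (dv1 z * dv1 z)) - - (dq z / q z * (dv2 z * dv2 z)))
            with (- (dq z / q z * S z)) by (unfold S; ring).
          rewrite Rabs_Ropp, Rabs_mult, (Rabs_pos_eq (dq z / q z)) by lra.
          apply Rmult_le_compat; [lra | apply Rabs_pos | assumption | assumption]. }
  intros x Hx. assert (A := Hall x Hx). assert (X1 := Rmax_l (Rabs (D x)) (Rabs (Y x))).
  assert (X2 : Rabs (D x) <= 0) by lra. cbv beta in X2. apply Rabs_le_between in X2. lra.
Qed.

(** At the end of the interval of agreement the common level is nonzero, or it is 0
    with nonzero speed, or both solutions are at rest at 0. *)
Lemma motions_agree : 0 < v1 0 -> v1 0 = v2 0 -> forall r, 0 <= r -> v1 r = v2 r.
Proof.
  intros Hpos H0 r Hr. destruct (Req_dec (v1 r) (v2 r)) as [| Hne]; [assumption | exfalso].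
  destruct (completeness (fun x => 0 <= x /\ forall y, 0 <= y <= x -> v1 y = v2 y)) as (t & Hub & Hlub).
  { exists r. intros x [Hx Hagree]. apply Rnot_lt_le. intros Hlt. apply Hne, Hagree. lra. }
  { exists 0. split; [lra |]. intros y Hy. replace y with 0 by lra. assumption. }
  assert (Ht : 0 <= t).
  { apply Hub. split; [lra |]. intros y Hy. replace y with 0 by lra. assumption. }
  assert (Hbefore : forall y, 0 <= y < t -> v1 y = v2 y).
  { intros y Hy. destruct (Req_dec (v1 y) (v2 y)) as [| Hn]; [assumption | exfalso].
    assert (t <= y); [| lra]. apply Hlub. intros x [Hx Hagree].
    apply Rnot_lt_le. intros Hlt. apply Hn, Hagree. lra. }
  assert (Hat : v1 t = v2 t /\ (0 < t -> dv1 t = dv2 t)).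
  { destruct (Rle_lt_or_eq_dec _ _ Ht) as [Hlt | <-]; [| split; [assumption | lra]].
    assert (Hd : forall z, 0 < z < t -> dv1 z = dv2 z).
    { intros z Hz. rewrite <- (is_derive_unique _ _ _ (mo_der M1 z ltac:(lra))).
      rewrite <- (is_derive_unique _ _ _ (mo_der M2 z ltac:(lra))).
      apply Derive_ext_loc.
      assert (He : 0 < Rmin z (t - z)) by (apply Rmin_pos; lra).
      exists (mkposreal _ He). intros y Hy. change (Rabs (y - z) < Rmin z (t - z)) in Hy.
      assert (X1 := Rmin_l z (t - z)). assert (X2 := Rmin_r z (t - z)). apply Rabs_lt_between in Hy.
      apply Hbefore. lra. }
    assert (Hlim : forall g k : R -> R, continuous g t -> continuous k t ->
      (forall z, 0 < z < t -> g z = k z) -> g t = k t).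
    { intros g k Hg Hk Heq.
      apply (filterlim_locally_unique (F := at_left t) g); [now apply continuous_at_left |].
      apply (filterlim_ext_loc k); [| now apply continuous_at_left].
      apply (filter_imp (fun z => 0 < z < t)); [| now apply at_left_interval].
      intros z Hz. symmetry. now apply Heq. }
    split.
    - apply Hlim; [apply (motion_continuous M1) | apply (motion_continuous M2) |]; try assumption.
      intros z Hz. apply Hbefore. lra.
    - intros _. apply Hlim; [apply (motion_speed_continuous M1) | apply (motion_speed_continuous M2) |]; assumption. }
  destruct Hat as [Hvt Hdt].
  assert (Hnext : exists d, 0 < d /\ forall x, t < x < t + d -> v1 x = v2 x).
  { destruct (Req_dec (v1 t) 0) as [Hz | Hz].
    - destruct (Rle_lt_or_eq_dec _ _ Ht) as [Hlt | <-]; [| lra].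
      specialize (Hdt Hlt). destruct (Req_dec (dv1 t) 0) as [Hw | Hw].
      + exists 1. split; [lra |]. intros x Hx.
        assert (T1 : total F v1 dv1 t <= 0) by (unfold total; rewrite Hz, Hw, HF0; lra).
        assert (T2 : total F v2 dv2 t <= 0) by (unfold total; rewrite <- Hvt, <- Hdt, Hz, Hw, HF0; lra).
        rewrite (rest_forever Wt Fo HF0 M1 t Hlt T1) by lra.
        now rewrite (rest_forever Wt Fo HF0 M2 t Hlt T2) by lra.
      + apply (agree_beyond_simple_zero t (dv1 t) Hlt Hw); congruence.
    - apply (agree_beyond_nonzero t (v1 t) Ht Hz (mo_dom M1 t Ht)).
      + destruct (Rle_lt_or_eq_dec _ _ Ht) as [Hlt | <-]; [| apply (mo_start M1)].
        now apply continuous_at_right, (motion_continuous M1).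
      + rewrite Hvt. destruct (Rle_lt_or_eq_dec _ _ Ht) as [Hlt | <-]; [| apply (mo_start M2)].
        now apply continuous_at_right, (motion_continuous M2).
      + destruct (Rle_lt_or_eq_dec _ _ Ht) as [Hlt | <-].
        * replace 0 with (q t * dv1 t - q t * dv2 t) by (rewrite Hdt by assumption; ring).
          apply lim_minus.
          -- apply (continuous_at_right (fun x => q x * dv1 x)).
             exact (is_derive_continuous _ _ _ (motion_flux_derive Wt M1 t Hlt)).
          -- apply (continuous_at_right (fun x => q x * dv2 x)).
             exact (is_derive_continuous _ _ _ (motion_flux_derive Wt M2 t Hlt)).
        * rewrite <- (Rminus_0_r 0) at 2.
          apply lim_minus; apply (flux_lim_start Wt (Rle_refl 0)); [apply (mo_rest M1) | apply (mo_rest M2)]. }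
  destruct Hnext as (d & Hd & Hx).
  assert (t + d / 2 <= t); [| lra].
  apply Hub. split; [lra |]. intros y Hy. destruct (Rtotal_order y t) as [Hl | [-> | Hl]].
  - apply Hbefore. lra.
  - assumption.
  - apply Hx. lra.
Qed.
End Uniqueness.

(** * Comparison of two solutions *)

(** The step for which the two sets of assumptions on f need different arguments. *)
Definition ordered_after_descent (c : Rbar) (q dq f F : R -> R) (beta : R) : Prop :=
  forall (v1 dv1 v2 dv2 r1 rho1 r2 rho2 : R -> R) (lo : R),
  motion c q dq f v1 dv1 -> motion c q dq f v2 dv2 -> lo < beta -> beta < v1 0 -> v1 0 < v2 0 ->
  branch c q dq f F lo (v1 0) r1 rho1 -> branch c q dq f F lo (v2 0) r2 rho2 ->
  rests (at_left (v1 0)) r1 rho1 0 -> rests (at_left (v2 0)) r2 rho2 0 ->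
  first_passage (v := v1) lo r1 -> first_passage (v := v2) lo r2 ->
  leads F r1 rho1 r2 rho2 beta \/ lags q r1 rho1 r2 rho2 beta.

Section Conclusion.
Context {c : Rbar} {q dq Q H f F : R -> R} {Hinf b beta : R}.
Context (Wt : weight q dq Q H Hinf) (Fo : force c f F b beta) (HF0 : F 0 = 0).
Context (Hwinf : forall K, exists M, 0 < M /\ forall r, M < r -> K < q r).
Context (Hcinf : forall eps, 0 < eps -> exists M, 0 < M /\ forall r, M < r -> Q r / (q r * q r) < eps).
Context (Hdesc : ordered_after_descent c q dq f F beta).
Context {v1 dv1 v2 dv2 : R -> R} (M1 : motion c q dq f v1 dv1) (M2 : motion c q dq f v2 dv2).
Context (Hpos : 0 < v1 0) (Hlt : v1 0 < v2 0).

Lemma nonnegative_pair_impossible : nonnegative v1 -> nonnegative v2 -> False.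
Proof.
  intros N1 N2. assert (Hb := fo_b Fo).
  assert (Ha : beta < v1 0) by apply (start_above_beta Wt Fo HF0 M1 Hpos).
  destruct (nonnegative_profile Wt Fo HF0 Hwinf Hcinf M1 Hpos N1) as (r1 & rho1 & B1 & P1 & S1 & _).
  destruct (nonnegative_profile Wt Fo HF0 Hwinf Hcinf M2 ltac:(lra) N2) as (r2 & rho2 & B2 & P2 & S2 & D2).
  assert (C2 := branch_sub 0 (v1 0) B2 (Rle_refl 0) (Rlt_le _ _ Hlt)).
  apply (two_tails_impossible Wt Fo B1 C2 D2 Ha).
  destruct (Hdesc v1 dv1 v2 dv2 r1 rho1 r2 rho2 0) as [Hl | Hl]; try assumption; try lra.
  - now left.
  - right. split; [apply Hl |]. apply (lags_ratio Wt B1 C2); [lra | assumption].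
Qed.

Lemma sign_changing_motions_impossible : growth c f F beta (1 / 2 - Hinf) ->
  one_sign_change v1 -> one_sign_change v2 -> False.
Proof.
  intros Gr N1 N2. assert (Hb := fo_b Fo).
  assert (Ha : beta < v1 0) by apply (start_above_beta Wt Fo HF0 M1 Hpos).
  destruct (sign_changing_profile Wt Fo HF0 Hwinf Hcinf M1 Hpos N1)
    as (mu1 & t1 & r1 & rho1 & s1 & sg1 & Hm1 & Hd1 & Ht1 & B1 & P1 & S1 & L1 & A1 & K1 & _).
  destruct (sign_changing_profile Wt Fo HF0 Hwinf Hcinf M2 ltac:(lra) N2)
    as (mu2 & t2 & r2 & rho2 & s2 & sg2 & Hm2 & Hd2 & Ht2 & B2 & P2 & S2 & L2 & A2 & K2 & D2).
  set (lo := Rmax (- mu1) (- mu2)).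
  assert (X1 : - mu1 <= lo) by apply Rmax_l. assert (X2 : - mu2 <= lo) by apply Rmax_r.
  assert (X3 : lo < beta) by (apply Rmax_lub_lt; lra).
  refine (sign_changing_pair_impossible Wt Fo Gr B1 B2 Hm1 Hm2 Ha _ Hd1 Hd2 Ht1 Ht2 L1 L2 _
    A1 A2 K1 K2 D2); [lra |].
  apply (Hdesc v1 dv1 v2 dv2 r1 rho1 r2 rho2 lo); try assumption.
  - apply (branch_sub lo (v1 0) B1 X1 (Rle_refl _)).
  - apply (branch_sub lo (v2 0) B2 X2 (Rle_refl _)).
  - intros s Hs. apply P1. lra.
  - intros s Hs. apply P2. lra.
Qed.
End Conclusion.

Section Assembly.
Context {c : Rbar} {f q : R -> R} {b beta Hinf linf : R}.
Context (hf : forall s, in_dom c s -> continuous f s).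
Context (hf1 : cond_f1 c f b beta) (hf2 : cond_f2 c f).
Context (hq1 : cond_q1 q) (hq2 : cond_q2 q) (hq3 : cond_q3 q Hinf) (hq4 : cond_q4 q linf) (hq5 : cond_q5 q).

Lemma at_most_one_of_start_order (P : (R -> R) -> Prop) :
  (forall u v du dv, P u -> P v -> motion c q (Derive q) f u du -> motion c q (Derive q) f v dv ->
    0 < u 0 -> u 0 < v 0 -> False) ->
  at_most_one_on_Rplus (fun u => is_solution c f q u /\ 0 < u 0 /\ P u).
Proof.
  intros HP u v (Su & Pu & Cu) (Sv & Pv & Cv).
  assert (Wt := weight_of_conditions hq1 hq2 hq3 hq5).
  destruct (motion_of_solution u (w_pos Wt) (w_der Wt) Su) as [du Mu].
  destruct (motion_of_solution v (w_pos Wt) (w_der Wt) Sv) as [dv Mv].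
  destruct (Rtotal_order (u 0) (v 0)) as [Hl | [He | Hg]].
  - destruct (HP u v du dv); assumption.
  - exact (motions_agree Wt (force_of_conditions hf hf1) potential_zero hf hf2 Mu Mv Pu He).
  - destruct (HP v u dv du); assumption.
Qed.

Lemma uniqueness_of_descent_order : growth c f (primitive f) beta (1 / 2 - Hinf) ->
  ordered_after_descent c q (Derive q) f (primitive f) beta ->
  at_most_one_on_Rplus (fun u => is_solution c f q u /\ 0 < u 0 /\ nonnegative u) /\
  at_most_one_on_Rplus (fun u => is_solution c f q u /\ 0 < u 0 /\ one_sign_change u).
Proof.
  intros Gr Hdesc.
  assert (Wt := weight_of_conditions hq1 hq2 hq3 hq5). assert (Fo := force_of_conditions hf hf1).
  assert (W1 := weight_unbounded hq1 hq4). assert (W2 := weight_ratio_sq_vanishes hq1 hq4).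
  split; apply at_most_one_of_start_order; intros u v du dv Pu Pv Mu Mv H0 Hlt.
  - exact (nonnegative_pair_impossible Wt Fo potential_zero W1 W2 Hdesc Mu Mv H0 Hlt Pu Pv).
  - exact (sign_changing_motions_impossible Wt Fo potential_zero W1 W2 Hdesc Mu Mv H0 Hlt Gr Pu Pv).
Qed.

Lemma descent_order_sublinear :
  (forall s, b <= s -> Rbar_lt s c -> Derive f s * (s - b) <= f s) ->
  ordered_after_descent c q (Derive q) f (primitive f) beta.
Proof.
  intros Hsub v1 dv1 v2 dv2 r1 rho1 r2 rho2 lo M1 M2 Hlo Ha Hlt B1 B2 S1 S2 P1 P2. left.
  eapply (first_descent_sublinear (weight_of_conditions hq1 hq2 hq3 hq5) (force_of_conditions hf hf1)
    B1 B2 Hlo Ha Hlt (mo_dom M1 0 (Rle_refl 0)) S1 M1 M2); try reflexivity; try assumption.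
  intros s t Hs Hst Ht. now apply (sublinear_slope hf1 hf2).
Qed.

Lemma descent_order_superlinear :
  (forall s1 s2, b < s1 -> s1 <= s2 -> Rbar_lt s2 c ->
    s2 * Derive f s2 / f s2 <= s1 * Derive f s1 / f s1) ->
  beta * Derive f beta / f beta <= 1 + 2 * linf ->
  ordered_after_descent c q (Derive q) f (primitive f) beta.
Proof.
  intros Hmono Hbeta v1 dv1 v2 dv2 r1 rho1 r2 rho2 lo M1 M2 Hlo Ha Hlt B1 B2 S1 S2 P1 P2.
  exact (first_descent_superlinear (weight_of_conditions hq1 hq2 hq3 hq5) (force_of_conditions hf hf1)
    B1 B2 Hlo Ha Hlt (mo_dom M1 0 (Rle_refl 0)) S1 (tail_weight_of_conditions hq1 hq3 hq4)
    (elastic_of_conditions hf1 hf2 Hmono Hbeta) S2).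
Qed.
End Assembly.

Theorem theorem3 (c : Rbar) (f q : R -> R) (b beta Hinf linf : R)
  (hc : Rbar_lt 0 c)
  (hf : forall s, in_dom c s -> continuous f s)
  (hf1 : cond_f1 c f b beta)
  (hf2 : cond_f2 c f)
  (hq1 : cond_q1 q)
  (hq2 : cond_q2 q)
  (hq3 : cond_q3 q Hinf)
  (hq4 : cond_q4 q linf)
  (hq5 : cond_q5 q) :
  ((forall s, beta < s -> Rbar_lt s c ->
      1 / 2 * (1 - 2 * Hinf) <= Derive (fun t => primitive f t / f t) s) ->
   (forall s, b <= s -> Rbar_lt s c -> Derive f s * (s - b) <= f s) ->
   at_most_one_on_Rplus
     (fun u => is_solution c f q u /\ 0 < u 0 /\ nonnegative u) /\
   at_most_one_on_Rplus
     (fun u => is_solution c f q u /\ 0 < u 0 /\ one_sign_change u))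
  /\
  ((forall s1 s2, b < s1 -> s1 <= s2 -> Rbar_lt s2 c ->
      s2 * Derive f s2 / f s2 <= s1 * Derive f s1 / f s1) ->
   beta * Derive f beta / f beta <= 1 + 2 * linf ->
   at_most_one_on_Rplus
     (fun u => is_solution c f q u /\ 0 < u 0 /\ nonnegative u) /\
   at_most_one_on_Rplus
     (fun u => is_solution c f q u /\ 0 < u 0 /\ one_sign_change u)).
Proof.
  assert (Hh : 0 < Hinf < 1 / 2).
  { split; [apply (q3_Hinf_pos _ _ hq3) |].
    apply Rle_lt_trans with (Hfun q 1); [exact (H_above_limit hq3 1 Rlt_0_1) |].
    exact (w_Hhalf (weight_of_conditions hq1 hq2 hq3 hq5) 1 Rlt_0_1). }
  assert (Hb := fo_b (force_of_conditions hf hf1)).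
  split; intros Hyp1 Hyp2; apply (uniqueness_of_descent_order hf hf1 hf2 hq1 hq2 hq3 hq4 hq5).
  - apply (growth_of_outer_bound hf hf1 hf2); [lra |]. intros s Hs Hd.
    rewrite <- (is_derive_unique _ _ _ (potential_ratio_derive hf hf1 hf2 s ltac:(lra) Hd)).
    apply Rle_trans with (1 / 2 * (1 - 2 * Hinf)); [lra |].
    apply Hyp1; [assumption |]. apply in_dom_pos; [lra | assumption].
  - now apply (descent_order_sublinear hf hf1 hf2 hq1 hq2 hq3 hq5).
  - apply (growth_of_elasticity hf hf1 hf2 (l := linf)); try assumption.
    apply (limit_slopes hq1 hq2 hq3 hq4 hq5).
  - now apply (descent_order_superlinear hf hf1 hf2 hq1 hq2 hq3 hq4 hq5).
Qed.
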